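(* Let $n\ge 2$ be an integer and $\nu=n/2-1$. Let $\varphi$ be a complex-valued infinitely differentiable function on $(0,\infty)$ such that $\varphi(s)=0$ for $s\ge1$. Suppose there are $\mu\in\mathbb{C}$ with $\operatorname{Re}(\mu+\nu)>-1$ and complex numbers $c_0,c_1,c_2,\dots$ with $c_0\ne0$ such that for every $j=0,1,2,\dots$ $$\varphi^{(j)}(s)\sim\sum_{k=0}^{\infty}c_k\frac{d^{j}}{ds^{j}}s^{\mu+k},\qquad s\to+0 .$$ Then $$f(x)=|x|^{-n/2}\varphi(|x|)\chi_{[0,1]}(|x|),\qquad x\in\mathbb{R}^n,$$ where $\chi_{[0,1]}$ is the indicator function of $[0,1]$, is an invertible distribution if and only if the set $$K_n=\Bigl\{k\in\mathbb{N}_0;\ c_k\ne0,\ \tfrac12\bigl(\mu+k-(n/2-1)-1\bigr)\notin\mathbb{N}_0\Bigr\}$$ is non-empty.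
   Context: $\mathbb{N}_0$ is the set of nonnegative integers. The Fourier transform of a compactly supported distribution $u\in\mathcal{E}'(\mathbb{R}^n)$ is $\hat u(\zeta)=\langle u(x),e^{-i\zeta\cdot x}\rangle$, an entire function of $\zeta\in\mathbb{C}^n$. A distribution $u\in\mathcal{E}'(\mathbb{R}^n)$ is called invertible if there is a constant $A>0$ such that $$\sup\{|\hat u(\eta)|;\ \eta\in\mathbb{R}^n,\ |\eta-\xi|<A\log(2+|\xi|)\}>(A+|\xi|)^{-A}\quad\text{for all }\xi\in\mathbb{R}^n .$$ (By a known theorem of Ehrenpreis and Hörmander this is equivalent to surjectivity of the convolution map $u*\colon\mathcal{C}^\infty(\mathbb{R}^n)\to\mathcal{C}^\infty(\mathbb{R}^n)$, and to surjectivity of $u*\colon\mathcal{D}'(\mathbb{R}^n)\to\mathcal{D}'(\mathbb{R}^n)$.) The asymptotic expansion $\varphi^{(j)}(s)\sim\sum_{k\ge0}c_k\frac{d^j}{ds^j}s^{\mu+k}$ as $s\to+0$ means that for every integer $M\ge0$, $\varphi^{(j)}(s)-\sum_{k=0}^{M-1}c_k\frac{d^j}{ds^j}s^{\mu+k}=O(s^{\operatorname{Re}\mu+M-j})$ as $s\to+0$. Individual coefficients $c_k$ with $k\ge1$ may vanish. Complex powers of positive reals are $x^{a}=e^{a\log x}$. The function $f$ is defined almost everywhere and regarded as a compactly supported distribution. *)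

(* Defs.v *)
From HB Require Import structures.
From mathcomp Require Import all_boot all_order all_algebra.
From mathcomp Require Import all_classical all_reals all_analysis.
From mathcomp Require Import complex.

Set Implicit Arguments.
Unset Strict Implicit.
Unset Printing Implicit Defensive.

Import Order.TTheory GRing.Theory Num.Theory.
Import numFieldNormedType.Exports.

Local Open Scope classical_set_scope.
Local Open Scope ring_scope.
Local Open Scope complex_scope.

(* Real and imaginary parts and modulus with values in R, as opposed to 'Re, 'Im
   and `| | of ssrnum, which have values in R[i]. *)
Local Notation Re := (@complex.Re _).
Local Notation Im := (@complex.Im _).
Local Notation normc := (@Normc.normc _).

(* Lebesgue measure on R^n.  The library has the product sigma-algebra on
   n.-tuple, but no measure on it: it is built by iterated products, R^n.+1
   being identified with R * R^n through [cons]. *)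
Section lebesgue_measure_tuple.
Context {R : realType}.
Local Notation mR := (measurableTypeR R).

Definition tuple_cons n (p : mR * n.-tuple mR) : n.+1.-tuple mR :=
  [tuple of p.1 :: p.2].

Definition tuple_uncons n (t : n.+1.-tuple mR) : mR * n.-tuple mR :=
  (thead t, [tuple of behead t]).

Lemma tuple_consK n : cancel (@tuple_cons n) (@tuple_uncons n).
Proof.
move=> [x t]; rewrite /tuple_uncons /tuple_cons /= theadE; congr pair.
exact/val_inj.
Qed.

Lemma measurable_tuple_cons n :
  measurable_fun [set: mR * n.-tuple mR] (@tuple_cons n).
Proof. exact: measurable_cons measurable_fst measurable_snd. Qed.

Lemma measurable_tuple_uncons n :
  measurable_fun [set: n.+1.-tuple mR] (@tuple_uncons n).
Proof.
apply/measurable_fun_pairP; split; first exact: measurable_tnth.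
exact: measurable_behead.
Qed.

Section cons_measure.
Context n (m : {sigma_finite_measure set (n.-tuple mR) -> \bar R}).

Definition cons_measure : set (n.+1.-tuple mR) -> \bar R :=
  pushforward (@lebesgue_measure R \x m)%E (@tuple_cons n).

Let cons_measure0 : cons_measure set0 = 0%E.
Proof. by rewrite /cons_measure /pushforward preimage_set0 measure0. Qed.

Let cons_measure_ge0 A : (0 <= cons_measure A)%E.
Proof. by rewrite /cons_measure /pushforward; exact: measure_ge0. Qed.

Let cons_measure_sigma_additive : semi_sigma_additive cons_measure.
Proof.
have mcons := @measurable_tuple_cons n.
move=> F mF tF mUF; rewrite /cons_measure /pushforward preimage_bigcup.
apply: measure_semi_sigma_additive.
- by move=> k; rewrite -[X in measurable X]setTI; exact: mcons.
- apply/trivIsetP => /= i j _ _ ij; rewrite -preimage_setI.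
  by move/trivIsetP : tF => /(_ _ _ _ _ ij) ->//; rewrite preimage_set0.
- by rewrite -preimage_bigcup -[X in measurable X]setTI; exact: mcons.
Qed.

HB.instance Definition _ := isMeasure.Build _ _ _ cons_measure
  cons_measure0 cons_measure_ge0 cons_measure_sigma_additive.

Let cons_measure_sigma_finite :
  sigma_finite [set: n.+1.-tuple mR] cons_measure.
Proof.
pose l : {sigma_finite_measure set mR -> \bar R} := @lebesgue_measure R.
have [F UF mF] : sigma_finite setT (l \x m)%E.
  have /sigma_finiteP[F [TF ndF Foo]] := sigma_finiteT l.
  have /sigma_finiteP[G [TG ndG Goo]] := sigma_finiteT m.
  exists (fun k => F k `*` G k).
    rewrite -setXTT TF TG predeqE => -[x y]; split.
      move=> [/= [i _ Fix] [k _ Gky]]; exists (maxn i k) => //; split.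
      - by move: x Fix; exact/subsetPset/ndF/leq_maxl.
      - by move: y Gky; exact/subsetPset/ndG/leq_maxr.
    by move=> [i _ []/= ? ?]; split; exists i.
  move=> k; have [? ?] := Foo k; have [? ?] := Goo k.
  split; first exact: measurableX.
  by rewrite product_measure1E// lte_mul_pinfty// ge0_fin_numE.
exists (fun k => @tuple_uncons n @^-1` F k).
  by rewrite -preimage_bigcup -UF preimage_setT.
move=> k; have [mFk Fk] := mF k; split.
  by rewrite -[X in measurable X]setTI; exact: measurable_tuple_uncons.
rewrite /cons_measure /pushforward -comp_preimage.
rewrite (_ : _ \o _ = id) ?preimage_id//.
by apply/funext => p /=; rewrite tuple_consK.
Qed.

HB.instance Definition _ :=
  Measure_isSigmaFinite.Build _ _ _ cons_measure cons_measure_sigma_finite.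

End cons_measure.

Fixpoint lebesgue_tuple_rec n :
    {sigma_finite_measure set (n.-tuple mR) -> \bar R} :=
  match n with
  | 0 => @dirac _ _ ([tuple] : 0.-tuple mR) R
  | n'.+1 => cons_measure (lebesgue_tuple_rec n')
  end.

Definition lebesgue_tuple n : set (n.-tuple mR) -> \bar R :=
  lebesgue_tuple_rec n.

HB.instance Definition _ n := SigmaFiniteMeasure.on (@lebesgue_tuple n).

End lebesgue_measure_tuple.

Section complex_valued.
Context {R : realType}.
Local Notation C := R[i].

Definition cexp (z : C) : C :=
  (expR (Re z))%:C * (cos (Im z) +i* sin (Im z)).

(* x^a for x > 0 *)
Definition cpow (x : R) (a : C) : C := cexp (a * (ln x)%:C).

(* R[i] is not a normed module over R in the library, so derivatives and
   integrals of complex-valued functions are taken componentwise. *)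
Definition Cderive1n (j : nat) (f : R -> C) (s : R) : C :=
  derive1n j (Re \o f) s +i* derive1n j (Im \o f) s.

Definition smooth_on_pos (f : R -> C) : Prop :=
  forall (j : nat) (s : R), 0 < s ->
    derivable (derive1n j (Re \o f)) s 1 /\ derivable (derive1n j (Im \o f)) s 1.

(* f^(j)(s) ~ sum_k c_k (d/ds)^j s^(mu + k) as s -> 0+ *)
Definition asymptotic_expansion (j : nat) (f : R -> C) (mu : C)
    (c : nat -> C) : Prop :=
  forall M : nat, exists B : R, \forall s \near (0 : R)^'+,
    normc (Cderive1n j f s
           - \sum_(k < M) c k * Cderive1n j (fun t => cpow t (mu + k%:R)) s)
    <= B * s `^ (Re mu + M%:R - j%:R).

End complex_valued.

Section distributions.
Context {R : realType} {n : nat}.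
Local Notation C := R[i].
Local Notation Rn := 'rV[R]_n.

(* The library norm on 'rV[R]_n is the sup norm. *)
Definition enorm (x : Rn) : R := Num.sqrt (\sum_i x 0 i ^+ 2).

Definition partial (s : seq 'I_n) (g : Rn -> R) : Rn -> R :=
  foldr (fun i h x => 'D_(delta_mx 0 i) h x) g s.

Definition smooth_real (g : Rn -> R) : Prop :=
  forall s : seq 'I_n, continuous (partial s g) /\
    forall (i : 'I_n) (x : Rn), derivable (partial s g) x (delta_mx 0 i).

Definition smooth (g : Rn -> C) : Prop :=
  smooth_real (Re \o g) /\ smooth_real (Im \o g).

Definition Cpartial (s : seq 'I_n) (g : Rn -> C) (x : Rn) : C :=
  partial s (Re \o g) x +i* partial s (Im \o g) x.

(* Elements of E'(R^n), as continuous linear forms on C^oo(R^n).  A form is a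
   total function on all g : R^n -> C, of which only the values at smooth g
   are constrained.  Continuity is the seminorm estimate
   |u(g)| <= A max_(|alpha| <= N) sup_K |D^alpha g|, with the right-hand side
   expressed through its upper bounds B. *)
Definition compact_distribution (u : (Rn -> C) -> C) : Prop :=
  (forall (a : C) (g h : Rn -> C), smooth g -> smooth h ->
     u (fun x => a * g x + h x) = a * u g + u h) /\
  exists (K : set Rn) (N : nat) (A : R), compact K /\
    forall (g : Rn -> C) (B : R), smooth g -> 0 <= B ->
      (forall (s : seq 'I_n) (x : Rn), (size s <= N)%N -> K x ->
         normc (Cpartial s g x) <= B) ->
      normc (u g) <= A * B.

Definition fourier (u : (Rn -> C) -> C) (zeta : 'rV[C]_n) : C :=
  u (fun x => cexp (- 'i * \sum_i zeta 0 i * (x 0 i)%:C)).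

Definition invertible_distribution (u : (Rn -> C) -> C) : Prop :=
  compact_distribution u /\
  exists2 A : R, 0 < A & forall xi : Rn,
    (((A + enorm xi) `^ (- A))%:E <
     ereal_sup [set (normc (fourier u (map_mx (real_complex R) eta)))%:E
               | eta in [set eta : Rn |
                   (enorm (eta - xi) < A * ln (2 + enorm xi))%R]])%E.

Definition Cintegral (g : Rn -> C) : C :=
  let row_of (t : n.-tuple (measurableTypeR R)) : Rn := \row_i tnth t i in
  (\int[@lebesgue_tuple R n]_t Re (g (row_of t))) +i*
  (\int[@lebesgue_tuple R n]_t Im (g (row_of t))).

Definition distribution_of_fun (f : Rn -> C) : (Rn -> C) -> C :=
  fun g => Cintegral (fun x => f x * g x).

(* The value at x = 0 is junk (0 `^ (- (n / 2)) = 0); {0} is negligible. *)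
Definition radial_fun (phi : R -> C) (x : Rn) : C :=
  (enorm x `^ (- (n%:R / 2)))%:C * phi (enorm x)
  * (\1_(`[0, 1]%classic : set R) (enorm x))%:C.

End distributions.

Definition Kset {R : realType} (n : nat) (mu : R[i]) (c : nat -> R[i]) :
    set nat :=
  [set k | c k != 0 /\
     ~ exists m : nat, 2^-1 * (mu + k%:R - (n%:R / 2 - 1) - 1) = m%:R].

(* Main.v *)
(* The idea is to read off the full asymptotic expansion of the Fourier transform.
   Write r = |x| and g(r) = r^(-n/2) phi(r). Cauchy's formula for repeated
   integration in the variable r^2 represents f as a superposition of truncated
   powers (s^2 - |x|^2)_+^(L-1), with density the L-th derivative of g with respect
   to r^2, which is supported in s <= 1. A term c_k r^a of the expansion of g, with
   a = mu + k - n/2, contributes c_k (a/2)(a/2-1)...(a/2-L+1) s^(a-2L) to the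
   density. The transform of a truncated power is O(|xi|^-(L-1)), so replacing the
   density by finitely many such terms, extended to all s > 0, costs only
   O(|xi|^-(L-2)). The transform of a pure power is a multiple of |xi|^-(a+n), the
   factor being a quotient of Gamma values that does not vanish. Hence fhat has an
   expansion in powers |xi|^-(mu+k+n/2), in which the k-th coefficient vanishes
   exactly when c_k = 0 or a/2 is a natural number, that is, when k is not in K_n.
   If K_n is non-empty, its least element gives a lower bound |fhat(xi)| >= d |xi|^-q
   for large xi, and f is invertible. If K_n is empty, fhat is rapidly decreasing,
   and f is not invertible. *)
Require Import Defs.
From HB Require Import structures.
From mathcomp Require Import all_boot all_order all_algebra.
From mathcomp Require Import all_classical all_reals all_analysis.
From mathcomp Require Import measurable_realfun.
From mathcomp Require Import complex ring lra zify.

Import Order.TTheory GRing.Theory Num.Theory.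
Import numFieldNormedType.Exports.

Set Implicit Arguments.
Unset Strict Implicit.
Unset Printing Implicit Defensive.

Local Open Scope classical_set_scope.
Local Open Scope ring_scope.
Local Open Scope complex_scope.

(** * Integrals over product spaces and over the line *)

(** Being smooth and zero for r >= 1, phi is flat at r = 1, so Cauchy's formula has no boundary
    terms and the origin alone produces the expansion. A term r^(2m) is a polynomial in x, smooth at
    the origin; this is why it drops out. The squared radius is used because (s^2 - |x|^2)_+^N
    restricts to every coordinate line as a function of the same kind: decay then comes from
    one-dimensional integrations by parts, with no Bessel functions, and is measured in a single
    coordinate, finally the largest one. Pure powers are evaluated as superpositions of Gaussians.
    Radii and Laplace variables are replaced by their logarithms, so that integrals run over the
    whole line and integrability is a bound by e^(-e |w|). The obstacle is convergence at both ends
    once a term is extended to all s > 0. With L = N + 2 the kernel transform decays to order N + 1,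
    so at +oo the terms of decay exponent at most N may be split off, while at -oo the remainder
    must start beyond N; the two conditions fix the number M of terms. Gamma appears only at
    arguments with Re z > 0, where it is nonzero by an estimate for large Re z and the functional
    equation. *)

Notation itg mu f := (mu.-integrable setT (EFin \o f)).

Section integrals.
Context d (T : measurableType d) (R : realType) (mu : {measure set T -> \bar R}).
Implicit Types f g h : T -> R.

Lemma itg_meas f : itg mu f -> measurable_fun setT f.
Proof. by move=> /integrableP[/measurable_EFinP]. Qed.

Lemma itgD f g : itg mu f -> itg mu g -> itg mu (fun x => f x + g x).
Proof. by move=> hf hg; have := integrableD measurableT hf hg. Qed.

Lemma itgB f g : itg mu f -> itg mu g -> itg mu (fun x => f x - g x).
Proof. by move=> hf hg; have := integrableB measurableT hf hg. Qed.

Lemma itgZl (k : R) f : itg mu f -> itg mu (fun x => k * f x).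
Proof. by move=> hf; have := integrableZl measurableT k hf. Qed.

Lemma itgZr (k : R) f : itg mu f -> itg mu (fun x => f x * k).
Proof. by move=> /(itgZl k); apply: eq_integrable => // x _ /=; rewrite mulrC. Qed.

Lemma itg_sum (I : Type) (s : seq I) (F : I -> T -> R) :
  (forall i, itg mu (F i)) -> itg mu (fun x => \sum_(i <- s) F i x).
Proof.
move=> h.
have := @integrable_sum _ _ _ mu setT measurableT I s xpredT _ (fun i _ => h i).
by apply: eq_integrable => // x _ /=; rewrite sumEFin.
Qed.

Lemma itg_le f g : measurable_fun setT f -> (forall x, `|f x| <= g x) ->
  itg mu g -> itg mu f.
Proof.
move=> mf fg; apply: le_integrable => //; first exact/measurable_EFinP.
by move=> x _ /=; rewrite lee_fin (le_trans (fg x)) ?ler_norm.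
Qed.

Lemma Rint_le_norm f g : measurable_fun setT f -> (forall x, `|f x| <= g x) ->
  itg mu g -> `|\int[mu]_x f x| <= \int[mu]_x g x.
Proof.
move=> mf fg ig; have if_ := itg_le mf fg ig.
apply: le_trans (le_normr_Rintegral _ if_) _ => //.
apply: le_Rintegral => //; exact: (integrable_norm if_).
Qed.

Lemma Rint_sum (I : Type) (s : seq I) (F : I -> T -> R) :
  (forall i, itg mu (F i)) ->
  \int[mu]_x (\sum_(i <- s) F i x) = \sum_(i <- s) \int[mu]_x F i x.
Proof.
move=> h; elim: s => [|i s ih].
  rewrite big_nil; under eq_Rintegral do rewrite big_nil.
  by rewrite Rintegral_cst// mul0r.
under eq_Rintegral do rewrite big_cons.
by rewrite RintegralD// ?big_cons ?ih//; exact: itg_sum.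
Qed.

End integrals.

(** * Fubini's theorem for real-valued integrands *)

Section fubini.
Context d d' (X : measurableType d) (Y : measurableType d') (R : realType).
Context (m1 : {sigma_finite_measure set X -> \bar R})
  (m2 : {sigma_finite_measure set Y -> \bar R}).

Lemma itg_prod1 (f : X * Y -> R) (g : X -> R) : measurable_fun setT f ->
  itg m1 g -> (forall x, (\int[m2]_y `|f (x, y)|%:E <= (g x)%:E)%E) ->
  itg (m1 \x m2)%E f.
Proof.
move=> mf ig fg.
have mf' : measurable_fun setT (EFin \o f) by exact/measurable_EFinP.
apply/(integrable12ltyP m1 m2 mf') => /=.
have /integrableP[mg glt] := ig.
apply: le_lt_trans glt; apply: ge0_le_integral => //.
- by move=> x _; apply: integral_ge0.
- apply: (measurable_fun_fubini_tonelli_F (fun z => (`|f z|%:E)%E)) => //.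
  by apply/measurable_EFinP; apply: measurableT_comp.
- exact: measurableT_comp.
- move=> x _; apply: le_trans (fg x) _ => /=; by rewrite lee_fin ler_norm.
Qed.

Lemma itg_prod2 (f : X * Y -> R) (g : Y -> R) : measurable_fun setT f ->
  itg m2 g -> (forall y, (\int[m1]_x `|f (x, y)|%:E <= (g y)%:E)%E) ->
  itg (m1 \x m2)%E f.
Proof.
move=> mf ig fg.
have mf' : measurable_fun setT (EFin \o f) by exact/measurable_EFinP.
apply/(integrable21ltyP m1 m2 mf') => /=.
have /integrableP[mg glt] := ig.
apply: le_lt_trans glt; apply: ge0_le_integral => //.
- by move=> x _; apply: integral_ge0.
- apply: (measurable_fun_fubini_tonelli_G (fun z => (`|f z|%:E)%E)) => //.
  by apply/measurable_EFinP; apply: measurableT_comp.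
- exact: measurableT_comp.
- move=> x _; apply: le_trans (fg x) _ => /=; by rewrite lee_fin ler_norm.
Qed.

Lemma integrable_fubini_G' (f : X * Y -> \bar R) :
  (m1 \x m2)%E.-integrable setT f -> m2.-integrable setT (fubini_G m1 f).
Proof.
move=> h; have mf := measurable_int _ h.
apply/integrableP; split; first exact: (measurable_fubini_G h).
have := (integrable21ltyP m1 m2 mf).1 h; apply: le_lt_trans.
apply: ge0_le_integral => //.
- by apply: measurableT_comp => //; exact: (measurable_fubini_G h).
- apply: (measurable_fun_fubini_tonelli_G (abse \o f)) => //.
  + exact: measurableT_comp.
  + by move=> z /=; exact: abse_ge0.
- move=> y _; apply: le_abse_integral => //.
  exact: measurableT_comp.
Qed.

(** The inner integral of an integrable function may be infinite on a null set, where [fine] returns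
    the default value 0. Finiteness almost everywhere makes the real-valued integral agree with the
    extended one. *)
Lemma fine_itg d0 (Z : measurableType d0) (m : {measure set Z -> \bar R})
    (F : Z -> \bar R) : m.-integrable setT F ->
  itg m (fine \o F) /\ (\int[m]_x (fine (F x))%:E = \int[m]_x F x)%E.
Proof.
move=> iF; have mF : measurable_fun setT F by exact: measurable_int iF.
have mfF : measurable_fun setT (fine \o F) by apply: measurableT_comp.
split.
  apply: le_integrable iF => //; first exact/measurable_EFinP.
  by move=> x _ /=; case: (F x) => [r| |] /=; rewrite ?lee_fin ?normr0 ?leey.
apply: ae_eq_integral => //.
- exact/measurable_EFinP.
- have := integrable_ae measurableT iF; apply: filterS => x /= h _.
  by rewrite fineK//; apply: h.
Qed.

Lemma itg_fub1 (f : X * Y -> R) : itg (m1 \x m2)%E f ->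
  itg m1 (fun x => \int[m2]_y f (x, y)).
Proof.
by move=> h; have [] := fine_itg (integrable_fubini_F h).
Qed.

Lemma itg_fub2 (f : X * Y -> R) : itg (m1 \x m2)%E f ->
  itg m2 (fun y => \int[m1]_x f (x, y)).
Proof.
by move=> h; have [] := fine_itg (integrable_fubini_G' h).
Qed.

Lemma Rint_prod1 (f : X * Y -> R) : itg (m1 \x m2)%E f ->
  \int[(m1 \x m2)%E]_z f z = \int[m1]_x \int[m2]_y f (x, y).
Proof.
move=> h; rewrite /Rintegral.
have [_ ->] := fine_itg (integrable_fubini_F h).
by rewrite (integral12_prod_meas1 h).
Qed.

Lemma Rint_prod2 (f : X * Y -> R) : itg (m1 \x m2)%E f ->
  \int[(m1 \x m2)%E]_z f z = \int[m2]_y \int[m1]_x f (x, y).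
Proof.
move=> h; rewrite /Rintegral.
have [_ ->] := fine_itg (integrable_fubini_G' h).
by rewrite (integral21_prod_meas1 h).
Qed.

End fubini.

(** * Change of variables and integration by parts on the line *)

Section real_line.
Context {R : realType}.
Local Notation leb := (@lebesgue_measure R).
Implicit Types f G : R -> R.

Lemma is_derive_continuous (f df : R -> R) :
  (forall x : R, is_derive x 1 f (df x)) -> continuous f.
Proof.
move=> h x; apply: differentiable_continuous; apply/derivable1_diffP.
by have [] := h x.
Qed.

Lemma is_derive_affine (c a x : R) : is_derive x 1 (fun y => c * y + a) c.
Proof. by apply: is_derive_eq; rewrite addr0 /GRing.scale /= mulr1. Qed.

Lemma ge0_int_affine (c a : R) G : 0 < c -> continuous G -> (forall x, 0 <= G x) ->
  (\int[leb]_x (G x)%:E = \int[leb]_x (c * G (c * x + a))%:E)%E.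
Proof.
move=> c0 cG G0.
have dF : derive1 (fun x : R => c * x + a) = cst c.
  by apply/funext => x; rewrite derive1E; have h := is_derive_affine c a x;
    rewrite derive_val.
rewrite (@increasing_ge0_integration_by_substitutionT R (fun x => c * x + a) G)//.
- by apply: eq_integral => x _; rewrite dF /= mulrC.
- by move=> x y xy; rewrite ltrD2r ltr_pM2l.
- by rewrite dF; move=> x; exact: cvg_cst.
- by rewrite dF; exact: is_cvg_cst.
- by rewrite dF; exact: is_cvg_cst.
- apply/cvgrNyPle => A; near=> x.
  rewrite -lerBrDr -ler_pdivlMl//; near: x; exact: nbhs_ninfty_le.
- apply/cvgryPge => A; near=> x.
  rewrite -lerBlDr -ler_pdivrMl//; near: x; exact: nbhs_pinfty_ge.
Unshelve. all: end_near. Qed.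

Lemma ge0_int_opp G : continuous G -> (forall x, 0 <= G x) ->
  (\int[leb]_x (G x)%:E = \int[leb]_x (G (- x))%:E)%E.
Proof.
move=> cG G0.
have cGN : continuous (fun x => G (- x)).
  by move=> x; apply: (@continuous_comp _ _ _ -%R G); [exact: opp_continuous|exact: cG].
have split (f : R -> R) : continuous f -> (forall x, 0 <= f x) ->
  (\int[leb]_x (f x)%:E = \int[leb]_(x in `]-oo, 0%R]) (f x)%:E + \int[leb]_(x in `[0%R,
    +oo[) (f x)%:E)%E.
  move=> cf f0.
  have mf : measurable_fun setT (EFin \o f) by apply/measurable_EFinP;
    exact: continuous_measurable_fun.
  rewrite -(integral_itv_obnd_cbnd (r := 0))//=; last exact: measurable_funTS.
  rewrite -ge0_integral_setU//=.
  - by rewrite -setCitvr setvU.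
  - exact: measurable_funTS.
  - by move=> x _; rewrite lee_fin.
  - rewrite disj_set2E; apply/eqP; rewrite -subset0 => x/=.
    by rewrite !in_itv/= andbT => -[x0]; rewrite ltNge x0.
rewrite (split _ cG G0) (split _ cGN (fun x => G0 _)).
have e1 := @ge0_integration_by_substitutionNy R G 0.
have e2 := @ge0_integration_by_substitutionNy R (fun x => G (- x)) 0.
rewrite oppr0 in e1, e2.
rewrite e1; [|exact: continuous_subspaceT|by []].
rewrite e2; [|exact: continuous_subspaceT|by []].
rewrite addeC; congr (_ + _)%E.
by apply: eq_integral => x _ /=; rewrite opprK.
Qed.

Lemma itg_ge0_lty (f : R -> R) : measurable_fun setT f -> (forall x, 0 <= f x) ->
  (\int[leb]_x (f x)%:E < +oo)%E -> itg leb f.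
Proof.
move=> mf f0 h; apply/integrableP; split; first exact/measurable_EFinP.
by under eq_integral => x _ do rewrite /= ger0_norm//.
Qed.

(** Writing G = |G| - (|G| - G) passes from nonnegative integrands to signed ones: both pieces are
    nonnegative, continuous and integrable. *)
Lemma Rint_subst (F : R -> R) (c : R) :
  0 < c -> continuous F ->
  (forall G, continuous G -> (forall x, 0 <= G x) ->
     (\int[leb]_x (G x)%:E = \int[leb]_x (c * G (F x))%:E)%E) ->
  forall G, continuous G -> itg leb G ->
  itg leb (G \o F) /\ \int[leb]_x G (F x) = c^-1 * \int[leb]_x G x.
Proof.
move=> c0 cF hG G cG iG.
have key (H : R -> R) : continuous H -> (forall x, 0 <= H x) -> itg leb H ->
  itg leb (H \o F) /\ \int[leb]_x H (F x) = c^-1 * \int[leb]_x H x.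
  move=> cH H0 iH.
  have mH : measurable_fun setT (H \o F).
    apply: continuous_measurable_fun => x.
    by apply: continuous_comp; [exact: cF|exact: cH].
  have i1 : itg leb (fun x => c * H (F x)).
    apply: itg_ge0_lty.
    - exact: measurable_funM.
    - by move=> x; rewrite mulr_ge0// ltW.
    - by rewrite -hG//; exact: integrable_lty.
  have i2 : itg leb (H \o F).
    have := itgZl c^-1 i1; apply: eq_integrable => // x _ /=.
    by rewrite mulKf// gt_eqF.
  split => //.
  have -> : \int[leb]_x H x = \int[leb]_x (c * H (F x)) by rewrite /Rintegral hG.
  by rewrite RintegralZl// mulKf// gt_eqF.
have cn : continuous (fun x => `|G x|).
  by move=> x; apply: (@continuous_comp _ _ _ G Num.norm);
    [exact: cG|exact: norm_continuous].
have [|//|a1 b1] := key (fun x => `|G x|) cn; first by move=> x.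
  exact: integrable_norm.
have [|x||a2 b2] := key (fun x => `|G x| - G x).
- by move=> x; apply: cvgB; [exact: cn|exact: cG].
- by rewrite subr_ge0 ler_norm.
- by apply: itgB => //; exact: integrable_norm.
have e : G \o F = fun x => `|G (F x)| - (`|G (F x)| - G (F x)).
  by apply/funext => x /=; ring.
split.
  by rewrite e; apply: itgB.
have -> : \int[leb]_x G (F x) = \int[leb]_x (`|G (F x)| - (`|G (F x)| - G (F x))).
  by apply: eq_Rintegral => x _; ring.
rewrite RintegralB// b1 b2 -mulrBr -RintegralB//.
- by congr (_ * _); apply: eq_Rintegral => x _; ring.
- exact: integrable_norm.
- by apply: itgB => //; exact: integrable_norm.
Qed.

Lemma Rint_affine (c a : R) G : 0 < c -> continuous G -> itg leb G ->
  itg leb (fun x => G (c * x + a)) /\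
  \int[leb]_x G (c * x + a) = c^-1 * \int[leb]_x G x.
Proof.
move=> c0; apply: Rint_subst => //.
  exact: is_derive_continuous (is_derive_affine c a).
by move=> H cH H0; exact: ge0_int_affine.
Qed.

Lemma Rint_opp G : continuous G -> itg leb G ->
  itg leb (fun x => G (- x)) /\ \int[leb]_x G (- x) = \int[leb]_x G x.
Proof.
move=> cG iG.
have cauchy_cst : continuous (-%R : R -> R) by move=> x; exact: opp_continuous.
have [] := @Rint_subst -%R 1 ltr01 cauchy_cst _ G cG iG.
  by move=> H cH H0; rewrite (ge0_int_opp cH H0); under [RHS]eq_integral do rewrite mul1r.
by rewrite invr1 mul1r.
Qed.

(** The majorant of most integrals below, which are taken in logarithmic variables. *)
Lemma itg_exp_abs (c : R) : 0 < c -> itg leb (fun x => expR (- (c * `|x|))).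
Proof.
move=> c0.
have cf : continuous (fun x : R => expR (- (c * `|x|))).
  move=> x; apply: (@continuous_comp _ _ _ (fun x => - (c * `|x|)) expR);
    last exact: continuous_expR.
  apply: continuousN; apply: continuousM; first exact: cvg_cst.
  exact: norm_continuous.
apply: itg_ge0_lty.
- exact: continuous_measurable_fun.
- by move=> x; exact: expR_ge0.
rewrite ge0_symfun_integralT//; last by move=> x /=; rewrite normrN.
rewrite -set_itvcy.
have dF (x : R) : is_derive x 1 (fun y => - c^-1 * expR (- (c * y))) (expR (- (c * x))).
  apply: is_derive_eq; rewrite /GRing.scale /=; field; exact: lt0r_neq0.
have c1 : continuous (fun x : R => expR (- (c * x))).
  move=> x; apply: (@continuous_comp _ _ _ (fun x => - (c * x)) expR);
    last exact: continuous_expR.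
  apply: continuousN; exact: mulrl_continuous.
have -> : (\int[leb]_(x in `[0%R, +oo[) (expR (- (c * `|x|)))%:E =
           \int[leb]_(x in `[0%R, +oo[) (expR (- (c * x)))%:E)%E.
  apply: eq_integral => x; rewrite inE /= in_itv /= andbT => x0.
  by rewrite ger0_norm.
rewrite (@ge0_continuous_FTC2y _ _ (fun x => - c^-1 * expR (- (c * x))) _ 0).
- by rewrite -EFinB -EFinM ltry.
- by move=> x _; exact: expR_ge0.
- exact: continuous_subspaceT.
- rewrite -[X in _ --> X](mulr0 (- c^-1)); apply: cvgM; first exact: cvg_cst.
  apply: (cvg_comp (fun x => c * x) (fun x => expR (- x))); last exact: cvgr_expR.
  apply/cvgryPge => A; near=> x.
  rewrite -ler_pdivrMl//; near: x; exact: nbhs_pinfty_ge.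
- by move=> x _; have [] := dF x.
- by apply: cvg_at_right_filter; exact: (is_derive_continuous dF).
- by move=> x _; rewrite derive1E; have h := dF x; rewrite derive_val.
Unshelve. all: end_near. Qed.

Lemma Rint_itvT f : itg leb f ->
  (\int[leb]_(x in `[(- n%:R)%R, n%:R%R]) f x) @[n --> \oo] --> \int[leb]_x f x.
Proof.
move=> if_; have mf := itg_meas if_.
rewrite /Rintegral; apply: fine_cvg.
rewrite fineK; last exact: integrable_fin_num.
under eq_fun do rewrite integral_mkcond.
apply: (@dominated_cvg _ _ _ leb setT measurableT
    (fun n => (EFin \o f) \_ `[(- n%:R)%R, n%:R%R]) (EFin \o f) (EFin \o (fun x =>
      `|f x|))).
- by move=> n; apply/(measurable_restrictT _ _).1 => //; apply: measurable_funTS;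
  apply/measurable_EFinP.
- move=> x _; apply: cvg_near_cst; near=> n.
  rewrite patchE mem_set//= in_itv /= -ler_norml.
  near: n; exact: nbhs_infty_ger.
- by [].
- exact: integrable_norm.
- move=> n x _ /=; rewrite patchE; case: ifPn => _ /=; rewrite ?lee_fin//.
  by rewrite normr0.
Unshelve. all: end_near. Qed.

(** The form in which integration by parts over the whole line is used: the derivative of a product
    has integral 0. *)
Lemma Rint_derive0 (F f : R -> R) : (forall x : R, is_derive x 1 F (f x)) ->
  continuous f -> itg leb f ->
  F x @[x --> +oo] --> 0 -> F x @[x --> -oo] --> 0 ->
  \int[leb]_x f x = 0.
Proof.
move=> dF cf if_ Fy FNy.
have cF := is_derive_continuous dF.
suff : (\int[leb]_(x in `[(- n%:R)%R, n%:R%R]) f x) @[n --> \oo] --> (0 : R).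
  by apply: cvg_unique; [exact: Rhausdorff|exact: Rint_itvT].
rewrite -(subr0 0).
have h1 : F n%:R @[n --> \oo] --> 0.
  by apply: (cvg_comp (fun n : nat => n%:R) F) Fy; exact: cvgr_idn.
have h2 : F (- n%:R) @[n --> \oo] --> 0.
  apply: (cvg_comp (fun n : nat => - n%:R) F) FNy.
  by apply/cvgNrNy; exact: cvgr_idn.
apply: cvg_trans (cvgB h1 h2).
apply: near_eq_cvg; near=> n.
have n0 : (0 < n)%N by near: n; exact: nbhs_infty_gt.
rewrite /Rintegral (@continuous_FTC2 _ f F).
- by rewrite -EFinB.
- by rewrite -subr_gt0 opprK addr_gt0// ltr0n.
- exact: continuous_subspaceT.
- split; first by move=> x _; have [] := dF x.
  + by apply: cvg_at_right_filter; exact: cF.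
  + by apply: cvg_at_left_filter; exact: cF.
- by move=> x _; rewrite derive1E; have h := dF x; rewrite derive_val.
Unshelve. all: end_near. Qed.

End real_line.

(** * Complex-valued functions *)

Notation cRe := (@complex.Re _).
Notation cIm := (@complex.Im _).
Notation normc := (@Normc.normc _).

Section complex_basics.
Context {R : realType}.
Local Notation C := R[i].
Implicit Types (z w : C) (x y : R).

Lemma cReD z w : cRe (z + w) = cRe z + cRe w. Proof. by case: z; case: w. Qed.
Lemma cImD z w : cIm (z + w) = cIm z + cIm w. Proof. by case: z; case: w. Qed.
Lemma cReN z : cRe (- z) = - cRe z. Proof. by case: z. Qed.
Lemma cImN z : cIm (- z) = - cIm z. Proof. by case: z. Qed.
Lemma cReM z w : cRe (z * w) = cRe z * cRe w - cIm z * cIm w.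
Proof. by case: z; case: w. Qed.
Lemma cImM z w : cIm (z * w) = cRe z * cIm w + cIm z * cRe w.
Proof. by case: z => a b; case: w => c d /=; rewrite addrC. Qed.
Lemma cReZ z x : cRe (z * x%:C) = cRe z * x.
Proof. by rewrite cReM /= mulr0 subr0. Qed.
Lemma cImZ z x : cIm (z * x%:C) = cIm z * x.
Proof. by rewrite cImM /= mulr0 add0r. Qed.

Lemma cRe_sum (I : Type) (s : seq I) (P : pred I) (F : I -> C) :
  cRe (\sum_(i <- s | P i) F i) = \sum_(i <- s | P i) cRe (F i).
Proof. by elim/big_rec2: _ => // i y1 y2 _ <-; rewrite cReD. Qed.
Lemma cIm_sum (I : Type) (s : seq I) (P : pred I) (F : I -> C) :
  cIm (\sum_(i <- s | P i) F i) = \sum_(i <- s | P i) cIm (F i).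
Proof. by elim/big_rec2: _ => // i y1 y2 _ <-; rewrite cImD. Qed.

Lemma complex_eq z w : cRe z = cRe w -> cIm z = cIm w -> z = w.
Proof. by case: z; case: w => a b c d /= -> ->. Qed.

Lemma normc_real x : normc x%:C = `|x|.
Proof. by rewrite /normc /= expr0n addr0 sqrtr_sqr. Qed.

Lemma normc_ge0 z : 0 <= normc z.
Proof. by case: z => a b; exact: sqrtr_ge0. Qed.

Lemma norm_Re_le z : `|cRe z| <= normc z.
Proof.
case: z => a b /=; rewrite -sqrtr_sqr ler_wsqrtr// lerDl; exact: sqr_ge0.
Qed.

Lemma norm_Im_le z : `|cIm z| <= normc z.
Proof.
case: z => a b /=; rewrite -sqrtr_sqr ler_wsqrtr// lerDr; exact: sqr_ge0.
Qed.

Lemma normc_le z : normc z <= `|cRe z| + `|cIm z|.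
Proof.
case: z => a b /=.
rewrite -[leRHS]ger0_norm ?addr_ge0// -sqrtr_sqr ler_wsqrtr//.
rewrite sqrrD !real_normK ?num_real// -addrA lerD2l lerDr.
by rewrite mulrn_wge0// mulr_ge0.
Qed.

Lemma le_normc_sum (I : Type) (s : seq I) (P : pred I) (F : I -> C) :
  normc (\sum_(i <- s | P i) F i) <= \sum_(i <- s | P i) normc (F i).
Proof.
elim/big_rec2: _ => [|i y1 y2 _ h]; first by rewrite Normc.normc0.
by apply: le_trans (le_normcD _ _) _; rewrite lerD2l.
Qed.

Lemma normc_eq0 z : normc z = 0 -> z = 0.
Proof. exact: Normc.eq0_normc. Qed.

Lemma normc_gt0 z : z != 0 -> 0 < normc z.
Proof.
move=> z0; rewrite lt0r normc_ge0 andbT; apply: contraNN z0 => /eqP/normc_eq0 ->.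
by rewrite eqxx.
Qed.

Lemma cexpD z w : cexp (z + w) = cexp z * cexp w.
Proof.
case: z => a b; case: w => c d; rewrite /cexp /= expRD cosD sinD.
by apply: complex_eq => /=; ring.
Qed.

Lemma cexp0 : cexp 0 = 1 :> C.
Proof. by rewrite /cexp /= expR0 cos0 sin0 mul1r. Qed.

Lemma normc_cexp z : normc (cexp z) = expR (cRe z).
Proof.
rewrite /cexp Normc.normcM normc_real ger0_norm ?expR_ge0//=.
by rewrite cos2Dsin2 sqrtr1 mulr1.
Qed.

Lemma cexp_neq0 z : cexp z != 0.
Proof.
apply/eqP => h; have := normc_cexp z; rewrite h Normc.normc0 => /esym/eqP.
by rewrite gt_eqF// expR_gt0.
Qed.

Lemma cexpN z : cexp (- z) = (cexp z)^-1.
Proof.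
apply: (mulIf (cexp_neq0 z)); rewrite -cexpD addNr cexp0 mulVf//.
exact: cexp_neq0.
Qed.

Lemma cexp_real x : cexp x%:C = (expR x)%:C.
Proof. by rewrite /cexp /= cos0 sin0 mulr1. Qed.

Lemma Re_cexp z : cRe (cexp z) = expR (cRe z) * cos (cIm z).
Proof. by rewrite /cexp cReM /= mul0r subr0. Qed.
Lemma Im_cexp z : cIm (cexp z) = expR (cRe z) * sin (cIm z).
Proof. by rewrite /cexp cImM /= mul0r addr0. Qed.

Lemma is_derive_Re_cexp z (u : R) :
  is_derive u 1 (fun u : R => cRe (cexp (z * u%:C))) (cRe (z * cexp (z * u%:C))).
Proof.
have -> : (fun u : R => cRe (cexp (z * u%:C))) = (fun u =>
  expR (cRe z * u) * cos (cIm z * u)).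
  by apply/funext => v; rewrite Re_cexp cReZ cImZ.
rewrite cReM Re_cexp Im_cexp cReZ cImZ.
apply: is_derive_eq; rewrite /GRing.scale /=; ring.
Qed.

Lemma is_derive_Im_cexp z (u : R) :
  is_derive u 1 (fun u : R => cIm (cexp (z * u%:C))) (cIm (z * cexp (z * u%:C))).
Proof.
have -> : (fun u : R => cIm (cexp (z * u%:C))) = (fun u =>
  expR (cRe z * u) * sin (cIm z * u)).
  by apply/funext => v; rewrite Im_cexp cReZ cImZ.
rewrite cImM Re_cexp Im_cexp cReZ cImZ.
apply: is_derive_eq; rewrite /GRing.scale /=; ring.
Qed.

End complex_basics.

(** * Componentwise integrals of complex-valued functions *)

Section complex_integral.
Context d (T : measurableType d) (R : realType) (mu : {measure set T -> \bar R}).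
Local Notation C := R[i].
Implicit Types f g : T -> C.

Definition Cint f : C := (\int[mu]_x cRe (f x)) +i* (\int[mu]_x cIm (f x)).

Definition Citg f := itg mu (fun x => cRe (f x)) /\ itg mu (fun x => cIm (f x)).

Definition Cmeas f := measurable_fun setT (fun x => cRe (f x)) /\
  measurable_fun setT (fun x => cIm (f x)).

Lemma eq_Cint f g : f =1 g -> Cint f = Cint g.
Proof. by move=> /funext ->. Qed.

Lemma CmeasM f g : Cmeas f -> Cmeas g -> Cmeas (fun x => f x * g x).
Proof.
move=> [a b] [c e]; split.
  under eq_fun do rewrite cReM.
  by apply: measurable_funB; apply: measurable_funM.
under eq_fun do rewrite cImM.
by apply: measurable_funD; apply: measurable_funM.
Qed.

Lemma Cmeas_real (f : T -> R) : measurable_fun setT f -> Cmeas (fun x => (f x)%:C).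
Proof. by move=> mf; split. Qed.

Lemma Citg_meas f : Citg f -> Cmeas f.
Proof. by move=> [a b]; split; [exact: itg_meas a|exact: itg_meas b]. Qed.

Lemma Citg_le f (g : T -> R) : Cmeas f -> (forall x, normc (f x) <= g x) ->
  itg mu g -> Citg f.
Proof.
move=> [a b] h ig; split; apply: itg_le ig => // x; apply: le_trans (h x).
  exact: norm_Re_le.
exact: norm_Im_le.
Qed.

(** The factor 2 comes from bounding real and imaginary parts separately. *)
Lemma normc_Cint_le f (g : T -> R) : Cmeas f -> (forall x, normc (f x) <= g x) ->
  itg mu g -> normc (Cint f) <= 2 * \int[mu]_x g x.
Proof.
move=> [a b] h ig; apply: le_trans (normc_le _) _ => /=.
rewrite mulr_natl mulr2n; apply: lerD; apply: Rint_le_norm => // x;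
  apply: le_trans (h x); [exact: norm_Re_le|exact: norm_Im_le].
Qed.

Lemma CitgD f g : Citg f -> Citg g -> Citg (fun x => f x + g x).
Proof.
move=> [a b] [c e]; split.
  by under eq_fun do rewrite cReD; exact: itgD.
by under eq_fun do rewrite cImD; exact: itgD.
Qed.

Lemma CitgZ (k : C) f : Citg f -> Citg (fun x => k * f x).
Proof.
move=> [a b]; split.
  by under eq_fun do rewrite cReM; apply: itgB; exact: itgZl.
by under eq_fun do rewrite cImM; apply: itgD; exact: itgZl.
Qed.

Lemma CintD f g : Citg f -> Citg g -> Cint (fun x => f x + g x) = Cint f + Cint g.
Proof.
move=> [a b] [c e]; apply: complex_eq => /=; rewrite -RintegralD//;
  apply: eq_Rintegral => x _; rewrite ?cReD ?cImD//.
Qed.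

Lemma CintZ (k : C) f : Citg f -> Cint (fun x => k * f x) = k * Cint f.
Proof.
move=> [a b]; apply: complex_eq; rewrite ?cReM ?cImM /=.
  under eq_Rintegral do rewrite cReM.
  by rewrite RintegralB ?RintegralZl//; exact: itgZl.
under eq_Rintegral do rewrite cImM.
by rewrite RintegralD ?RintegralZl//; exact: itgZl.
Qed.

Lemma Citg_sum (I : Type) (s : seq I) (F : I -> T -> C) :
  (forall i, Citg (F i)) -> Citg (fun x => \sum_(i <- s) F i x).
Proof.
move=> h; split.
  by under eq_fun do rewrite cRe_sum; apply: itg_sum => i; have [] := h i.
by under eq_fun do rewrite cIm_sum; apply: itg_sum => i; have [] := h i.
Qed.

Lemma Cint_sum (I : Type) (s : seq I) (F : I -> T -> C) :
  (forall i, Citg (F i)) ->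
  Cint (fun x => \sum_(i <- s) F i x) = \sum_(i <- s) Cint (F i).
Proof.
move=> h; apply: complex_eq; rewrite ?cRe_sum ?cIm_sum /=.
  by under eq_Rintegral do rewrite cRe_sum; rewrite Rint_sum// => i; have [] := h i.
by under eq_Rintegral do rewrite cIm_sum; rewrite Rint_sum// => i; have [] := h i.
Qed.

End complex_integral.

Section complex_fubini.
Context d d' (X : measurableType d) (Y : measurableType d') (R : realType).
Context (m1 : {sigma_finite_measure set X -> \bar R})
  (m2 : {sigma_finite_measure set Y -> \bar R}).

Lemma Cint_fubini (f : X * Y -> R[i]) : Citg (m1 \x m2)%E f ->
  Cint m1 (fun x => Cint m2 (fun y => f (x, y))) =
  Cint m2 (fun y => Cint m1 (fun x => f (x, y))).
Proof.
move=> [a b]; apply: complex_eq => /=.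
  by rewrite -(Rint_prod1 a) -(Rint_prod2 a).
by rewrite -(Rint_prod1 b) -(Rint_prod2 b).
Qed.

End complex_fubini.

(** * The Gamma function *)

Section gamma.
Context {R : realType}.
Local Notation C := R[i].
Local Notation leb := (@lebesgue_measure R).
Implicit Types (z : C) (u q x : R).

Definition Ccont (f : R -> C) :=
  continuous (fun u => cRe (f u)) /\ continuous (fun u => cIm (f u)).

Lemma CcontM (f g : R -> C) : Ccont f -> Ccont g -> Ccont (fun u => f u * g u).
Proof.
move=> [a b] [c e]; split.
  under eq_fun do rewrite cReM.
  move=> x; apply: cvgB; apply: cvgM; by [apply: a|apply: b|apply: c|apply: e].
under eq_fun do rewrite cImM.
move=> x; apply: cvgD; apply: cvgM; by [apply: a|apply: b|apply: c|apply: e].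
Qed.

Lemma Ccont_real (f : R -> R) : continuous f -> Ccont (fun u => (f u)%:C).
Proof. by move=> cf; split => //= x; exact: cvg_cst. Qed.

Lemma Ccont_cexp z : Ccont (fun u : R => cexp (z * u%:C)).
Proof.
split; [exact: is_derive_continuous (is_derive_Re_cexp z)|].
exact: is_derive_continuous (is_derive_Im_cexp z).
Qed.

Lemma Ccont_meas (f : R -> C) : Ccont f -> Cmeas f.
Proof. by move=> [a b]; split; exact: continuous_measurable_fun. Qed.

Lemma Cint_shift (f : R -> C) (a : R) : Ccont f -> Citg leb f ->
  Citg leb (fun u => f (u + a)) /\ Cint leb (fun u => f (u + a)) = Cint leb f.
Proof.
move=> [a1 b1] [a2 b2].
have [] := Rint_affine a ltr01 a1 a2; have [] := Rint_affine a ltr01 b1 b2.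
have -> : (fun x : R => cIm (f (1 * x + a))) = (fun x : R => cIm (f (x + a))).
  by apply/funext => x; rewrite mul1r.
have -> : (fun x : R => cRe (f (1 * x + a))) = (fun x : R => cRe (f (x + a))).
  by apply/funext => x; rewrite mul1r.
rewrite invr1 !mul1r => i1 e1 i2 e2.
by split; [split|apply: complex_eq].
Qed.

Lemma Cint_opp (f : R -> C) : Ccont f -> Citg leb f ->
  Citg leb (fun u => f (- u)) /\ Cint leb (fun u => f (- u)) = Cint leb f.
Proof.
move=> [a1 b1] [a2 b2].
have [i1 e1] := Rint_opp a1 a2; have [i2 e2] := Rint_opp b1 b2.
by split; [split|apply: complex_eq].
Qed.

(** With t = e^u this is t^z e^(-q t) dt/t. The parameter q will be a squared radius r^2, so that
    the integral is r^(-2z) times a Gamma value. *)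
Definition gker q z u : C := cexp (z * u%:C) * (expR (- (q * expR u)))%:C.

Lemma continuous_gexp q : continuous (fun u : R => expR (- (q * expR u))).
Proof.
have d (u : R) : is_derive u 1 (fun u : R => expR (- (q * expR u))) (- (q * expR u) *
  expR (- (q * expR u))).
  by apply: is_derive_eq; rewrite /GRing.scale /=; ring.
exact: is_derive_continuous d.
Qed.

Lemma Ccont_gker q z : Ccont (gker q z).
Proof.
by apply: CcontM; [exact: Ccont_cexp|apply: Ccont_real; exact: continuous_gexp].
Qed.

Lemma normc_gker q z u : normc (gker q z u) = expR (cRe z * u - q * expR u).
Proof.
by rewrite /gker Normc.normcM normc_cexp normc_real ger0_norm ?expR_ge0// expRD cReZ.
Qed.

(** For u >= 0, squaring e^(u/2) >= 1 + u/2 gives e^u >= u^2/4, and 2xu <= u^2/4 + 4x^2 follows from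
    (u/2 - 2x)^2 >= 0, whence the constant. For u < 0 the factor e^(xu) decays by itself. *)
Lemma gker_bound x u : 0 < x ->
  expR (x * u - expR u) <= expR (4 * x ^+ 2) * expR (- (x * `|u|)).
Proof.
move=> x0; rewrite -expRD ler_expR.
have [u0|u0] := leP 0 u; last first.
  rewrite ltr0_norm// mulrN opprK; have := expR_ge0 u; have := sqr_ge0 x; lra.
rewrite ger0_norm//.
have h : (1 + u / 2) ^+ 2 <= expR u.
  have := @expR_ge1Dx R (u / 2) => h.
  have -> : expR u = expR (u / 2) ^+ 2 by rewrite -expRM_natl; congr expR; field.
  by rewrite ler_pXn2r// ?nnegrE ?expR_ge0//; lra.
have := sqr_ge0 (u / 2 - 2 * x); nra.
Qed.

Lemma Citg_gker1 z : 0 < cRe z -> Citg leb (gker 1 z).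
Proof.
move=> z0; apply: (Citg_le (mu := leb) (g := fun u : R =>
  expR (4 * cRe z ^+ 2) * expR (- (cRe z * `|u|)))).
- exact: Ccont_meas (Ccont_gker _ _).
- by move=> u; rewrite normc_gker mul1r; exact: gker_bound.
- by apply: itgZl; exact: itg_exp_abs.
Qed.

(* Euler's integral after the substitution t = e^u. *)
Definition Gam z : C := Cint leb (gker 1 z).

Lemma gker_scale q z u : 0 < q ->
  gker q z u = cexp (- z * (ln q)%:C) * gker 1 z (u + ln q).
Proof.
move=> q0; rewrite /gker mulrA -cexpD mul1r expRD lnK ?posrE//.
congr (cexp _ * (expR (- _))%:C); last by rewrite mulrC.
rewrite raddfD /=; ring.
Qed.

Lemma gker_int q z : 0 < q -> 0 < cRe z ->
  Citg leb (gker q z) /\ Cint leb (gker q z) = cexp (- z * (ln q)%:C) * Gam z.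
Proof.
move=> q0 z0.
have [i1 e1] := Cint_shift (ln q) (Ccont_gker 1 z) (Citg_gker1 z0).
have -> : gker q z = fun u => cexp (- z * (ln q)%:C) * gker 1 z (u + ln q).
  by apply/funext => u; exact: gker_scale.
by split; [exact: (CitgZ _ i1)|rewrite (CintZ _ i1) e1].
Qed.

Lemma cvg_expNabs (c : R) (F : R -> R) (K : R) : 0 < c ->
  (forall u, `|F u| <= K * expR (- (c * `|u|))) ->
  F x @[x --> +oo] --> 0 /\ F x @[x --> -oo] --> 0.
Proof.
move=> c0 h.
have K0 : 0 <= K by have := h 0; rewrite normr0 mulr0 oppr0 expR0 mulr1; apply: le_trans.
have key : forall e : R, 0 < e -> exists A : R, 0 < A /\ forall u : R,
  A <= `|u| -> `|F u| <= e.
  move=> e e0; exists ((K / e + 1) / c).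
  have A0 : 0 < K / e + 1 by rewrite ltr_wpDl// divr_ge0// ltW.
  split; first exact: divr_gt0.
  move=> u; rewrite ler_pdivrMr// mulrC => hu.
  apply: le_trans (h u) _; rewrite expRN ler_pdivrMr ?expR_gt0//.
  have h2 := @expR_ge1Dx R (c * `|u|).
  have h3 : K / e <= expR (c * `|u|) by lra.
  by rewrite mulrC -ler_pdivrMr.
split; apply/cvgrPdist_le => e e0; have [A [A0 hA]] := key e e0.
  near=> u; rewrite sub0r normrN; apply: hA.
  apply: le_trans (ler_norm _); near: u; exact: (nbhs_pinfty_ge (num_real A)).
near=> u; rewrite sub0r normrN; apply: hA; rewrite -(normrN u).
apply: le_trans (ler_norm _); rewrite lerNr; near: u.
exact: (nbhs_ninfty_le (num_real (- A))).
Unshelve. all: end_near. Qed.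

Lemma Gam_add1 z : 0 < cRe z -> Gam (z + 1) = z * Gam z.
Proof.
move=> z0.
have z1 : 0 < cRe (z + 1) by rewrite cReD /= addr_gt0.
have i1 := Citg_gker1 z0; have i2 := Citg_gker1 z1.
(* The right-hand side is the product rule for [gker 1 z], so the difference on the left is its
   derivative and has integral 0. *)
have eqd u : z * gker 1 z u - gker 1 (z + 1) u =
    (z * cexp (z * u%:C)) * (expR (- (1 * expR u)))%:C
    + cexp (z * u%:C) * (- expR u * expR (- (1 * expR u)))%:C.
  rewrite /gker mulrDl cexpD [1 * u%:C]mul1r cexp_real !mul1r [(_ *
    expR _)%:C]rmorphM rmorphN /=; ring.
have i3 : Citg leb (fun u => z * gker 1 z u - gker 1 (z + 1) u).
  apply: CitgD; first exact: (CitgZ _ i1).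
  have -> : (fun u => - gker 1 (z + 1) u) = (fun u => -1 * gker 1 (z + 1) u).
    by apply/funext => u; rewrite mulN1r.
  exact: (CitgZ _ i2).
have c3 : Ccont (fun u => z * gker 1 z u - gker 1 (z + 1) u).
  under eq_fun do rewrite eqd.
  have cc := Ccont_cexp z.
  have cg : continuous (fun u : R => expR (- (1 * expR u))) by exact: continuous_gexp.
  have [a b] : Ccont (fun u => (z * cexp (z * u%:C)) * (expR (- (1 * expR u)))%:C).
    apply: CcontM; last exact: Ccont_real.
    by apply: CcontM => //; split => x; exact: cvg_cst.
  have [a' b'] : Ccont (fun u => cexp (z * u%:C) * (- expR u * expR (- (1 * expR u)))%:C).
    apply: CcontM => //; apply: Ccont_real => x; apply: cvgM; last exact: cg.
    by apply: cvgN; exact: continuous_expR.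
  split.
    by under eq_fun do rewrite cReD; move=> x; apply: cvgD; [exact: a|exact: a'].
  by under eq_fun do rewrite cImD; move=> x; apply: cvgD; [exact: b|exact: b'].
have : Cint leb (fun u => z * gker 1 z u - gker 1 (z + 1) u) = 0.
  have [[a b] [a' b']] := (c3, i3).
  have de (u : R) : is_derive u 1 (fun u : R => expR (- (1 * expR u))) (- (expR u) *
    expR (- (1 * expR u))).
    by apply: is_derive_eq; rewrite /GRing.scale /=; ring.
  apply: complex_eq => /=.
    apply: (@Rint_derive0 _ (fun u => cRe (gker 1 z u))) => //.
    + move=> u; rewrite eqd cReD !cReZ.
      have -> : (fun u : R => cRe (gker 1 z u)) = fun u =>
        cRe (cexp (z * u%:C)) * expR (- (1 * expR u)).
        by apply/funext => v; rewrite /gker cReZ.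
      have h1 := is_derive_Re_cexp z u; have h2 := de u.
      apply: is_derive_eq; rewrite /GRing.scale /=; ring.
    + apply: (cvg_expNabs z0 (K := expR (4 * cRe z ^+ 2)) _).1 => u.
      by apply: le_trans (norm_Re_le _) _; rewrite normc_gker mul1r; exact: gker_bound.
    + apply: (cvg_expNabs z0 (K := expR (4 * cRe z ^+ 2)) _).2 => u.
      by apply: le_trans (norm_Re_le _) _; rewrite normc_gker mul1r; exact: gker_bound.
  apply: (@Rint_derive0 _ (fun u => cIm (gker 1 z u))) => //.
  + move=> u; rewrite eqd cImD !cImZ.
    have -> : (fun u : R => cIm (gker 1 z u)) = fun u =>
      cIm (cexp (z * u%:C)) * expR (- (1 * expR u)).
      by apply/funext => v; rewrite /gker cImZ.
    have h1 := is_derive_Im_cexp z u; have h2 := de u.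
    apply: is_derive_eq; rewrite /GRing.scale /=; ring.
  + apply: (cvg_expNabs z0 (K := expR (4 * cRe z ^+ 2)) _).1 => u.
    by apply: le_trans (norm_Im_le _) _; rewrite normc_gker mul1r; exact: gker_bound.
  + apply: (cvg_expNabs z0 (K := expR (4 * cRe z ^+ 2)) _).2 => u.
    by apply: le_trans (norm_Im_le _) _; rewrite normc_gker mul1r; exact: gker_bound.
have -> : (fun u => z * gker 1 z u - gker 1 (z + 1) u) = (fun u =>
  z * gker 1 z u + (-1) * gker 1 (z + 1) u).
  by apply/funext => u; rewrite mulN1r.
rewrite (CintD (CitgZ _ i1) (CitgZ _ i2)) (CintZ _ i1) (CintZ _ i2) mulN1r => /eqP.
by rewrite subr_eq0 => /eqP.
Qed.

Definition rGam x : R := \int[leb]_u expR (x * u - expR u).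

Lemma Re_gker_real x u : cRe (gker 1 x%:C u) = expR (x * u - expR u).
Proof.
by rewrite /gker cReZ Re_cexp cReZ cImZ -[cRe _]/x -[cIm _]/(0 : R) mul0r cos0 mulr1
  mul1r expRD.
Qed.

Lemma itg_rGam x : 0 < x -> itg leb (fun u => expR (x * u - expR u)).
Proof.
move=> x0; have [a _] := @Citg_gker1 x%:C x0.
by apply: eq_integrable a => // u _; rewrite [LHS]/comp Re_gker_real.
Qed.

Lemma rGam_add1 x : 0 < x -> rGam (x + 1) = x * rGam x.
Proof.
move=> x0.
have e (y : R) : rGam y = cRe (Gam y%:C).
  rewrite /rGam -[RHS]/(\int[leb]_u _); apply: eq_Rintegral => u _.
  by rewrite Re_gker_real.
by rewrite !e (_ : (x + 1)%:C = x%:C + 1) ?raddfD// (@Gam_add1 x%:C)// mulrC cReZ mulrC.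
Qed.

Lemma rGam_gt0 x : 0 < x -> 0 < rGam x.
Proof.
move=> x0; apply: (@lt_le_trans _ _ (expR (- expR 1))); first exact: expR_gt0.
have -> : expR (- expR 1) = \int[leb]_u (expR (- expR 1) * \1_(`[0%R,
  1%R]%classic : set R) u).
  rewrite RintegralZl//; last exact: integrable_indic_itv.
  rewrite /Rintegral integral_indic// setIT.
  rewrite -[LHS]mulr1 -[1 in LHS]/(fine 1%:E); congr (_ * fine _).
  by apply/esym; apply: (etrans (lebesgue_measure_itv _));
    rewrite /= lte_fin ltr01 oppr0 adde0.
apply: le_Rintegral => //; [|exact: itg_rGam|].
  by apply: itgZl; exact: integrable_indic_itv.
move=> u _; rewrite indicE; have [|_] := boolP (_ \in _); last by rewrite mulr0 expR_ge0.
rewrite inE /= in_itv /= => /andP[u0 u1]; rewrite mulr1 ler_expR.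
have : expR u <= expR 1 by rewrite ler_expR.
have : 0 <= x * u by rewrite mulr_ge0// ltW.
lra.
Qed.

Lemma sqr_le_expR (v : R) : v ^+ 2 <= 4 * (expR v + expR (- v) - 2).
Proof.
have h (w : R) : 0 <= w -> w ^+ 2 <= 4 * (expR w + expR (- w) - 2).
  move=> w0.
  have h1 : (1 + w / 2) ^+ 2 <= expR w.
    have := @expR_ge1Dx R (w / 2) => h.
    have -> : expR w = expR (w / 2) ^+ 2 by rewrite -expRM_natl; congr expR; field.
    by rewrite ler_pXn2r// ?nnegrE ?expR_ge0//; lra.
  have h2 := @expR_ge1Dx R (- w); nra.
have [v0|v0] := leP 0 v; first exact: h.
have := h (- v); rewrite opprK sqrrN oppr_ge0 => /(_ (ltW v0)).
by rewrite [expR v + _]addrC.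
Qed.

Lemma norm_sin_le (v : R) : `|sin v| <= `|v|.
Proof.
have h (w : R) : 0 <= w -> `|sin w| <= w.
  move=> w0.
  have [c _ e] := @MVT_segment R sin cos 0 w w0 (fun x _ => is_derive_sin x)
     (continuous_subspaceT (@continuous_sin R)).
  have -> : sin w = cos c * w by rewrite sin0 !subr0 in e.
  by rewrite normrM (ger0_norm w0) ler_piMl// cos_max.
have [v0|v0] := leP 0 v; first by rewrite (ger0_norm v0); exact: h.
have := h (- v); rewrite oppr_ge0 => /(_ (ltW v0)).
by rewrite sinN normrN (ltr0_norm v0).
Qed.

Lemma cos_ge (v : R) : 1 - v ^+ 2 / 2 <= cos v.
Proof.
have -> : cos v = 1 - 2 * sin (v / 2) ^+ 2.
  have := cosD (v / 2) (v / 2); rewrite -splitr => ->.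
  by have := cos2Dsin2 (v / 2); rewrite !expr2; lra.
have := norm_sin_le (v / 2); rewrite -ler_sqr ?nnegrE// !real_normK ?num_real//.
rewrite exprMn; lra.
Qed.

(* Rotating the integrand to be positive at its peak u = ln x, and using
   cos v >= 1 - v^2/2 and v^2 <= 4 (e^v + e^-v - 2), bounds |Gam z| below by a
   combination of real values of Gam. *)
Lemma Gam_neq0_large z : 0 < cRe z - 1 -> 2 * cIm z ^+ 2 < cRe z - 1 -> Gam z != 0.
Proof.
set x := cRe z; set y := cIm z => x1 xy.
have x0 : 0 < x by lra.
have ig := Citg_gker1 x0.
apply/eqP => G0.
pose v0 := ln x.
pose k : C := cexp (0 +i* (- (y * v0))).
have : cRe (Cint leb (fun u => k * gker 1 z u)) = 0.
  by rewrite (CintZ _ ig) -/(Gam z) G0 mulr0.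
have [ik _] := CitgZ k ig.
have e u : cRe (k * gker 1 z u) = expR (x * u - expR u) * cos (y * (u - v0)).
  rewrite /k /gker mulrA -cexpD cReZ Re_cexp cReD cImD cReZ cImZ /= add0r mul1r.
  rewrite expRD; have -> : - (y * v0) + cIm z * u = y * (u - v0) by rewrite /y; ring.
  by rewrite /x; ring.
have -> : cRe (Cint leb (fun u => k * gker 1 z u)) =
    \int[leb]_u (expR (x * u - expR u) * cos (y * (u - v0))).
  by rewrite -[LHS]/(\int[leb]_u _); apply: eq_Rintegral => u _; exact: e.
have {}ik : itg leb (fun u => expR (x * u - expR u) * cos (y * (u - v0))).
  by apply: eq_integrable ik => // u _; rewrite [LHS]/comp e.
pose h u := (1 + 4 * y ^+ 2) * expR (x * u - expR u) - (2 * y ^+ 2 / x) * expR ((x +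
  1) * u - expR u)
   - (2 * y ^+ 2 * x) * expR ((x - 1) * u - expR u).
have i0 := itg_rGam x0.
have i1 : itg leb (fun u => expR ((x + 1) * u - expR u)) by apply: itg_rGam; lra.
have i2 := itg_rGam x1.
have ih : itg leb h by apply: itgB; [apply: itgB; exact: itgZl|exact: itgZl].
have : \int[leb]_u h u <= \int[leb]_u (expR (x * u - expR u) * cos (y * (u - v0))).
  apply: le_Rintegral => // u _; rewrite /h.
  have -> : expR ((x + 1) * u - expR u) = expR (x * u - expR u) * (expR (u - v0) * x).
    by rewrite expRB /v0 lnK ?posrE// mulfVK ?gt_eqF// -expRD; congr expR; ring.
  have -> : expR ((x - 1) * u - expR u) = expR (x * u - expR u) * (expR (- (u - v0)) / x).
    have -> : - (u - v0) = v0 - u by ring.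
    rewrite expRB /v0 lnK ?posrE//.
    have -> : x / expR u / x = expR (- u) by rewrite expRN; field;
      rewrite !lt0r_neq0// expR_gt0.
    by rewrite -expRD; congr expR; ring.
  set E := expR (x * u - expR u); have E0 : 0 <= E by exact: expR_ge0.
  have c1 := cos_ge (y * (u - v0)).
  have c2 := sqr_le_expR (u - v0).
  set P := expR (u - v0) in c2 *; set Q := expR (- (u - v0)) in c2 *.
  have -> : (1 + 4 * y ^+ 2) * E - 2 * y ^+ 2 / x * (E * (P * x)) - 2 * y ^+ 2 * x * (E *
    (Q / x))
     = E * (1 - 2 * y ^+ 2 * (P + Q - 2)) by field; rewrite gt_eqF.
  apply: ler_wpM2l => //; apply: le_trans c1.
  rewrite exprMn; have y2 := sqr_ge0 y.
  have : y ^+ 2 * (u - v0) ^+ 2 <= y ^+ 2 * (4 * (P + Q - 2)) by apply: ler_wpM2l.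
  lra.
move=> le1 eq1; rewrite eq1 in le1; move: le1.
rewrite /h RintegralB//; [|by apply: itgB; exact: itgZl|exact: itgZl].
rewrite RintegralB//; [|exact: itgZl|exact: itgZl].
rewrite !RintegralZl// -/(rGam x) -/(rGam (x + 1)) -/(rGam (x - 1)) rGam_add1//.
(* The functional equation reduces all three values to [rGam (x - 1)]; its total coefficient is (x -
   1) - 2y^2, positive by hypothesis. *)
have e1 : rGam x = (x - 1) * rGam (x - 1) by rewrite -(rGam_add1 x1) subrK.
have := rGam_gt0 x1; set g := rGam (x - 1) in e1 *; rewrite e1 => g0.
have -> : (1 + 4 * y ^+ 2) * ((x - 1) * g) - 2 * y ^+ 2 / x * (x * ((x - 1) * g)) - 2 *
  y ^+ 2 * x * g
   = ((x - 1) - 2 * y ^+ 2) * g by field; rewrite gt_eqF.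
by rewrite leNgt mulr_gt0// subr_gt0.
Qed.

(** A zero would propagate to all z + n by the functional equation, while for large n the real part
    exceeds 1 + 2 (Im z)^2. *)
Lemma Gam_neq0 z : 0 < cRe z -> Gam z != 0.
Proof.
move=> z0; apply/eqP => G0.
have h n : 0 < cRe (z + n%:R) /\ Gam (z + n%:R) = 0.
  elim: n => [|n [ih1 ih2]]; first by rewrite addr0.
  rewrite -addn1 natrD addrA; split; first by rewrite cReD /= addr_gt0.
  by rewrite Gam_add1// ih2 mulr0.
pose n := (Num.truncn (1 + 2 * cIm z ^+ 2)).+1.
have hn : 1 + 2 * cIm z ^+ 2 < n%:R by rewrite /n; exact: truncnS_gt.
have rn : forall m, cRe (m%:R : C) = m%:R /\ cIm (m%:R : C) = 0.
  elim => [|m [a b]]; first by [].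
  by rewrite -addn1 !natrD cReD cImD a b /= addr0.
have [_ /eqP] := h n; apply/negP.
by apply: Gam_neq0_large; rewrite ?cReD ?cImD (rn n).1 ?(rn n).2 ?addr0;
  have := sqr_ge0 (cIm z); lra.
Qed.

End gamma.

(** * Fourier transforms of truncated powers and Gaussians *)

Section tuple_measure.
Context {R : realType}.
Local Notation leb := (@lebesgue_measure R).
Local Notation mR := (measurableTypeR R).
Local Notation lam n := (@lebesgue_tuple R n).
Implicit Types (xi : nat -> R) (x s th : R).

Lemma itg_cons n (f : n.+1.-tuple mR -> R) : measurable_fun setT f ->
  itg (leb \x lam n)%E (fun p => f (tuple_cons p)) -> itg (lam n.+1) f.
Proof.
move=> mf h.
have := @integrable_pushforward _ _ _ _ R (@tuple_cons R n) (@measurable_tuple_cons R n)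
  (leb \x lam n)%E setT (EFin \o f).
apply => //; first exact/measurable_EFinP.
Qed.

Lemma Rint_cons n (f : n.+1.-tuple mR -> R) : measurable_fun setT f ->
  itg (leb \x lam n)%E (fun p => f (tuple_cons p)) ->
  \int[lam n.+1]_t f t = \int[(leb \x lam n)%E]_p f (tuple_cons p).
Proof.
move=> mf h; rewrite /Rintegral; congr fine.
have := @integral_pushforward _ _ _ _ R (@tuple_cons R n) (@measurable_tuple_cons R n)
  (leb \x lam n)%E setT (EFin \o f).
apply => //; first exact/measurable_EFinP.
Qed.

Lemma Rint_tuple0 (f : 0.-tuple mR -> R) : \int[lam 0]_t f t = f [tuple].
Proof.
rewrite /Rintegral.
have -> : (\int[lam 0]_t (f t)%:E = (f [tuple])%:E)%E; last by [].
rewrite (_ : lam 0 = dirac [tuple])//.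
have mf : measurable_fun setT f.
  move=> _ Y mY; rewrite setTI.
  have [h|h] := pselect (Y (f [tuple])).
    rewrite (_ : f @^-1` Y = setT); first exact: measurableT.
    by apply/seteqP; split => // t _ /=; rewrite (tuple0 t).
  rewrite (_ : f @^-1` Y = set0); first exact: measurable0.
  by apply/seteqP; split => // t /=; rewrite (tuple0 t).
rewrite integral_dirac//; last exact/measurable_EFinP.
by rewrite diracT mul1e.
Qed.

Lemma itg_tuple0 (f : 0.-tuple mR -> R) : itg (lam 0) f.
Proof.
have -> : f = cst (f [tuple]) by apply/funext => t; rewrite (tuple0 t).
exact: (@finite_measure_integrable_cst _ _ R (dirac [tuple]) setT).
Qed.

Definition sq n (t : n.-tuple mR) : R := \sum_(i < n) tnth t i ^+ 2.
(* The frequency xi is a function on nat, so that [xi \o S] drops the first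
   coordinate. *)
Definition dotp n xi (t : n.-tuple mR) : R := \sum_(i < n) xi i * tnth t i.

Lemma sq_ge0 n (t : n.-tuple mR) : 0 <= sq t.
Proof. by apply: sumr_ge0 => i _; exact: sqr_ge0. Qed.

Lemma sq_cons n (p : mR * n.-tuple mR) : sq (tuple_cons p) = p.1 ^+ 2 + sq p.2.
Proof.
rewrite /sq big_ord_recl; congr (_ + _).
by apply: eq_bigr => i _; rewrite /tuple_cons (tnth_nth 0) (tnth_nth 0).
Qed.

Lemma dotp_cons n xi (p : mR * n.-tuple mR) :
  dotp xi (tuple_cons p) = xi 0 * p.1 + dotp (xi \o S) p.2.
Proof.
rewrite /dotp big_ord_recl; congr (_ + _).
by apply: eq_bigr => i _; rewrite /tuple_cons (tnth_nth 0) (tnth_nth 0).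
Qed.

Lemma measurable_sq n : measurable_fun setT (@sq n).
Proof.
rewrite /sq; apply: measurable_sum => i; apply: measurable_funX.
exact: measurable_tnth.
Qed.

Lemma measurable_dotp n xi : measurable_fun setT (@dotp n xi).
Proof.
rewrite /dotp; apply: measurable_sum => i; apply: measurable_funM => //.
exact: measurable_tnth.
Qed.

Definition cube n (r : R) : set (n.-tuple mR) := [set t | forall i, `|tnth t i| <= r].

Lemma measurable_cube n (r : R) : measurable (@cube n r).
Proof.
rewrite (_ : cube r = \bigcap_(i in [set: 'I_n]) [set t | `|tnth t i| <= r]); last first.
  by apply/seteqP; split => t /= h i; [move=> _; exact: h|exact: h].
apply: fin_bigcap_measurable => // i _.
have m : measurable_fun setT (fun t : n.-tuple mR => `|tnth t i|).
  by apply: measurableT_comp => //; exact: measurable_tnth.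
rewrite (_ : [set _ | _] = (fun t : n.-tuple mR => `|tnth t i|) @^-1` `]-oo, r]).
  by rewrite -[X in measurable X]setTI; apply: m.
by apply/seteqP; split => t /=; rewrite in_itv.
Qed.

Lemma cube_measure n (r : R) : 0 <= r -> lam n (@cube n r) = ((2 * r) ^+ n)%:E.
Proof.
move=> r0; elim: n => [|n ih].
  rewrite expr0 /lebesgue_tuple /=.
  rewrite diracE mem_set//=; by case.
have e : (@tuple_cons R n) @^-1` (@cube n.+1 r) = (`[(- r)%R,
  r]%classic : set mR) `*` @cube n r.
  apply/seteqP; split => -[x t] /=.
    move=> h; split.
      by have := h ord0; rewrite /tuple_cons tnth0 /= in_itv /= ler_norml.
    by move=> i; have := h (lift ord0 i); rewrite /tuple_cons tnthS.
  rewrite in_itv /= => -[hx ht] i; have [j ->|->] := unliftP ord0 i.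
    by rewrite /tuple_cons tnthS; exact: ht.
  by rewrite /tuple_cons tnth0 /= ler_norml.
have -> : lam n.+1 (@cube n.+1 r) = (leb \x lam n)%E ((`[(- r)%R,
  r]%classic : set mR) `*` @cube n r).
  by rewrite -e.
rewrite product_measure1E//; last exact: measurable_cube.
rewrite exprS EFinM; congr (_ * _)%E; last exact: ih.
apply: (etrans (lebesgue_measure_itv _)); rewrite /= lte_fin.
case: ltP => [_|h]; first by rewrite -EFinD opprK; congr (_%:E); ring.
have -> : r = 0 by apply/eqP; lra.
by rewrite mulr0.
Qed.

Lemma itg_cube n (r : R) : 0 <= r -> itg (lam n) (\1_(@cube n r)).
Proof.
move=> r0; apply/integrableP; split.
  by apply/measurable_EFinP; apply: measurable_indic; exact: measurable_cube.
under eq_integral => x _ do rewrite /= ger0_norm ?indicE//.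
rewrite -[ltLHS]/(\int[lam n]_x (\1_(@cube n r) x)%:E)%E.
rewrite integral_indic ?setIT//; last exact: measurable_cube.
by rewrite [ltLHS](_ : _ = ((2 * r) ^+ n)%:E) ?ltry//; exact: cube_measure.
Qed.

Lemma Rint_cube n (r : R) : 0 <= r ->
  \int[lam n]_t \1_(@cube n r) t = (2 * r) ^+ n.
Proof.
move=> r0; rewrite /Rintegral integral_indic ?setIT//; last exact: measurable_cube.
by rewrite [X in fine X](_ : _ = ((2 * r) ^+ n)%:E)//; exact: cube_measure.
Qed.

Lemma sq_le_cube n (t : n.-tuple mR) (r : R) : 0 <= r -> sq t <= r ^+ 2 -> cube r t.
Proof.
move=> r0 h i; rewrite -ler_sqr ?nnegrE// real_normK ?num_real//.
apply: le_trans h; rewrite /sq (bigD1 i)//= lerDl.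
by apply: sumr_ge0 => j _; exact: sqr_ge0.
Qed.

Lemma itg_on_cube n (f : n.-tuple mR -> R) (c r : R) : 0 <= r ->
  measurable_fun setT f -> (forall t, `|f t| <= c * \1_(@cube n r) t) -> itg (lam n) f.
Proof.
by move=> r0 mf h; apply: itg_le h _ => //; apply: itgZl; exact: itg_cube.
Qed.

Lemma Rint_on_cube n (f : n.-tuple mR -> R) (c r : R) : 0 <= r ->
  measurable_fun setT f -> (forall t, `|f t| <= c * \1_(@cube n r) t) ->
  `|\int[lam n]_t f t| <= c * (2 * r) ^+ n.
Proof.
move=> r0 mf h; have ic := itg_cube n r0.
by rewrite -(Rint_cube n r0) -RintegralZl//; apply: Rint_le_norm h _ => //; exact: itgZl.
Qed.

(* At a = |x|^2: the truncated power (s - |x|^2)_+^N. *)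
Definition kern N s a : R := Num.max (s - a) 0 ^+ N.

Lemma kern_ge0 N s a : 0 <= kern N s a.
Proof. by apply: exprn_ge0; rewrite le_max lexx orbT. Qed.

(** The exponent is a successor because [0 ^+ 0 = 1]: with exponent 0 the kernel would not be
    supported in the ball. *)
Lemma kern_le N (r a : R) : 0 <= r -> 0 <= a ->
  kern N.+1 (r ^+ 2) a <= r ^+ (2 * N.+1) * (a <= r ^+ 2)%R%:R.
Proof.
move=> r0 a0; rewrite /kern; have [h|h] := leP a (r ^+ 2).
  rewrite mulr1 exprM lerXn2r ?nnegrE ?sqr_ge0 ?le_max ?lexx ?orbT//.
  by rewrite ge_max lerBlDr lerDl a0 sqr_ge0.
by rewrite mulr0 max_r ?expr0n// subr_le0 ltW.
Qed.

Lemma kern_neg N s a : s <= a -> kern N.+1 s a = 0.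
Proof. by move=> h; rewrite /kern max_r ?expr0n// subr_le0. Qed.

Lemma kern_shift N s a b : kern N s (a + b) = kern N (s - a) b.
Proof. by rewrite /kern; congr (Num.max _ _ ^+ _); ring. Qed.

(* The phase th lets one statement cover both the cosine and the sine transform. *)
Definition kern_cos n N s xi th : R := \int[lam n]_t (kern N s (sq t) * cos (dotp xi t +
  th)).

Lemma measurable_kern d (T : measurableType d) N s (f : T -> R) :
  measurable_fun setT f -> measurable_fun setT (fun t => kern N s (f t)).
Proof.
move=> mf; apply: measurable_funX; apply: measurable_maxr => //.
exact: measurable_funB.
Qed.

Lemma measurable_cosD d (T : measurableType d) (f : T -> R) (th : R) :
  measurable_fun setT f -> measurable_fun setT (fun t => cos (f t + th)).
Proof.
move=> mf; apply: measurableT_comp.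
  by apply: continuous_measurable_fun; exact: continuous_cos.
exact: measurable_funD.
Qed.

Lemma measurable_kern_cos_fun n N s xi th :
  measurable_fun setT (fun t : n.-tuple mR => kern N s (sq t) * cos (dotp xi t + th)).
Proof.
apply: measurable_funM.
  by apply: measurable_kern; exact: measurable_sq.
by apply: measurable_cosD; exact: measurable_dotp.
Qed.

Lemma kern_mul_cos_le n N (r : R) (t : n.-tuple mR) (v : R) : 0 <= r ->
  `|kern N.+1 (r ^+ 2) (sq t) * cos v| <= r ^+ (2 * N.+1) * \1_(@cube n r) t.
Proof.
move=> r0; rewrite normrM (ger0_norm (kern_ge0 _ _ _)).
apply: le_trans (_ : kern N.+1 (r ^+ 2) (sq t) <= _).
  by rewrite ler_piMr ?kern_ge0// cos_max.
apply: le_trans (kern_le _ r0 (sq_ge0 _)) _.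
apply: ler_wpM2l; first exact: exprn_ge0.
have [h|h] := boolP (sq t <= r ^+ 2)%R; last by rewrite indicE ler0n.
by rewrite indicE mem_set//; exact: sq_le_cube.
Qed.

Lemma itg_kern_cos n N (r : R) xi th : 0 <= r ->
  itg (lam n) (fun t => kern N.+1 (r ^+ 2) (sq t) * cos (dotp xi t + th)).
Proof.
move=> r0; apply: (itg_on_cube (c := r ^+ (2 * N.+1)) r0) => [|t].
  exact: measurable_kern_cos_fun.
exact: kern_mul_cos_le.
Qed.

Lemma kern_cos_le n N (r : R) xi th : 0 <= r ->
  `|kern_cos n N.+1 (r ^+ 2) xi th| <= 2 ^+ n * r ^+ (n + 2 * N.+1).
Proof.
move=> r0; have := @Rint_on_cube n _ (r ^+ (2 * N.+1)) r r0 (measurable_kern_cos_fun N.+1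
  (r ^+ 2) xi th).
move=> /(_ (fun t => kern_mul_cos_le N t _ r0)) /le_trans; apply.
by rewrite exprMn exprD mulrCA [r ^+ n * _]mulrC.
Qed.

Lemma itg_kern_cos_prod n N (r : R) xi th : 0 <= r ->
  itg (leb \x lam n)%E (fun p =>
    kern N.+1 (r ^+ 2) (sq (tuple_cons p)) * cos (dotp xi (tuple_cons p) + th)).
Proof.
move=> r0.
have mc := @measurable_tuple_cons R n.
have mf := measurableT_comp (measurable_kern_cos_fun (n := n.+1) N.+1 (r ^+ 2) xi th) mc.
apply: (itg_prod1 (m1 := leb) (m2 := lam n)
  (g := fun x : R => (r ^+ (2 * N.+1) * (2 * r) ^+ n) * \1_(`[(- r)%R,
    r]%classic : set R) x) mf).
  by apply: itgZl; exact: integrable_indic_itv.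
move=> x.
have ic := itg_cube n r0.
apply: (@le_trans _ _ (\int[lam n]_y ((r ^+ (2 * N.+1) * \1_(`[(- r)%R,
  r]%classic : set R) x) * \1_(@cube n r) y)%:E)%E).
  apply: ge0_le_integral => //.
  - apply/measurable_EFinP; apply: measurableT_comp => //.
    by apply: (measurableT_comp mf); exact: pair1_measurable.
  - apply/measurable_EFinP; apply: measurable_funM => //.
    by apply: measurable_indic; exact: measurable_cube.
  - move=> y _; rewrite lee_fin; apply: le_trans (kern_mul_cos_le N _ _ r0) _.
    rewrite -mulrA; apply: ler_wpM2l; first exact: exprn_ge0.
    rewrite indicE; have [/set_mem h|_] := boolP (_ \in _); last by rewrite mulr_ge0.
    rewrite !indicE !mem_set ?mulr1//.
      by move=> i; have := h (lift ord0 i); rewrite /tuple_cons tnthS.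
    by have := h ord0; rewrite /tuple_cons tnth0 /= in_itv /= ler_norml.
rewrite -[leLHS]fineK; last by apply: integrable_fin_num => //; exact: itgZl.
rewrite lee_fin -/(Rintegral _ _ _) RintegralZl// Rint_cube//.
by rewrite mulrAC.
Qed.

(** A slice of a truncated power is a truncated power in one dimension less, with r^2 lowered by
    x^2, and the sliced coordinate goes into the phase. This order of integration passes decay in a
    later coordinate down to the lower dimension. *)
Lemma kern_cos_cons1 n N (r : R) xi th : 0 <= r ->
  kern_cos n.+1 N.+1 (r ^+ 2) xi th =
  \int[leb]_x kern_cos n N.+1 (r ^+ 2 - x ^+ 2) (xi \o S) (th + xi 0 * x).
Proof.
move=> r0; rewrite /kern_cos Rint_cons; [|exact: measurable_kern_cos_fun|exact:
  itg_kern_cos_prod].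
rewrite Rint_prod1; last exact: itg_kern_cos_prod.
apply: eq_Rintegral => x _; apply: eq_Rintegral => t _.
by rewrite sq_cons dotp_cons kern_shift /=; congr (_ * cos _); ring.
Qed.

(** The opposite order, with a one-dimensional kernel innermost: it serves the decay in the first
    coordinate. *)
Lemma kern_cos_cons2 n N (r : R) xi th : 0 <= r ->
  kern_cos n.+1 N.+1 (r ^+ 2) xi th =
  \int[lam n]_t \int[leb]_x (kern N.+1 (r ^+ 2 - sq t) (x ^+ 2) *
     cos (xi 0 * x + (th + dotp (xi \o S) t))).
Proof.
move=> r0; rewrite /kern_cos Rint_cons; [|exact: measurable_kern_cos_fun|exact:
  itg_kern_cos_prod].
rewrite Rint_prod2; last exact: itg_kern_cos_prod.
apply: eq_Rintegral => x _; apply: eq_Rintegral => t _.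
rewrite sq_cons dotp_cons [_ ^+ 2 + _]addrC kern_shift /=; congr (_ * cos _); ring.
Qed.

End tuple_measure.

(** * Decay of the transforms of truncated powers *)

Section kernel_decay.
Context {R : realType}.
Local Notation leb := (@lebesgue_measure R).
Local Notation mR := (measurableTypeR R).
Local Notation lam n := (@lebesgue_tuple R n).
Implicit Types (xi : nat -> R) (x s th : R).

Definition pint (p : {poly R}) (om th : R) : R :=
  \int[leb]_(y in `[(-1)%R, 1%R]) (p.[y] * cos (om * y + th)).

Lemma itg_compact (f : R -> R) (a b : R) : continuous f ->
  leb.-integrable `[a, b] (EFin \o f).
Proof.
move=> cf; apply: continuous_compact_integrable; first exact: segment_compact.
exact: continuous_subspaceT.
Qed.

Lemma continuous_cosaff (om th : R) : continuous (fun y : R => cos (om * y + th)).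
Proof.
have h (x : R) : is_derive x 1 (fun y : R => cos (om * y + th)) (- om * sin (om * x + th)).
  by apply: is_derive_eq; rewrite /GRing.scale /=; ring.
exact: (is_derive_continuous h).
Qed.

Lemma continuous_polycos (p : {poly R}) (om th : R) :
  continuous (fun y : R => p.[y] * cos (om * y + th)).
Proof.
by move=> y; apply: cvgM; [exact: continuous_horner|exact: continuous_cosaff].
Qed.

Lemma pint_bound0 (p : {poly R}) : exists C : R, 0 <= C /\
  forall om th, `|pint p om th| <= C.
Proof.
exists (\int[leb]_(y in `[(-1)%R, 1%R]) `|p.[y]|).
have cp : continuous (fun y => p.[y]) by exact: continuous_horner.
split; first exact: Rintegral_ge0.
move=> om th; rewrite /pint.
have cc := @continuous_polycos p om th.
apply: le_trans (le_normr_Rintegral _ _) _ => //; first exact: itg_compact.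
apply: le_Rintegral => //.
- apply: itg_compact => y; apply: (@continuous_comp _ _ _ (fun y : R =>
  p.[y] * cos (om * y + th)) Num.norm); first exact: cc.
  exact: norm_continuous.
- apply: itg_compact => y; apply: (@continuous_comp _ _ _ (fun y : R => p.[y]) Num.norm);
  first exact: cp.
  exact: norm_continuous.
- by move=> y _; rewrite normrM ler_piMr// cos_max.
Qed.

(** One integration by parts. The phase shift by pi/2 writes the resulting sine as a cosine again,
    so that the step can be iterated. *)
Lemma pint_deriv (p : {poly R}) (om th : R) : p.[1] = 0 -> p.[-1] = 0 ->
  pint p om th * om = - pint p^`() om (th - pi / 2).
Proof.
move=> p1 pN1.
have dF (y : R) : is_derive y 1 (fun y => p.[y] * sin (om * y + th))
   (om * (p.[y] * cos (om * y + th)) + p^`().[y] * cos (om * y + (th - pi / 2))).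
  have h : is_derive y (1:R) (fun y => p.[y]) p^`().[y] by exact: is_derive_poly.
  rewrite addrA cosBpihalf.
  apply: is_derive_eq; rewrite /GRing.scale /=; ring.
have cc (q : {poly R}) th' : continuous (fun y : R => q.[y] * cos (om * y + th')).
  exact: continuous_polycos.
have cf : continuous (fun y : R => om * (p.[y] * cos (om * y + th)) +
  p^`().[y] * cos (om * y + (th - pi / 2))).
  by move=> y; apply: cvgD; [apply: cvgM; [exact: cvg_cst|exact: cc]|exact: cc].
have : \int[leb]_(y in `[(-1)%R, 1%R]) (om * (p.[y] * cos (om * y + th)) +
  p^`().[y] * cos (om * y + (th - pi / 2))) = 0.
  rewrite /Rintegral (@continuous_FTC2 _ _ (fun y => p.[y] * sin (om * y + th))).
  - by rewrite p1 pN1 !mul0r -EFinB subrr.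
  - by rewrite -subr_gt0 opprK addr_gt0.
  - exact: continuous_subspaceT.
  - have cF := is_derive_continuous dF.
    split; first by move=> x _; have [] := dF x.
    + by apply: cvg_at_right_filter; exact: cF.
    + by apply: cvg_at_left_filter; exact: cF.
  - by move=> x _; rewrite derive1E; have h := dF x; rewrite derive_val.
rewrite RintegralD//; last 2 first.
- by apply: itg_compact => y; apply: cvgM; [exact: cvg_cst|exact: cc].
- exact: itg_compact.
rewrite RintegralZl//; last exact: itg_compact.
rewrite -/(pint p om th) -/(pint _ om (th - pi / 2)) => /eqP.
by rewrite addr_eq0 mulrC => /eqP.
Qed.

(** Each integration by parts consumes one factor 1 - X^2, whose zeros at 1 and -1 remove the
    boundary terms; the cofactor [q] absorbs what the product rule produces. *)
Lemma pint_bound m N (p q : {poly R}) : (m <= N)%N -> p = (1 - 'X^2) ^+ N * q ->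
  exists C : R, 0 <= C /\ forall om th, `|pint p om th| * `|om| ^+ m <= C.
Proof.
elim: m N p q => [|m ih] N p q.
  move=> _ _; have [C [C0 h]] := pint_bound0 p; exists C; split => // om th.
  by rewrite expr0 mulr1.
case: N => // N mN ep.
have hv (v : R) : v ^+ 2 = 1 -> p.[v] = 0.
  by move=> v2; rewrite ep hornerM horner_exp !hornerE v2 subrr expr0n mul0r.
have p1 : p.[1] = 0 by apply: hv; rewrite expr1n.
have pN1 : p.[-1] = 0 by apply: hv; rewrite sqrrN expr1n.
pose q' := N.+1%:R * (1 - 'X^2)^`() * q + (1 - 'X^2) * q^`() : {poly R}.
have [|C [C0 h]] := ih N p^`() q' mN.
  rewrite ep /q' derivM deriv_exp /= -[X in X * q]mulr_natl (exprS (1 - 'X^2) N).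
  have alg (A : comNzRingType) (a du u v q1 dq : A) :
    a * (du * v) * q1 + u * v * dq = v * (a * du * q1 + u * dq) by ring.
  exact: alg.
exists C; split => // om th.
rewrite exprS mulrA -normrM pint_deriv// normrN; exact: h.
Qed.

Lemma continuous_kern N (a : R) : continuous (fun x : R => kern N a (x ^+ 2)).
Proof.
move=> x; rewrite /kern.
apply: (@continuous_comp _ _ _ (fun x => Num.max (a - x ^+ 2) 0) (fun y => y ^+ N));
  last exact: exprn_continuous.
apply: (@continuous_comp _ _ _ (fun x : R => a - x ^+ 2) (fun y => Num.max y 0)).
  by apply: cvgB; [exact: cvg_cst|exact: exprn_continuous].
have -> : (fun y : R => Num.max y 0) = (fun y => (y + `|y|) / 2).
  apply/funext => y; have [y0|y0] := leP 0 y; [rewrite ger0_norm//|rewrite ltr0_norm//];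
    lra.
apply: cvgM; last exact: cvg_cst.
by apply: cvgD; [exact: cvg_id|exact: norm_continuous].
Qed.

Definition kern_cos1 N (a om th : R) : R := \int[leb]_x (kern N a (x ^+ 2) * cos (om *
  x + th)).

Lemma itg_kern_cos1 N (a om th : R) : itg leb (fun x =>
  kern N.+1 a (x ^+ 2) * cos (om * x + th)).
Proof.
pose r := Num.sqrt a.
apply: (itg_le (mu := leb) (g := fun x : R => kern N.+1 a 0 * \1_(`[(- r)%R,
  r]%classic : set R) x)).
- apply: measurable_funM.
    by apply: continuous_measurable_fun; exact: continuous_kern.
  by apply: measurable_cosD; apply: measurable_funM.
- move=> x; rewrite normrM (ger0_norm (kern_ge0 _ _ _)).
  apply: le_trans (_ : kern N.+1 a (x ^+ 2) <= _).
    by rewrite ler_piMr ?kern_ge0// cos_max.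
  have [h|h] := leP a (x ^+ 2).
    by rewrite kern_neg// mulr_ge0// kern_ge0.
  rewrite indicE mem_set ?mulr1 /=; last first.
    rewrite in_itv /= -ler_norml -sqrtr_sqr ler_wsqrtr// ltW//.
  rewrite /kern lerXn2r ?nnegrE ?le_max ?lexx ?orbT// subr0.
  by rewrite ge_max lerBlDr lerDl sqr_ge0 (le_trans (sqr_ge0 x) (ltW h)).
- by apply: itgZl; exact: integrable_indic_itv.
Qed.

(** Rescaling by r turns the kernel into r^(2(N+1)) (1 - y^2)^(N+1) on [-1, 1] at frequency om r; m
    factors of r are then spent on replacing om r by om. *)
Lemma kern_cos1_decay N m : (m <= N.+1)%N -> exists C : R, 0 <= C /\
  forall r om th : R, 0 <= r ->
    `|kern_cos1 N.+1 (r ^+ 2) om th| * `|om| ^+ m <= C * r ^+ (1 + 2 * N.+1 - m).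
Proof.
move=> mN; have [C [C0 hC]] := @pint_bound m N.+1 ((1 - 'X^2) ^+ N.+1) 1 mN (esym (mulr1
  _)).
exists C; split => // r om th; rewrite le_eqVlt => /predU1P[<-|r0].
  rewrite /kern_cos1; under eq_Rintegral do rewrite expr0n /= kern_neg ?sqr_ge0// mul0r.
  rewrite Rintegral_cst// mul0r normr0 mul0r mulr_ge0// exprn_ge0//.
have cG : continuous (fun x : R => kern N.+1 (r ^+ 2) (x ^+ 2) * cos (om * x + th)).
  by move=> x; apply: cvgM; [exact: continuous_kern|exact: continuous_cosaff].
have [_] := Rint_affine 0 r0 cG (itg_kern_cos1 _ _ _ _).
have -> : \int[leb]_x (kern N.+1 (r ^+ 2) ((r * x + 0) ^+ 2) * cos (om * (r * x + 0) +
  th)) =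
    r ^+ (2 * N.+1) * pint ((1 - 'X^2) ^+ N.+1) (om * r) th.
  rewrite /pint -RintegralZl//; last first.
    exact: (@itg_compact (fun y : R => ((1 - 'X^2) ^+ N.+1).[y] * cos (om * r * y +
      th)) (-1) 1 (@continuous_polycos _ _ _)).
  rewrite [RHS]Rintegral_mkcond; apply: eq_Rintegral => x _.
  rewrite addr0 patchE; have e1 : r ^+ 2 - (r * x) ^+ 2 = r ^+ 2 * (1 - x ^+ 2) by ring.
  have [/set_mem /=|/negP h] := boolP (x \in _).
    rewrite in_itv /= -ler_norml => hx.
    have x2 : x ^+ 2 <= 1 by rewrite -real_normK ?num_real// expr_le1.
    rewrite /kern e1 max_l; last by rewrite mulr_ge0 ?sqr_ge0// subr_ge0.
    have -> : ((1 - 'X^2) ^+ N.+1).[x] = (1 - x ^+ 2) ^+ N.+1 by rewrite horner_exp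
      !hornerE.
    rewrite exprMn -exprM [RHS]mulrA; congr (_ * cos _); ring.
  rewrite kern_neg ?mul0r// -subr_le0 e1 pmulr_rle0 ?exprn_gt0// subr_le0.
  have : 1 < `|x|.
    by rewrite ltNge; apply/negP => hx; apply: h; apply/mem_set;
      rewrite /= in_itv /= -ler_norml.
  by move=> h1; rewrite -real_normK ?num_real// expr_ge1 // ltW.
rewrite -/(kern_cos1 _ _ _ _) => e.
have -> : kern_cos1 N.+1 (r ^+ 2) om th = r ^+ (1 +
  2 * N.+1) * pint ((1 - 'X^2) ^+ N.+1) (om * r) th.
  by rewrite exprD expr1 -mulrA e mulrA mulfV ?gt_eqF// mul1r.
have -> : (1 + 2 * N.+1 = (1 + 2 * N.+1 - m) + m)%N.
  by rewrite subnK// (leq_trans mN)// add1n mul2n -addnn leqW// leq_addl.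
rewrite exprD addnK; set a := r ^+ (1 + 2 * N.+1 - m).
have a0 : 0 <= a by rewrite exprn_ge0// ltW.
rewrite 2!normrM (ger0_norm a0) (ger0_norm (exprn_ge0 _ (ltW r0))).
have := hC (om * r) th; rewrite normrM (gtr0_norm r0) exprMn.
set P := `|pint _ _ _|; move=> h.
rewrite (_ : a * r ^+ m * P * `|om| ^+ m = P * (`|om| ^+ m * r ^+ m) * a); last by ring.
exact: ler_wpM2r.
Qed.

Lemma kern_cos_neg n N s xi th : s <= 0 -> kern_cos n N.+1 s xi th = 0.
Proof.
move=> s0; have e (t : n.-tuple mR) : kern N.+1 s (sq t) * cos (dotp xi t + th) = 0.
  by rewrite kern_neg ?mul0r// (le_trans s0)// sq_ge0.
by rewrite /kern_cos; under eq_Rintegral do rewrite e; rewrite Rintegral_cst// mul0r.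
Qed.

Lemma kern_cos1_neg N s om th : s <= 0 -> kern_cos1 N.+1 s om th = 0.
Proof.
move=> s0; have e x : kern N.+1 s (x ^+ 2) * cos (om * x + th) = 0.
  by rewrite kern_neg ?mul0r// (le_trans s0)// sqr_ge0.
by rewrite /kern_cos1; under eq_Rintegral do rewrite e; rewrite Rintegral_cst// mul0r.
Qed.

Lemma Rint_itv_le (f : R -> R) (c r : R) : 0 <= r -> measurable_fun setT f ->
  (forall x, `|f x| <= c * \1_(`[(- r)%R, r]%classic : set R) x) ->
  `|\int[leb]_x f x| <= c * (2 * r).
Proof.
move=> r0 mf h.
apply: le_trans (Rint_le_norm (mu := leb) mf h _) _.
  by apply: itgZl; exact: integrable_indic_itv.
rewrite RintegralZl//; last exact: integrable_indic_itv.
rewrite /Rintegral integral_indic// setIT.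
have -> // : fine (leb (`[(- r)%R, r]%classic : set R)) = 2 * r.
rewrite [X in fine X](_ : _ = (2 * r)%:E)//.
apply: (etrans (lebesgue_measure_itv _)); rewrite /= lte_fin.
case: ltP => [_|h0]; first by rewrite -EFinD opprK; congr (_%:E); ring.
have -> : r = 0 by apply/eqP; lra.
by rewrite mulr0.
Qed.

(* m integrations by parts in the variable x_j; the kernel vanishes to order N + 1
   on the sphere. *)
Lemma kern_cos_decay n N m j : (m <= N.+1)%N -> (j < n)%N -> exists C : R, 0 <= C /\
  forall (r : R) xi th, 0 <= r ->
    `|kern_cos n N.+1 (r ^+ 2) xi th| * `|xi j| ^+ m <= C * r ^+ (n + 2 * N.+1 - m).
Proof.
move=> mN; have m2N : (m <= 2 * N.+1)%N by rewrite (leq_trans mN)// leq_pmull.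
elim: n j => // n ih [|j] jn.
  have [C [C0 hC]] := kern_cos1_decay mN.
  exists (C * 2 ^+ n); split; first by rewrite mulr_ge0.
  move=> r xi th r0; rewrite kern_cos_cons2//.
  pose F (t : n.-tuple mR) := kern_cos1 N.+1 (r ^+ 2 - sq t) (xi 0) (th +
    dotp (xi \o S) t) : R.
  have iF : itg (lam n) F.
    have := itg_fub2 (itg_kern_cos_prod n N xi th r0).
    apply: eq_integrable => // t _; rewrite /F /kern_cos1 /=; congr (_%:E).
    apply: eq_Rintegral => x _.
    rewrite sq_cons dotp_cons [_ ^+ 2 + _]addrC kern_shift /=; congr (_ * cos _); ring.
  rewrite -/(\int[lam n]_t F t) -[X in X ^+ m]ger0_norm//.
  rewrite -normrX -normrM -RintegralZr//.
  apply: le_trans (@Rint_on_cube _ n (fun t => F t * `|xi 0%N| ^+ m) (C * r ^+ (1 +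
    2 * N.+1 - m)) r r0 _ _) _.
  - by apply: measurable_funM => //; exact: itg_meas iF.
  - move=> t; rewrite normrM normrX normr_id /F.
    have [h|h] := leP (r ^+ 2) (sq t).
      rewrite kern_cos1_neg ?subr_le0// normr0 mul0r mulr_ge0// ?indicE// mulr_ge0//
        exprn_ge0//.
    rewrite indicE mem_set ?mulr1; last by apply: sq_le_cube => //; exact: ltW.
    (* The slice at t is a one-dimensional kernel of radius rho <= r, and the bound is monotone in
       the radius. *)
    set rho := Num.sqrt (r ^+ 2 - sq t).
    have rho0 : 0 <= rho by exact: sqrtr_ge0.
    have -> : r ^+ 2 - sq t = rho ^+ 2 by rewrite sqr_sqrtr// subr_ge0 ltW.
    apply: le_trans (hC rho _ _ rho0) _; apply: ler_wpM2l => //.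
    apply: lerXn2r; rewrite ?nnegrE//.
    by rewrite -[leRHS](ger0_norm r0) -sqrtr_sqr ler_wsqrtr// lerBlDr lerDl sq_ge0.
  rewrite exprMn (_ : (n.+1 + 2 * N.+1 - m = (1 + 2 * N.+1 - m) + n)%N); last by lia.
  rewrite exprD (_ : C * r ^+ (1 + 2 * N.+1 - m) * (2 ^+ n * r ^+ n) =
    C * 2 ^+ n * (r ^+ (1 + 2 * N.+1 - m) * r ^+ n))//; ring.
have [C [C0 hC]] := ih j jn.
exists (C * 2); split; first by rewrite mulr_ge0.
move=> r xi th r0; rewrite kern_cos_cons1//.
pose F x := kern_cos n N.+1 (r ^+ 2 - x ^+ 2) (xi \o S) (th + xi 0 * x).
have iF : itg leb F.
  have := itg_fub1 (itg_kern_cos_prod n N xi th r0).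
  apply: eq_integrable => // x _; rewrite /F /kern_cos /=; congr (_%:E).
  apply: eq_Rintegral => t _.
  rewrite sq_cons dotp_cons kern_shift /=; congr (_ * cos _); ring.
rewrite -/(\int[leb]_x F x) -[X in X ^+ m]ger0_norm//.
rewrite -normrX -normrM -RintegralZr//.
apply: le_trans (@Rint_itv_le (fun x => F x * `|xi j.+1| ^+ m) (C * r ^+ (n +
  2 * N.+1 - m)) r r0 _ _) _.
- by apply: measurable_funM => //; exact: itg_meas iF.
- move=> x; rewrite normrM normrX normr_id /F.
  have [h|h] := leP (r ^+ 2) (x ^+ 2).
    rewrite kern_cos_neg ?subr_le0// normr0 mul0r mulr_ge0// ?indicE// mulr_ge0//
      exprn_ge0//.
  rewrite indicE mem_set ?mulr1; last first.
    by rewrite /= in_itv /= -ler_norml -sqrtr_sqr -[leRHS](ger0_norm r0) -sqrtr_sqr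
      ler_wsqrtr// ltW.
  set rho := Num.sqrt (r ^+ 2 - x ^+ 2).
  have rho0 : 0 <= rho by exact: sqrtr_ge0.
  have -> : r ^+ 2 - x ^+ 2 = rho ^+ 2 by rewrite sqr_sqrtr// subr_ge0 ltW.
  apply: le_trans (hC rho _ _ rho0) _; apply: ler_wpM2l => //.
  apply: lerXn2r; rewrite ?nnegrE//.
  by rewrite -[leRHS](ger0_norm r0) -sqrtr_sqr ler_wsqrtr// lerBlDr lerDl sqr_ge0.
rewrite (_ : (n.+1 + 2 * N.+1 - m = (n + 2 * N.+1 - m).+1)%N); last by lia.
rewrite exprS (_ : C * r ^+ (n + 2 * N.+1 - m) * (2 * r) =
  C * 2 * (r * r ^+ (n + 2 * N.+1 - m)))//; ring.
Qed.

End kernel_decay.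

(** * Fourier transforms of Gaussians *)

Section gaussian.
Context {R : realType}.
Local Notation leb := (@lebesgue_measure R).
Local Notation mR := (measurableTypeR R).
Local Notation lam n := (@lebesgue_tuple R n).
Implicit Types (xi : nat -> R) (x s th : R).

Lemma gauss_cos_cont (om th : R) : continuous (fun x : R =>
  gauss_fun x * cos (om * x + th)).
Proof.
by move=> x; apply: cvgM; [exact: continuous_gauss_fun|exact: continuous_cosaff].
Qed.

Lemma itg_gauss_cos (om th : R) : itg leb (fun x => gauss_fun x * cos (om * x + th)).
Proof.
apply: (itg_le (mu := leb) (g := gauss_fun)); last exact: integrableT_gauss.
  exact: (continuous_measurable_fun (@gauss_cos_cont om th)).
by move=> x; rewrite normrM ger0_norm ?gauss_fun_ge0// ler_piMr ?gauss_fun_ge0 ?cos_max.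
Qed.

Lemma gauss_fun_bound x : (1 + `|x|) * gauss_fun x <= expR 1 * expR (- (1 * `|x|)).
Proof.
rewrite -expRD mul1r /gauss_fun.
have h := @expR_ge1Dx R `|x|.
apply: le_trans (_ : expR `|x| * expR (- x ^+ 2) <= _);
  first by rewrite ler_wpM2r ?expR_ge0.
rewrite -expRD ler_expR -(real_normK (num_real x)).
have := sqr_ge0 (`|x| - 1); nra.
Qed.

Lemma is_derive_gauss x : is_derive x 1 (@gauss_fun R) (- (2 * x) * gauss_fun x).
Proof.
rewrite /gauss_fun; apply: is_derive_eq; rewrite /GRing.scale /=; ring.
Qed.

Lemma itg_xgauss_cos (om th : R) : itg leb (fun x => x * gauss_fun x * cos (om * x + th)).
Proof.
apply: (itg_le (mu := leb) (g := fun x : R => expR 1 * expR (- (1 * `|x|)))); last 1 first.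
- by apply: itgZl; exact: itg_exp_abs.
- have c : continuous (fun x : R => x * gauss_fun x * cos (om * x + th)).
    move=> x; apply: cvgM; last exact: continuous_cosaff.
    by apply: cvgM; [exact: cvg_id|exact: continuous_gauss_fun].
  exact: (continuous_measurable_fun c).
move=> x; rewrite 2!normrM (ger0_norm (gauss_fun_ge0 x)).
apply: le_trans (_ : `|x| * gauss_fun x <= _).
  by rewrite ler_piMr ?cos_max// mulr_ge0 ?gauss_fun_ge0.
apply: le_trans (gauss_fun_bound x).
by rewrite ler_wpM2r ?gauss_fun_ge0// lerDr.
Qed.

Definition IG (om : R) : R := \int[leb]_x (gauss_fun x * cos (om * x)).

Lemma IG_ibp (om : R) :
  2 * \int[leb]_x (x * gauss_fun x * sin (om * x)) = om * IG om.
Proof.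
have cs y : sin y = cos (y + (- (pi / 2))) :> R by rewrite cosBpihalf.
have i1 : itg leb (fun x => x * gauss_fun x * sin (om * x)).
  by have := itg_xgauss_cos om (- (pi / 2)); apply: eq_integrable => // x _ /=; rewrite cs.
have i2 : itg leb (fun x => gauss_fun x * cos (om * x)).
  by have := itg_gauss_cos om 0; apply: eq_integrable => // x _ /=; rewrite addr0.
have : \int[leb]_x (om * (gauss_fun x * cos (om * x)) - 2 * (x * gauss_fun x * sin (om *
  x))) = 0.
  have dF (x : R) : is_derive x 1 (fun y => gauss_fun y * sin (om * y))
      (om * (gauss_fun x * cos (om * x)) - 2 * (x * gauss_fun x * sin (om * x))).
    have h := is_derive_gauss x.
    apply: is_derive_eq; rewrite /GRing.scale /=; ring.
  apply: (Rint_derive0 dF).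
  - move=> x; apply: cvgB; apply: cvgM; try exact: cvg_cst.
      by have := @gauss_cos_cont om 0 x; under eq_fun do rewrite addr0.
    apply: cvgM; first by apply: cvgM; [exact: cvg_id|exact: continuous_gauss_fun].
    have := @continuous_cosaff R om (- (pi / 2)) x.
    by under eq_fun do rewrite -cs.
  - by apply: itgB; exact: itgZl.
  - apply: (cvg_expNabs (K := expR 1) ltr01 _).1 => x.
    rewrite normrM (ger0_norm (gauss_fun_ge0 x)); apply: le_trans (gauss_fun_bound x).
    rewrite mulrC; apply: ler_wpM2r; first exact: gauss_fun_ge0.
    by apply: le_trans (sin_max _) _; rewrite lerDl.
  - apply: (cvg_expNabs (K := expR 1) ltr01 _).2 => x.
    rewrite normrM (ger0_norm (gauss_fun_ge0 x)); apply: le_trans (gauss_fun_bound x).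
    rewrite mulrC; apply: ler_wpM2r; first exact: gauss_fun_ge0.
    by apply: le_trans (sin_max _) _; rewrite lerDl.
rewrite RintegralB//; [|exact: itgZl|exact: itgZl].
by rewrite !RintegralZl// => /eqP; rewrite subr_eq0 => /eqP ->.
Qed.

(** Differentiating under the integral produces the sine integral of [IG_ibp], which integration by
    parts turns back into [IG]. *)
Lemma is_derive_IG (om : R) : is_derive om 1 IG (- (om / 2) * IG om).
Proof.
pose f (o x : R) := gauss_fun x * cos (o * x).
have df (o x : R) : is_derive o 1 (f ^~ x) (- (x * gauss_fun x * sin (o * x))).
  rewrite /f; apply: is_derive_eq; rewrite /GRing.scale /=; ring.
have d1 (o x : R) : partial1of2 f o x = - (x * gauss_fun x * sin (o * x)).
  by rewrite partial1of2E; have h := df o x; rewrite derive_val.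
pose G (x : R) := expR 1 * expR (- (1 * `|x|)).
have iG : itg leb G by apply: itgZl; exact: itg_exp_abs.
have i2 (o : R) : itg leb (f o).
  by have := itg_gauss_cos o 0; apply: eq_integrable => // x _ /=; rewrite addr0.
have oI : (`](om - 1), (om + 1)[%classic : set R) om by rewrite /= in_itv /= ltrDl ltr01
  gtrBl ltr01.
have bnd (o x : R) : (`](om - 1), (om + 1)[%classic : set R) o -> setT x -> `|partial1of2
  f o x| <= G x.
  move=> _ _; rewrite d1 normrN 2!normrM (ger0_norm (gauss_fun_ge0 x)).
  apply: le_trans (gauss_fun_bound x).
  apply: le_trans (_ : `|x| * gauss_fun x <= _).
    by rewrite ler_piMr ?sin_max// mulr_ge0 ?gauss_fun_ge0.
  by rewrite ler_wpM2r ?gauss_fun_ge0// lerDr.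
have G0 (x : R) : 0 <= G x by rewrite mulr_ge0// expR_ge0.
have dd (o x : R) : derivable (f ^~ x) o 1 by have [] := df o x.
have h1 := @derivable_under_integral R _ _ leb f setT measurableT om (om - 1) (om + 1) oI
   (fun o _ => i2 o) (fun o x _ _ => dd o x) G G0 iG bnd.
have h2 := @differentiation_under_integral R _ _ leb f setT measurableT om (om - 1) (om +
  1) oI
   (fun o _ => i2 o) (fun o x _ _ => dd o x) G G0 iG bnd.
apply: DeriveDef; first exact: h1.
rewrite -derive1E h2.
have i1 : itg leb (fun x => x * gauss_fun x * sin (om * x)).
  have := itg_xgauss_cos om (- (pi / 2)); apply: eq_integrable => // x _ /=.
  by rewrite cosBpihalf.
under eq_Rintegral do rewrite d1 -mulN1r.
rewrite RintegralZl//; have := IG_ibp om; lra.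
Qed.

(** By the differential equation just found, IG(om) e^(om^2/4) is constant; its value at 0 is the
    Gaussian integral. *)
Lemma IGE (om : R) : IG om = Num.sqrt pi * expR (- (om ^+ 2 / 4)).
Proof.
have dJ (o : R) : is_derive o 1 (fun o => IG o * expR (o ^+ 2 / 4)) 0.
  have h := is_derive_IG o.
  have h2 : is_derive o 1 (fun o : R => expR (o ^+ 2 / 4)) (o / 2 * expR (o ^+ 2 / 4)).
    apply: is_derive_eq; rewrite /GRing.scale /=; by field.
  have hh := is_deriveM h h2.
  apply: (is_derive_eq hh); rewrite /GRing.scale /=; ring.
have := is_derive_0_is_cst om 0 dJ => /=.
have -> : IG 0 = Num.sqrt pi.
  rewrite /IG /Rintegral -[RHS]/(fine (Num.sqrt pi)%:E) -integralT_gauss.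
  by congr fine; apply: eq_integral => x _; rewrite mul0r cos0 mulr1.
rewrite expr0n /= mul0r expR0 mulr1 => <-.
by rewrite -mulrA -expRD subrr expR0 mulr1.
Qed.

Lemma gauss_sin0 (om : R) : \int[leb]_x (gauss_fun x * sin (om * x)) = 0.
Proof.
have cs y : sin y = cos (y + (- (pi / 2))) :> R by rewrite cosBpihalf.
have i1 : itg leb (fun x => gauss_fun x * sin (om * x)).
  by have := itg_gauss_cos om (- (pi / 2)); apply: eq_integrable => // x _ /=; rewrite cs.
have c1 : continuous (fun x : R => gauss_fun x * sin (om * x)).
  have := @gauss_cos_cont om (- (pi / 2)).
  by have -> // : (fun x : R => gauss_fun x * cos (om * x - pi / 2)) = (fun x =>
    gauss_fun x * sin (om * x)) by apply/funext => x; rewrite cs.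
have [_] := Rint_opp c1 i1.
have -> : \int[leb]_x (gauss_fun (- x) * sin (om * - x)) =
  \int[leb]_x (-1 * (gauss_fun x * sin (om * x))).
  by apply: eq_Rintegral => x _; rewrite /gauss_fun sqrrN mulrN sinN; ring.
rewrite RintegralZl//; lra.
Qed.

Lemma gauss_cos_int (om th : R) :
  \int[leb]_x (gauss_fun x * cos (om * x + th)) = cos th * (Num.sqrt pi *
    expR (- (om ^+ 2 / 4))).
Proof.
have cs y : sin y = cos (y + (- (pi / 2))) :> R by rewrite cosBpihalf.
have i1 : itg leb (fun x => gauss_fun x * sin (om * x)).
  by have := itg_gauss_cos om (- (pi / 2)); apply: eq_integrable => // x _ /=; rewrite cs.
have i2 : itg leb (fun x => gauss_fun x * cos (om * x)).
  by have := itg_gauss_cos om 0; apply: eq_integrable => // x _ /=; rewrite addr0.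
have -> : \int[leb]_x (gauss_fun x * cos (om * x + th)) =
    \int[leb]_x (cos th * (gauss_fun x * cos (om * x)) - sin th * (gauss_fun x *
      sin (om * x))).
  by apply: eq_Rintegral => x _; rewrite cosD; ring.
rewrite RintegralB//; [|exact: itgZl|exact: itgZl].
by rewrite !RintegralZl// gauss_sin0 mulr0 subr0 -IGE.
Qed.

Lemma gauss1 (a om th : R) : 0 < a ->
  itg leb (fun x => expR (- (a * x ^+ 2)) * cos (om * x + th)) /\
  \int[leb]_x (expR (- (a * x ^+ 2)) * cos (om * x + th)) =
  cos th * (Num.sqrt (pi / a) * expR (- (om ^+ 2 / (4 * a)))).
Proof.
move=> a0; pose c := Num.sqrt a; have c0 : 0 < c by rewrite sqrtr_gt0.
have ca : c ^+ 2 = a by rewrite sqr_sqrtr// ltW.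
have [] := Rint_affine 0 c0 (@gauss_cos_cont (om / c) th) (itg_gauss_cos (om / c) th).
have e x : gauss_fun (c * x + 0) * cos (om / c * (c * x + 0) + th) =
  expR (- (a * x ^+ 2)) * cos (om * x + th).
  rewrite /gauss_fun addr0 exprMn ca; congr (_ * cos _); field; exact: lt0r_neq0.
have -> : (fun x => gauss_fun (c * x + 0) * cos (om / c * (c * x + 0) + th)) = (fun x =>
  expR (- (a * x ^+ 2)) * cos (om * x + th)).
  by apply/funext.
move=> h1 h2; split=> //; rewrite h2 gauss_cos_int sqrtrM ?pi_ge0// sqrtrV ?(ltW a0)// -/c.
rewrite expr_div_n ca (_ : om ^+ 2 / a / 4 = om ^+ 2 / (4 * a)); first by ring.
by field; exact: lt0r_neq0.
Qed.

Definition nsq n xi : R := \sum_(i < n) xi i ^+ 2.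

Lemma gauss_measurable n (a : R) xi th :
  measurable_fun setT (fun t : n.-tuple mR => expR (- (a * sq t)) * cos (dotp xi t + th)).
Proof.
apply: measurable_funM; last by apply: measurable_cosD; exact: measurable_dotp.
apply: measurableT_comp => //; apply: measurableT_comp => //.
by apply: measurable_funM => //; exact: measurable_sq.
Qed.

(** Induction on the dimension for all phases at once: integrating out the last n coordinates, with
    xi_0 x added to the phase, leaves a one-dimensional integral of the same shape. *)
Lemma gaussn n (a : R) xi th : 0 < a ->
  itg (lam n) (fun t => expR (- (a * sq t)) * cos (dotp xi t + th)) /\
  \int[lam n]_t (expR (- (a * sq t)) * cos (dotp xi t + th)) =
  cos th * (Num.sqrt (pi / a) ^+ n * expR (- (nsq n xi / (4 * a)))).
Proof.
move=> a0; elim: n xi th => [|n ih] xi th.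
  split; first exact: itg_tuple0.
  rewrite Rint_tuple0 /sq /dotp /nsq !big_ord0 mulr0 mul0r oppr0 expR0 add0r expr0; ring.
have i0 : itg (lam n) (fun t => expR (- (a * sq t))).
  by have [+ _] := ih (fun=> 0) 0; apply: eq_integrable => // t _ /=;
    rewrite /dotp big1 ?add0r ?cos0 ?mulr1// => i _; rewrite mul0r.
have ip : itg (leb \x lam n)%E (fun p => expR (- (a * sq (tuple_cons p))) *
  cos (dotp xi (tuple_cons p) + th)).
  have mf := measurableT_comp (@gauss_measurable n.+1 a xi th) (@measurable_tuple_cons R n).
  apply: (itg_prod1 (m1 := leb) (m2 := lam n) (g := fun x : R =>
    expR (- (a * x ^+ 2)) * \int[lam n]_t expR (- (a * sq t))) mf).
    have [+ _] := gauss1 0 0 a0; move=> /(itgZr (\int[lam n]_t expR (- (a * sq t)))).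
    by apply: eq_integrable => // x _ /=; rewrite mul0r add0r cos0 mulr1.
  move=> x.
  apply: (@le_trans _ _ (\int[lam n]_y (expR (- (a * x ^+ 2)) * expR (- (a * sq y)))%:E)%E).
    apply: ge0_le_integral => //.
    - apply/measurable_EFinP; apply: measurableT_comp => //.
      by apply: (measurableT_comp mf); exact: pair1_measurable.
    - by apply/measurable_EFinP; apply: (itg_meas (mu := lam n)); exact: itgZl.
    - move=> y _; rewrite lee_fin /= sq_cons normrM ger0_norm ?expR_ge0//=.
      rewrite -expRD (_ : - (a * x ^+ 2) + - (a * sq y) = - (a * (x ^+ 2 + sq y)));
        last by ring.
      by rewrite ler_piMr ?expR_ge0// cos_max.
  rewrite -[leLHS]fineK; last by apply: integrable_fin_num => //; exact: itgZl.
  by rewrite lee_fin -/(Rintegral _ _ _) RintegralZl.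
split; first by apply: itg_cons => //; exact: gauss_measurable.
rewrite Rint_cons//; last exact: gauss_measurable.
rewrite Rint_prod1//.
have -> : \int[leb]_x \int[lam n]_t (expR (- (a * sq (tuple_cons (x,
  t)))) * cos (dotp xi (tuple_cons (x, t)) + th)) =
  \int[leb]_x ((expR (- (a * x ^+ 2)) * cos (xi 0 * x +
    th)) * (Num.sqrt (pi / a) ^+ n * expR (- (nsq n (xi \o S) / (4 * a))))).
  apply: eq_Rintegral => x _.
  have [hi he] := ih (xi \o S) (xi 0 * x + th).
  rewrite -[RHS]mulrA -he -RintegralZl//; apply: eq_Rintegral => t _.
  rewrite sq_cons dotp_cons mulrDr opprD expRD /= -mulrA; congr (_ * (_ * cos _)); ring.
have [hi he] := gauss1 (xi 0) th a0.
rewrite RintegralZr// he.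
have -> : nsq n.+1 xi = xi 0 ^+ 2 + nsq n (xi \o S) by rewrite /nsq big_ord_recl.
set D := 4 * a; rewrite (exprS _ n) [(_ + nsq _ _) / D]mulrDl opprD [expR (_ + _)]expRD.
ring.
Qed.

End gaussian.

(** * Superpositions of truncated powers *)

Section representation.
Context {R : realType}.
Local Notation leb := (@lebesgue_measure R).
Local Notation mR := (measurableTypeR R).
Local Notation lam n := (@lebesgue_tuple R n).
Implicit Types (xi : nat -> R) (w x s th : R).

Definition krnl n N (p : mR * n.-tuple mR) : R := kern N (expR p.1 ^+ 2) (sq p.2).

Lemma measurable_krnl n N : measurable_fun setT (@krnl n N).
Proof.
apply: measurable_funX; apply: measurable_maxr => //.
apply: measurable_funB.
  apply: measurable_funX; apply: measurableT_comp => //.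
apply: measurableT_comp => //; exact: measurable_sq.
Qed.

(** The weight in the hypothesis on [psi] is, up to the factor 2^n, a bound for the integral of the
    kernel of radius e^w. *)
Lemma itg_rep n N (psi : R -> R) (C e : R) xi th : 0 < e ->
  measurable_fun setT psi ->
  (forall w, `|psi w| * expR w ^+ (n + 2 * N.+1) <= C * expR (- (e * `|w|))) ->
  itg (leb \x lam n)%E (fun p => psi p.1 * (krnl N.+1 p * cos (dotp xi p.2 + th))).
Proof.
move=> e0 mpsi hpsi.
have mf : measurable_fun setT (fun p : mR * n.-tuple mR =>
  psi p.1 * (krnl N.+1 p * cos (dotp xi p.2 + th))).
  apply: measurable_funM; first exact: measurableT_comp.
  apply: measurable_funM; first exact: measurable_krnl.
  apply: measurable_cosD; apply: measurableT_comp => //; exact: measurable_dotp.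
apply: (itg_prod1 (m1 := leb) (m2 := lam n) (g := fun w : R =>
  2 ^+ n * C * expR (- (e * `|w|))) mf).
  by apply: itgZl; exact: itg_exp_abs.
move=> w; set r := expR w; have r0 : 0 <= r by exact: expR_ge0.
have ik : itg (lam n) (fun t => kern N.+1 (r ^+ 2) (sq t)).
  have := itg_kern_cos n N (fun=> 0) 0 r0; apply: eq_integrable => // t _ /=.
  by rewrite /dotp big1 ?add0r ?cos0 ?mulr1// => i _; rewrite mul0r.
apply: (@le_trans _ _ (\int[lam n]_y (`|psi w| * kern N.+1 (r ^+ 2) (sq y))%:E)%E).
  apply: ge0_le_integral => //.
  - apply/measurable_EFinP; apply: measurableT_comp => //.
    by apply: (measurableT_comp mf); exact: pair1_measurable.
  - by apply/measurable_EFinP; apply: (itg_meas (mu := lam n)); exact: itgZl.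
  - move=> y _; rewrite lee_fin /= normrM; apply: ler_wpM2l => //.
    by rewrite normrM ger0_norm ?kern_ge0// ler_piMr ?kern_ge0// cos_max.
rewrite -[leLHS]fineK; last by apply: integrable_fin_num => //; exact: itgZl.
rewrite lee_fin -/(Rintegral _ _ _) RintegralZl//.
have -> : \int[lam n]_t kern N.+1 (r ^+ 2) (sq t) = kern_cos n N.+1 (r ^+ 2) (fun=> 0) 0.
  apply: eq_Rintegral => t _.
  by rewrite /dotp big1 ?add0r ?cos0 ?mulr1// => i _; rewrite mul0r.
have := kern_cos_le n N (fun=> 0) 0 r0 => h.
have := hpsi w; rewrite -/r => h2.
apply: le_trans (_ : `|psi w| * (2 ^+ n * r ^+ (n + 2 * N.+1)) <= _).
  by apply: ler_wpM2l => //; apply: le_trans (ler_norm _) h.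
rewrite mulrCA -mulrA; apply: ler_wpM2l => //; exact: exprn_ge0.
Qed.

Lemma Rint_rep n N (psi : R -> R) (C e : R) (h : n.+1.-tuple mR -> R) xi th : 0 < e ->
  measurable_fun setT psi ->
  (forall w, `|psi w| * expR w ^+ (n.+1 + 2 * N.+1) <= C * expR (- (e * `|w|))) ->
  measurable_fun setT h ->
  (forall t, 0 < sq t -> h t = \int[leb]_w (psi w * kern N.+1 (expR w ^+ 2) (sq t))) ->
  itg leb (fun w => psi w * kern_cos n.+1 N.+1 (expR w ^+ 2) xi th) /\
  itg (lam n.+1) (fun t => h t * cos (dotp xi t + th)) /\
  \int[lam n.+1]_t (h t * cos (dotp xi t + th)) =
  \int[leb]_w (psi w * kern_cos n.+1 N.+1 (expR w ^+ 2) xi th).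
Proof.
move=> e0 mpsi hpsi mh hE.
have ip := itg_rep xi th e0 mpsi hpsi.
have i1 := itg_fub1 ip; have i2 := itg_fub2 ip.
have eB w : \int[lam n.+1]_t (psi w * (krnl N.+1 (w, t) * cos (dotp xi t + th))) =
  psi w * kern_cos n.+1 N.+1 (expR w ^+ 2) xi th.
  rewrite RintegralZl//; exact: itg_kern_cos (expR_ge0 _).
have f12 : \int[lam n.+1]_t \int[leb]_w (psi w * (krnl N.+1 (w,
  t) * cos (dotp xi t + th))) =
   \int[leb]_w (psi w * kern_cos n.+1 N.+1 (expR w ^+ 2) xi th).
  rewrite -(Rint_prod2 ip) (Rint_prod1 ip); apply: eq_Rintegral => w _; exact: eB.
have mg : measurable_fun setT (fun t => h t * cos (dotp xi t + th)).
  by apply: measurable_funM => //; apply: measurable_cosD; exact: measurable_dotp.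
split; first by apply: eq_integrable i1 => // w _; rewrite /= eB.
(* The representation of [h] is available only off the origin, which is the null cube of side 0. *)
pose Z : set (n.+1.-tuple mR) := @cube R n.+1 0.
have mZ : measurable Z by exact: measurable_cube.
have Z0 : lam n.+1 Z = 0%E.
  by apply: (etrans (@cube_measure R n.+1 0 (lexx _))); rewrite mulr0 expr0n.
have eq t : (setT `\` Z) t -> h t * cos (dotp xi t + th) =
   \int[leb]_w (psi w * (krnl N.+1 (w, t) * cos (dotp xi t + th))).
  move=> [_ nZ].
  have s0 : 0 < sq t.
    rewrite lt0r sq_ge0 andbT; apply/negP => /eqP s0; apply: nZ.
    by apply: sq_le_cube => //; rewrite s0 expr0n.
  rewrite hE// -RintegralZr//; first by apply: eq_Rintegral => w _; rewrite /krnl /= mulrA.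
  (* At fixed t the hypothesis on [psi] has n + 1 powers of e^w in excess. The kernel vanishes
     unless e^w > r, so they may be bounded below by r^(n+1). *)
  pose r := Num.sqrt (sq t); have r0 : 0 < r by rewrite sqrtr_gt0.
  have rr : r ^+ 2 = sq t by rewrite sqr_sqrtr// sq_ge0.
  apply: (itg_le (mu := leb) (g := fun w : R => (C / r ^+ n.+1) * expR (- (e * `|w|)))).
  - apply: measurable_funM => //; apply: (measurable_funX _).
    apply: measurable_maxr => //; apply: measurable_funB => //.
    by apply: measurable_funX; exact: measurable_expR.
  - move=> w; rewrite normrM (ger0_norm (kern_ge0 _ _ _)).
    have [hw|hw] := leP (expR w ^+ 2) (sq t).
      rewrite kern_neg// mulr0 mulr_ge0 ?expR_ge0// divr_ge0 ?exprn_ge0//; last exact: ltW.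
      by have := hpsi 0; rewrite normr0 mulr0 oppr0 expR0 expr1n !mulr1; apply: le_trans.
    have hr : r <= expR w by rewrite -ler_sqr ?nnegrE ?expR_ge0 ?ltW// rr.
    apply: le_trans (_ : `|psi w| * expR w ^+ (2 * N.+1) <= _).
      apply: ler_wpM2l => //.
      by apply: le_trans (kern_le _ (expR_ge0 _) (sq_ge0 _)) _; rewrite (ltW hw) mulr1.
    rewrite mulrAC ler_pdivlMr ?exprn_gt0//; apply: le_trans (hpsi w).
    rewrite -mulrA; apply: ler_wpM2l => //.
    rewrite [leRHS]exprD mulrC; apply: ler_wpM2r; first by rewrite exprn_ge0// expR_ge0.
    by apply: lerXn2r; rewrite ?nnegrE ?expR_ge0// ltW.
  - by apply: itgZl; exact: itg_exp_abs.
have ih : itg (lam n.+1) (fun t => h t * cos (dotp xi t + th)).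
  have mg' : measurable_fun setT (EFin \o (fun t =>
    h t * cos (dotp xi t + th))) by exact/measurable_EFinP.
  apply/(negligible_integrable mZ measurableT mg' Z0).
  have := (integrableS measurableT (measurableD measurableT mZ) (@subDsetl _ _ _) i2).
  by apply: eq_integrable => [|t /set_mem ht]; [exact: measurableD|rewrite /= eq].
split => //; rewrite -f12 /Rintegral; congr fine.
rewrite (negligible_integral mZ measurableT ih Z0) [RHS](negligible_integral mZ
  measurableT i2 Z0).
by apply: eq_integral => t /set_mem ht; rewrite /= eq.
Qed.

Lemma expxa_bound (x a : R) : 0 < x -> 0 < a -> exists K : R, forall u,
  expR (x * u) * expR (- (a * expR u)) <= K * expR (- (x * `|u|)).
Proof.
move=> x0 a0; exists (expR (4 * x ^+ 2) * expR (x * `|ln a| - x * ln a)) => u.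
have h := gker_bound (u + ln a) x0.
rewrite [X in x * _ - X]expRD lnK ?posrE// in h.
rewrite -!expRD ler_expR; rewrite -expRD ler_expR in h.
have : x * `|u| <= x * `|u + ln a| + x * `|ln a|.
  rewrite -mulrDr ler_pM2l//; have := ler_normB (u + ln a) (ln a); by rewrite addrK.
lra.
Qed.

Lemma expR_sqr w : expR w ^+ 2 = expR (2 * w).
Proof. by rewrite -expRM_natl. Qed.

Lemma is_derive_expR2 w : is_derive w 1 (fun w : R => expR w ^+ 2) (2 * expR w ^+ 2).
Proof. by apply: is_derive_eq; rewrite /GRing.scale /=; ring. Qed.

Lemma is_derive_subX (s : R) N w :
  is_derive w 1 (fun w => (expR w ^+ 2 - s) ^+ N.+1) (N.+1%:R * (expR w ^+ 2 - s) ^+ N *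
    (2 * expR w ^+ 2)).
Proof.
have h := is_derive_expR2 w.
have h4 : is_derive w 1 (fun w => expR w ^+ 2 - s) (2 * expR w ^+ 2).
  by apply: is_derive_eq; rewrite oppr0 addr0.
elim: N => [|N ih].
  rewrite expr0 mulr1 mul1r; exact: h4.
have h5 := is_deriveM h4 ih.
apply: (is_derive_eq h5); rewrite /GRing.scale /= (exprS _ N); ring.
Qed.

Lemma cvg_pow_exp (k : nat) (a : R) : 0 < a ->
  (fun y : R => y ^+ k * expR (- (a * y))) x @[x --> +oo] --> 0.
Proof.
move=> a0; apply/cvgrPdist_le => e e0.
pose c := a / k.+1%:R; have c0 : 0 < c by rewrite divr_gt0.
near=> y.
have y0 : 0 < y by near: y; exact: nbhs_pinfty_gt.
rewrite sub0r normrN ger0_norm; last by rewrite mulr_ge0 ?expR_ge0// exprn_ge0// ltW.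
have h : (c * y) ^+ k.+1 <= expR (a * y).
  have -> : a * y = k.+1%:R * (c * y) by rewrite /c [RHS]mulrA [_ *
    (a / _)]mulrC divfK// pnatr_eq0.
  rewrite expRM_natl; apply: lerXn2r; rewrite ?nnegrE ?expR_ge0 ?mulr_ge0 ?ltW//.
  by apply: lt_le_trans (expR_ge1Dx _); rewrite ltrDr.
rewrite expRN ler_pdivrMr ?expR_gt0//.
apply: le_trans (_ : e * (c * y) ^+ k.+1 <= _); last by rewrite ler_wpM2l// ltW.
have -> : e * (c * y) ^+ k.+1 = (e * c ^+ k.+1 * y) * y ^+ k.
  by rewrite exprMn (exprS y); ring.
rewrite -[leLHS]mul1r.
apply: ler_wpM2r; first by rewrite exprn_ge0// ltW.
rewrite -ler_pdivrMl; last by rewrite mulr_gt0// exprn_gt0.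
by rewrite mulr1; near: y; apply: nbhs_pinfty_ge; rewrite num_real.
Unshelve. all: end_near. Qed.

Lemma cvg_expR2 : (fun w : R => expR w ^+ 2) x @[x --> +oo] --> +oo.
Proof.
apply/cvgryPge => A; near=> w.
have w0 : A <= w by near: w; apply: nbhs_pinfty_ge; rewrite num_real.
have w1 : 0 <= w by near: w; apply: nbhs_pinfty_ge.
have := @expR_ge1Dx R w; nra.
Unshelve. all: end_near. Qed.

(** An antiderivative of (y - s)^N e^(-ay) dy in the variable y = e^(2w), unfolded by repeated
    integration by parts. *)
Fixpoint lapF (a s : R) (N : nat) (w : R) : R :=
  match N with
  | 0 => - (expR (- (a * expR w ^+ 2)) / a)
  | N'.+1 => - ((expR w ^+ 2 - s) ^+ N'.+1 * expR (- (a * expR w ^+ 2)) / a)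
             + N'.+1%:R / a * lapF a s N' w
  end.

Lemma is_derive_lapF (a s : R) N w : 0 < a ->
  is_derive w 1 (lapF a s N)
   (2 * expR w ^+ 2 * expR (- (a * expR w ^+ 2)) * (expR w ^+ 2 - s) ^+ N).
Proof.
move=> a0; have h := is_derive_expR2 w.
have h2 : is_derive w 1 (fun w => expR (- (a * expR w ^+ 2))) (- (a * (2 *
  expR w ^+ 2)) * expR (- (a * expR w ^+ 2))).
  by apply: is_derive_eq; rewrite /GRing.scale /=; ring.
elim: N => [|N ih] /=.
  apply: is_derive_eq; rewrite /GRing.scale /=; field; exact: lt0r_neq0.
have h3 := is_derive_subX s N w.
apply: is_derive_eq; rewrite /GRing.scale /= exprS; field; exact: lt0r_neq0.
Qed.

Lemma cvg_lapF (a s : R) N : 0 < a -> lapF a s N x @[x --> +oo] --> 0.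
Proof.
move=> a0.
have key k : (fun w => (expR w ^+ 2 - s) ^+ k * expR (- (a *
  expR w ^+ 2))) x @[x --> +oo] --> 0.
  have -> : (fun w => (expR w ^+ 2 - s) ^+ k * expR (- (a * expR w ^+ 2))) =
      (fun w => expR (- (a * s)) * ((expR w ^+ 2 - s) ^+ k * expR (- (a *
        (expR w ^+ 2 - s))))).
    apply/funext => w; rewrite [RHS]mulrCA -expRD; congr (_ * expR _); ring.
  rewrite -[X in _ --> X](mulr0 (expR (- (a * s)))); apply: cvgM; first exact: cvg_cst.
  apply: (cvg_comp (fun w => expR w ^+ 2 - s) (fun y => y ^+ k * expR (- (a * y))));
    last exact: cvg_pow_exp.
  apply/cvgryPge => A; near=> w; rewrite lerBrDr; near: w.
  by move/cvgryPge: cvg_expR2; apply.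
elim: N => [|N ih] /=.
  have h := key 0%N; rewrite -[X in _ --> X]oppr0 -(mul0r a^-1); apply: cvgN;
    apply: cvgM; last exact: cvg_cst.
  have -> // : (fun w => expR (- (a * expR w ^+ 2))) = (fun w =>
    (expR w ^+ 2 - s) ^+ 0 * expR (- (a * expR w ^+ 2))).
  by apply/funext => v; rewrite expr0 mul1r.
rewrite -[X in _ --> X](addr0 0); apply: cvgD.
  by rewrite -[X in _ --> X]oppr0 -(mul0r a^-1); apply: cvgN; apply: cvgM;
    [exact: key|exact: cvg_cst].
by rewrite -[X in _ --> X](mulr0 (N.+1%:R / a)); apply: cvgM => //; exact: cvg_cst.
Unshelve. all: end_near. Qed.

Lemma lapF0 (a s : R) N w : 0 < a -> expR w ^+ 2 = s ->
  lapF a s N w = - (N`!%:R / a ^+ N.+1 * expR (- (a * s))).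
Proof.
move=> a0 e; elim: N => [|N ih] /=; rewrite ?ih e.
  by rewrite fact0 expr1 mul1r mulrC.
rewrite subrr expr0n mul0r mul0r oppr0 add0r factS natrM [a ^+ N.+2]exprS.
set b := a ^+ N.+1; have b0 : b != 0 by rewrite expf_neq0// lt0r_neq0.
by field; rewrite b0 lt0r_neq0.
Qed.

(* The density whose superposition of kernels is the Gaussian e^(-a |x|^2), up to a
   constant; it yields the Laplace transform of kern_cos in the variable s. *)
Definition psiG (a w : R) : R := 2 * expR w ^+ 2 * expR (- (a * expR w ^+ 2)).

Lemma continuous_psiG (a : R) : continuous (psiG a).
Proof.
have d w : is_derive w 1 (psiG a) ((4 * expR w ^+ 2 - 2 * expR w ^+ 2 * (a * (2 *
  expR w ^+ 2))) * expR (- (a * expR w ^+ 2))).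
  have h := is_derive_expR2 w.
  have h2 : is_derive w 1 (fun w => expR (- (a * expR w ^+ 2))) (- (a * (2 *
    expR w ^+ 2)) * expR (- (a * expR w ^+ 2))).
    by apply: is_derive_eq; rewrite /GRing.scale /=; ring.
  rewrite /psiG; apply: is_derive_eq; rewrite /GRing.scale /=; ring.
exact: is_derive_continuous d.
Qed.

Lemma psiG_bound n (a : R) : 0 < a -> exists C : R, forall w,
  `|psiG a w| * expR w ^+ n <= C * expR (- (1 * `|w|)).
Proof.
move=> a0; have x0 : 0 < (n%:R + 2) / 2 :> R by rewrite divr_gt0// ltr_wpDl.
have [K hK] := expxa_bound x0 a0; exists (2 * K) => w.
rewrite ger0_norm /psiG; last by rewrite !mulr_ge0 ?expR_ge0// exprn_ge0// expR_ge0.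
have := hK (2 * w); rewrite -expR_sqr.
have -> : expR ((n%:R + 2) / 2 * (2 * w)) = expR w ^+ n * expR w ^+ 2.
  rewrite -exprD -expRM_natl natrD; congr expR; by field.
move=> h; apply: le_trans (_ : 2 * (K * expR (- ((n%:R + 2) / 2 * `|2 * w|))) <= _).
  rewrite (_ : 2 * expR w ^+ 2 * expR (- (a * expR w ^+ 2)) * expR w ^+ n =
    2 * (expR w ^+ n * expR w ^+ 2 * expR (- (a * expR w ^+ 2)))); last by ring.
  exact: ler_wpM2l.
have K0 : 0 <= K.
  have := hK 0; rewrite mulr0 !normr0 mulr0 oppr0 !expR0 !mulr1 mul1r => hK0.
  by apply: le_trans hK0; exact: expR_ge0.
rewrite -[leRHS]mulrA; apply: ler_wpM2l => //; apply: ler_wpM2l => //.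
rewrite ler_expR lerN2 normrM ger0_norm// mulrA; apply: ler_wpM2r => //.
have : 0 <= n%:R :> R by [].
lra.
Qed.

(** In the variable y = e^(2w) this is the integral of (y - s)^(N+1) e^(-ay) over y >= s, a shifted
    Euler integral. *)
Lemma psiG_kern (a s : R) N : 0 < a -> 0 < s ->
  \int[leb]_w (psiG a w * kern N.+1 (expR w ^+ 2) s) =
    N.+1`!%:R / a ^+ N.+2 * expR (- (a * s)).
Proof.
move=> a0 s0; pose w0 := ln s / 2.
have ew0 : expR w0 ^+ 2 = s by rewrite expR_sqr /w0 mulrC divfK// lnK.
have mono w : (w0 <= w) = (s <= expR w ^+ 2).
  by rewrite -ew0 !expR_sqr ler_expR ler_pM2l.
have -> : \int[leb]_w (psiG a w * kern N.+1 (expR w ^+ 2) s) =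
   \int[leb]_(w in `[w0, +oo[) (psiG a w * (expR w ^+ 2 - s) ^+ N.+1).
  rewrite [RHS]Rintegral_mkcond; apply: eq_Rintegral => w _; rewrite patchE.
  have [/set_mem /=|/negP h] := boolP (w \in _).
    rewrite in_itv /= andbT mono => h; by rewrite /kern max_l// subr_ge0.
  rewrite kern_neg ?mulr0// leNgt; apply/negP => h1; apply: h; apply/mem_set.
  by rewrite /= in_itv /= andbT mono ltW.
have dF w := is_derive_lapF s N.+1 w a0.
rewrite (@Rintegral_ge0_continuous_FTC2y _ _ (lapF a s N.+1) w0 0).
- by rewrite sub0r lapF0// opprK.
- move=> w; rewrite mono => h; rewrite /psiG !mulr_ge0 ?expR_ge0 ?exprn_ge0 ?expR_ge0//.
  by rewrite subr_ge0.
- apply: continuous_subspaceT => w; apply: cvgM; first exact: continuous_psiG.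
  exact: is_derive_continuous (is_derive_subX s N) _.
- exact: cvg_lapF.
- by move=> w _; have [] := dF w.
- by apply: cvg_at_right_filter; exact: (is_derive_continuous dF).
- by move=> w _; rewrite derive1E; have h := dF w; rewrite derive_val.
Qed.

Lemma psiG_kern_cos n N (a : R) xi th : 0 < a ->
  \int[leb]_w (psiG a w * kern_cos n.+1 N.+1 (expR w ^+ 2) xi th) =
  N.+1`!%:R / a ^+ N.+2 * (cos th * (Num.sqrt (pi / a) ^+ n.+1 *
    expR (- (nsq n.+1 xi / (4 * a))))).
Proof.
move=> a0; have [C hC] := psiG_bound (n.+1 + 2 * N.+1) a0.
have [||_ [_ <-]] := Rint_rep (h := fun t => N.+1`!%:R / a ^+ N.+2 * expR (- (a *
  sq t))) xi th ltr01
  (continuous_measurable_fun (@continuous_psiG a)) hC.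
- apply: measurable_funM => //; apply: measurableT_comp => //;
  apply: measurableT_comp => //.
  by apply: measurable_funM => //; exact: measurable_sq.
- by move=> t t0; rewrite psiG_kern.
have [ig eg] := gaussn n.+1 xi th a0.
rewrite -eg -RintegralZl//; apply: eq_Rintegral => t _; ring.
Qed.

End representation.

Section real_integrand.
Context d (T : measurableType d) (R : realType) (mu : {measure set T -> \bar R}).

Lemma Cint_real (f : T -> R) : Cint mu (fun x => (f x)%:C) = (\int[mu]_x f x)%:C.
Proof. by rewrite /Cint /= Rintegral_cst// mul0r. Qed.

Lemma Citg_real (f : T -> R) : itg mu f -> Citg mu (fun x => (f x)%:C).
Proof. by move=> h; split => //=; exact: integrable0. Qed.

End real_integrand.

(** * Transforms of pure powers *)

Section pure_term.
Context {R : realType}.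
Local Notation C := R[i].
Local Notation leb := (@lebesgue_measure R).
Local Notation mR := (measurableTypeR R).
Local Notation lam n := (@lebesgue_tuple R n).
Implicit Types (xi : nat -> R) (u w x s th : R) (z : C).

(** Measurability in w is extracted from Fubini's theorem: multiplied by the positive density
    [psiG 1] the function is a partial integral, and the density is then divided out. *)
Lemma measurable_kern_cos n N xi th :
  measurable_fun setT (fun w => kern_cos n.+1 N.+1 (expR w ^+ 2) xi th).
Proof.
have [D hD] := psiG_bound (n.+1 + 2 * N.+1) (@ltr01 R).
have ip := itg_rep (n := n.+1) xi th (@ltr01 R) (continuous_measurable_fun
  (@continuous_psiG R 1)) hD.
have i1 := itg_fub1 ip.
have m1 := itg_meas i1.
have -> : (fun w => kern_cos n.+1 N.+1 (expR w ^+ 2) xi th) =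
  (fun w => (expR (- (2 * w)) / 2 * expR (1 * expR w ^+ 2)) *
    \int[lam n.+1]_t (psiG 1 (w, t).1 * (krnl N.+1 (w, t) * cos (dotp xi (w, t).2 + th)))).
  apply/funext => w /=; rewrite RintegralZl//; last exact: itg_kern_cos (expR_ge0 _).
  rewrite mulrA -[LHS]mul1r; congr (_ * _).
  rewrite /psiG expRN -expR_sqr [expR (- _)]expRN; field.
  by rewrite !lt0r_neq0 ?exprn_gt0 ?expR_gt0.
have m2 : measurable_fun setT (fun w => expR (- (2 * w)) / 2).
  apply: measurable_funM => //; apply: measurableT_comp => //;
    apply: measurableT_comp => //.
have m3 : measurable_fun setT (fun w => expR (1 * expR w ^+ 2)).
  apply: measurableT_comp => //; apply: measurable_funM => //.
  by apply: measurable_funX; exact: measurable_expR.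
by apply: measurable_funM => //; exact: measurable_funM.
Qed.

Lemma rGam_scale x q : 0 < x -> 0 < q ->
  itg leb (fun u => expR (x * u - q * expR u)) /\
  \int[leb]_u expR (x * u - q * expR u) = expR (- (x * ln q)) * rGam x.
Proof.
move=> x0 q0.
have c1 : continuous (fun u : R => expR (x * u - expR u)).
  have d (u : R) : is_derive u 1 (fun u : R => expR (x * u - expR u)) ((x - expR u) *
    expR (x * u - expR u)).
    by apply: is_derive_eq; rewrite /GRing.scale /=; ring.
  exact: is_derive_continuous d.
have [] := Rint_affine (ln q) ltr01 c1 (itg_rGam x0).
have e u : expR (x * u - q * expR u) = expR (- (x * ln q)) * expR (x * (1 * u +
  ln q) - expR (1 * u + ln q)).
  rewrite -expRD [expR (_ + ln q)]expRD lnK ?posrE// mul1r; congr expR; ring.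
move=> i1 e1; have -> : (fun u => expR (x * u - q * expR u)) = (fun u =>
  expR (- (x * ln q)) * expR (x * (1 * u + ln q) - expR (1 * u + ln q))) by apply/funext.
split; first exact: itgZl.
by rewrite (RintegralZl _ measurableT i1) e1 invr1 mul1r.
Qed.

(* The factor 2 e^(2w) is the density of d(r^2) for r = e^w. *)
Definition kern_cos_density n N xi th w : R := 2 * expR w ^+ 2 *
  kern_cos n.+1 N.+1 (expR w ^+ 2) xi th.

Definition pureF n N z xi th (p : mR * mR) : C :=
  gker (expR p.2 ^+ 2) z p.1 * (kern_cos_density n N xi th p.2)%:C.

Lemma Cmeas_pureF n N z xi th : Cmeas (pureF n N z xi th).
Proof.
apply: CmeasM; last first.
  apply: Cmeas_real; rewrite /kern_cos_density; apply: measurable_funM.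
    apply: measurable_funM => //; apply: measurable_funX; apply: measurableT_comp => //.
  by apply: (measurableT_comp (measurable_kern_cos n N xi th)).
apply: CmeasM.
  have [a b] := Ccont_meas (Ccont_cexp z); split.
    exact: (measurableT_comp a).
  exact: (measurableT_comp b).
apply: Cmeas_real; apply: measurableT_comp => //; apply: measurableT_comp => //.
apply: measurable_funM.
  by apply: measurable_funX; apply: measurableT_comp.
exact: measurableT_comp.
Qed.

(** Integrating in u first turns the exponential weight into Gamma(Re z) e^(-2 Re z w), which leaves
    the quantity bounded by hypothesis. *)
Lemma itg_pureF n N z xi th (K e : R) : 0 < cRe z -> 0 < e ->
  (forall w, expR (- (2 * cRe z * w)) * `|kern_cos_density n N xi th w| <= K *
    expR (- (e * `|w|))) ->
  Citg (leb \x leb)%E (pureF n N z xi th).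
Proof.
move=> z0 e0 hK.
apply: (Citg_le (mu := (leb \x leb)%E) (g := fun p : mR * mR =>
  expR (cRe z * p.1 - expR p.2 ^+ 2 * expR p.1) * `|kern_cos_density n N xi th p.2|)).
- exact: Cmeas_pureF.
- by move=> p; rewrite /pureF Normc.normcM normc_gker normc_real.
have mf : measurable_fun setT (fun p : mR * mR =>
  expR (cRe z * p.1 - expR p.2 ^+ 2 * expR p.1) * `|kern_cos_density n N xi th p.2|).
  apply: measurable_funM.
    apply: measurableT_comp => //; apply: measurable_funB; first exact: measurable_funM.
    apply: measurable_funM; last exact: measurableT_comp.
    by apply: measurable_funX; apply: measurableT_comp.
  apply: measurableT_comp => //; rewrite /kern_cos_density; apply: measurable_funM.
    by apply: measurable_funM => //; apply: measurable_funX; apply: measurableT_comp.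
  by apply: (measurableT_comp (measurable_kern_cos n N xi th)).
apply: (itg_prod2 (m1 := leb) (m2 := leb) (g := fun w : R =>
  rGam (cRe z) * K * expR (- (e * `|w|))) mf).
  by apply: itgZl; exact: itg_exp_abs.
move=> w.
have q0 : 0 < expR w ^+ 2 by rewrite exprn_gt0// expR_gt0.
have [i1 e1] := rGam_scale z0 q0.
have -> : (\int[leb]_x `|expR (cRe z * (x, w).1 - expR (x, w).2 ^+ 2 * expR (x,
  w).1) * `|kern_cos_density n N xi th (x, w).2| |%:E =
  \int[leb]_x (expR (cRe z * x - expR w ^+ 2 * expR x) *
    `|kern_cos_density n N xi th w|)%:E)%E.
  apply: eq_integral => x _; congr (_%:E) => /=.
  by rewrite normrM ger0_norm ?expR_ge0// normr_id.
rewrite -[leLHS]fineK; last by apply: integrable_fin_num => //; exact: itgZr.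
rewrite lee_fin -/(Rintegral _ _ _) RintegralZr// e1 expR_sqr expRK.
rewrite mulrAC mulrC -[leRHS]mulrA; apply: ler_wpM2l; first by rewrite ltW// rGam_gt0.
apply: le_trans (hK w); rewrite ler_wpM2r// ler_expR; lra.
Qed.

Lemma gker_opp_int q z : 0 < q -> 0 < cRe z ->
  Citg leb (fun u => cexp (- z * u%:C) * (expR (- (q * expR (- u))))%:C) /\
  Cint leb (fun u => cexp (- z * u%:C) * (expR (- (q * expR (- u))))%:C) =
    cexp (- z * (ln q)%:C) * Gam z.
Proof.
move=> q0 z0; have [i1 e1] := gker_int q0 z0.
have [i2 e2] := Cint_opp (Ccont_gker q z) i1.
have -> : (fun u => cexp (- z * u%:C) * (expR (- (q * expR (- u))))%:C) = (fun u =>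
  gker q z (- u)).
  by apply/funext => u; rewrite /gker rmorphN /= mulrN mulNr.
by split; [exact: i2|rewrite e2 e1].
Qed.

(* Gam z r^(-2z) = int e^(zu) e^(-r^2 e^u) du turns powers into Gaussians, whose
   transforms are explicit. *)
Lemma pure_term n N z z' xi th (K e : R) : 0 < cRe z -> 0 < e ->
  (forall w, expR (- (2 * cRe z * w)) * `|kern_cos_density n N xi th w| <= K *
    expR (- (e * `|w|))) ->
  z + z' = N.+2%:R + (n.+1%:R / 2 : R)%:C -> 0 < cRe z' ->
  0 < nsq n.+1 xi ->
  Citg leb (fun w => cexp (- (2 * z) * w%:C) * (kern_cos_density n N xi th w)%:C) /\
  Gam z * Cint leb (fun w => cexp (- (2 * z) * w%:C) * (kern_cos_density n N xi th w)%:C) =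
  (N.+1`!%:R * Num.sqrt pi ^+ n.+1 * cos th)%:C * (cexp (- z' *
    (ln (nsq n.+1 xi / 4))%:C) * Gam z').
Proof.
move=> z0 e0 hK zz' z'0 q0.
have mrB : measurable_fun setT (kern_cos_density n N xi th).
  apply: measurable_funM; last exact: measurable_kern_cos.
  by apply: measurable_funM => //; apply: measurable_funX; exact: measurable_expR.
have i0 : Citg leb (fun w => cexp (- (2 * z) * w%:C) * (kern_cos_density n N xi th w)%:C).
  apply: (Citg_le (mu := leb) (g := fun w : R => K * expR (- (e * `|w|)))).
  - apply: CmeasM; last exact: Cmeas_real.
    exact: (Ccont_meas (Ccont_cexp _)).
  - move=> w; rewrite Normc.normcM normc_cexp normc_real cReZ.
    apply: le_trans (hK w); rewrite ler_wpM2r// ler_expR mulr_natl mulr2n cReN cReD; lra.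
  - by apply: itgZl; exact: itg_exp_abs.
split => //; rewrite -CintZ//.
have ip := itg_pureF z0 e0 hK.
have -> : Cint leb (fun w => Gam z * (cexp (- (2 * z) * w%:C) *
  (kern_cos_density n N xi th w)%:C)) =
  Cint leb (fun w => Cint leb (fun u => pureF n N z xi th (u, w))).
  apply: eq_Cint => w.
  have q1 : 0 < expR w ^+ 2 by rewrite exprn_gt0// expR_gt0.
  have [i1 e1] := gker_int q1 z0.
  have -> : (fun u => pureF n N z xi th (u, w)) = (fun u =>
    (kern_cos_density n N xi th w)%:C * gker (expR w ^+ 2) z u).
    by apply/funext => u; rewrite /pureF mulrC.
  rewrite (CintZ _ i1) e1 expR_sqr expRK.
  have -> : - z * (2 * w)%:C = - (2 * z) * w%:C by rewrite rmorphM /= rmorph_nat; ring.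
  by ring.
(* At fixed a = e^u the w-integral is a Gaussian in xi times a^(-(N+2) - (n+1)/2). Together with a^z
   this is a^(-z'), and what remains in u is Euler's integral at z', reflected in u. *)
rewrite -(Cint_fubini ip).
have q4 : 0 < nsq n.+1 xi / 4 by rewrite divr_gt0.
have [i2 e2] := gker_opp_int q4 z'0.
rewrite -e2 -CintZ//; apply: eq_Cint => u.
pose a := expR u; have a0 : 0 < a by exact: expR_gt0.
have -> : Cint leb (fun w => pureF n N z xi th (u, w)) =
  cexp (z * u%:C) * (\int[leb]_w (psiG a w * kern_cos n.+1 N.+1 (expR w ^+ 2) xi th))%:C.
  have [D hD] := psiG_bound (n.+1 + 2 * N.+1) a0.
  have mh : measurable_fun setT (fun t : n.+1.-tuple mR =>
    N.+1`!%:R / a ^+ N.+2 * expR (- (a * sq t))).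
    apply: measurable_funM => //; apply: measurableT_comp => //;
      apply: measurableT_comp => //.
    by apply: measurable_funM => //; exact: measurable_sq.
  have [ip1 _] := Rint_rep xi th ltr01
    (continuous_measurable_fun (@continuous_psiG R a)) hD mh (fun t t0 =>
      esym (psiG_kern N a0 t0)).
  rewrite -Cint_real -CintZ; last exact: (Citg_real ip1).
  apply: eq_Cint => w; rewrite /pureF /gker -mulrA -rmorphM; congr (_ * _%:C).
  by rewrite /psiG /kern_cos_density /= -/a [_ * a]mulrC; ring.
rewrite (psiG_kern_cos n N xi th a0).
have -> : cexp (z * u%:C) = cexp (- z' * u%:C) * (expR ((N.+2%:R + n.+1%:R / 2) * u))%:C.
  rewrite -cexp_real -cexpD; congr cexp; rewrite rmorphM rmorphD /= rmorph_nat -zz'; ring.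
rewrite -mulrA [RHS]mulrCA; congr (_ * _).
rewrite -!rmorphM; congr (_%:C).
have sa : Num.sqrt (pi / a) = Num.sqrt pi * expR (- (u / 2)).
  rewrite sqrtrM ?pi_ge0// sqrtrV ?(ltW a0)// expRN; congr (_ / _).
  have -> : a = expR (u / 2) ^+ 2 by rewrite expR_sqr /a; congr expR; field.
  by rewrite sqrtr_sqr ger0_norm// expR_ge0.
have ea : nsq n.+1 xi / (4 * a) = nsq n.+1 xi / 4 * expR (- u).
  by rewrite expRN -/a; field; rewrite lt0r_neq0.
rewrite sa ea exprMn mulrDl expRD.
have -> : expR (- (u / 2)) ^+ n.+1 = (expR (n.+1%:R / 2 * u))^-1.
  rewrite -expRM_natl -expRN; congr expR; by field.
have -> : a ^+ N.+2 = expR (N.+2%:R * u) by rewrite expRM_natl.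
have p1 : expR (N.+2%:R * u) != 0 by rewrite lt0r_neq0// expR_gt0.
have p2 : expR (n.+1%:R / 2 * u) != 0 by rewrite lt0r_neq0// expR_gt0.
move: (expR (N.+2%:R * u)) (expR (n.+1%:R / 2 * u)) p1 p2 => A B A0 B0.
by field; rewrite A0 B0.
Qed.

End pure_term.

(** * Derivatives with respect to the squared radius *)

Section radial_derivatives.
Context {R : realType}.
Local Notation C := R[i].
Local Notation leb := (@lebesgue_measure R).
Implicit Types (p u w x s : R) (z al be : C) (Phi : nat -> R -> R) (F : nat -> R -> C).

(* With Phi j the j-th derivative of a function of r and r = e^w, this is
   (d/d(r^2))^l applied to r^p Phi_j(r). *)
Fixpoint rop Phi l p j w : R :=
  match l with
  | 0 => expR (p * w) * Phi j w
  | l'.+1 => p / 2 * rop Phi l' (p - 2) j w + 2^-1 * rop Phi l' (p - 1) j.+1 w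
  end.

(* Phi j is r |-> g^(j)(r) read at r = e^w. *)
Definition jet Phi := forall j w, is_derive w 1 (Phi j) (expR w * Phi j.+1 w).

Lemma is_derive_rop Phi l p j w : jet Phi ->
  is_derive w 1 (rop Phi l p j) (2 * expR w ^+ 2 * rop Phi l.+1 p j w).
Proof.
move=> fP; elim: l p j => [|l ih] p j.
  have h := fP j w; rewrite /=.
  have h2 : is_derive w 1 (fun w => expR (p * w)) (p * expR (p * w)).
    by apply: is_derive_eq; rewrite /GRing.scale /=; ring.
  have h3 := is_deriveM h2 h.
  apply: (is_derive_eq h3); rewrite /GRing.scale /=.
  have -> : expR (p * w) = expR ((p - 2) * w) * expR w ^+ 2.
    by rewrite expR_sqr -expRD; congr expR; ring.
  have -> : expR ((p - 1) * w) = expR ((p - 2) * w) * expR w.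
    by rewrite -expRD; congr expR; ring.
  by field.
have h1 := ih (p - 2) j; have h2 := ih (p - 1) j.+1.
rewrite [rop Phi l.+1 p j]/=.
apply: is_derive_eq; rewrite /GRing.scale /=; ring.
Qed.

Lemma continuous_rop Phi l p j : jet Phi -> continuous (rop Phi l p j).
Proof. by move=> fP; exact: is_derive_continuous (fun w => is_derive_rop l p j w fP). Qed.

Lemma rop_bound Phi (e : R) l p j : (forall j, exists B : R, forall w,
  w <= 0 -> `|Phi j w| <= B * expR ((e - j%:R) * w)) ->
  exists B : R, forall w, w <= 0 -> `|rop Phi l p j w| <= B * expR ((p +
    e - j%:R - 2 * l%:R) * w).
Proof.
move=> hP; elim: l p j => [|l ih] p j /=.
  have [B hB] := hP j; exists B => w w0.
  rewrite normrM ger0_norm ?expR_ge0//.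
  have -> : (p + e - j%:R - 2 * 0%:R) * w = p * w + (e - j%:R) * w by ring.
  by rewrite expRD mulrCA; rewrite ler_wpM2l ?expR_ge0// hB.
have [B1 h1] := ih (p - 2) j; have [B2 h2] := ih (p - 1) j.+1.
exists (`|p / 2| * B1 + 2^-1 * B2) => w w0.
apply: le_trans (ler_normD _ _) _; rewrite normrM [`|2^-1 * _|]normrM (@ger0_norm _ 2^-1)//.
have e1 : (p - 2 + e - j%:R - 2 * l%:R) * w = (p + e - j%:R - 2 * l.+1%:R) * w.
  by rewrite -addn1 natrD; ring.
have e2 : (p - 1 + e - j.+1%:R - 2 * l%:R) * w = (p + e - j%:R - 2 * l.+1%:R) * w.
  by rewrite -(addn1 l) -(addn1 j) !natrD; ring.
rewrite mulrDl; apply: lerD; rewrite -mulrA; apply: ler_wpM2l => //.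
  by rewrite -e1; exact: h1.
by rewrite -e2; exact: h2.
Qed.

Lemma rop0 Phi l p j w : (forall j, Phi j w = 0) -> rop Phi l p j w = 0.
Proof.
by move=> h; elim: l p j => [|l ih] p j /=; rewrite ?h ?ih ?mulr0 ?addr0.
Qed.

Lemma rop_sum (I : Type) (r : seq I) (Psi : I -> nat -> R -> R) Phi l p j w :
  rop (fun j w => Phi j w - \sum_(i <- r) Psi i j w) l p j w =
  rop Phi l p j w - \sum_(i <- r) rop (Psi i) l p j w.
Proof.
elim: l p j => [|l ih] p j /=; first by rewrite mulrBr mulr_sumr.
rewrite !ih big_split /= -!mulr_sumr; ring.
Qed.

Definition rop_complex F l p j w : C := rop (fun j w =>
  cRe (F j w)) l p j w +i* rop (fun j w => cIm (F j w)) l p j w.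

Lemma rop_complex0 F p j w : rop_complex F 0 p j w = (expR (p * w))%:C * F j w.
Proof. by apply: complex_eq; rewrite ?cReM ?cImM /= mul0r ?subr0 ?addr0. Qed.

Lemma rop_complexS F l p j w : rop_complex F l.+1 p j w =
  (p / 2)%:C * rop_complex F l (p - 2) j w + (2^-1)%:C * rop_complex F l (p - 1) j.+1 w.
Proof.
by apply: complex_eq; rewrite ?cReD ?cImD ?cReM ?cImM /= !mul0r ?subr0 ?addr0.
Qed.

(* The falling factorial al (al - 1) ... (al - j + 1). *)
Definition ffact_complex al j : C := \prod_(i < j) (al - i%:R).

Lemma ffact_complexS al j : ffact_complex al j.+1 = ffact_complex al j * (al - j%:R).
Proof. by rewrite /ffact_complex big_ord_recr. Qed.

Lemma ffact_complexSl al j : ffact_complex al j.+1 = al * ffact_complex (al - 1) j.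
Proof.
rewrite /ffact_complex big_ord_recl subr0; congr (_ * _); apply: eq_bigr => i _.
by rewrite /bump /= natrD opprD addrA.
Qed.

(* The j-th derivative of c r^al at r = e^w. *)
Definition powF (c : C) al j w : C := c * (ffact_complex al j * cexp ((al - j%:R) * w%:C)).

(** As r^b is (r^2)^(b/2), each derivative with respect to r^2 brings down b/2 and lowers it by one:
    this is the second falling factorial, and the place where even natural exponents are
    annihilated. *)
Lemma rop_complex_pow c al l p j w :
  rop_complex (powF c al) l p j w =
  c * (ffact_complex al j * ffact_complex ((al + p%:C - j%:R) / 2) l * cexp ((al - j%:R +
    p%:C - 2 * l%:R) * w%:C)).
Proof.
elim: l p j => [|l ih] p j.
  rewrite rop_complex0 /powF -cexp_real /ffact_complex big_ord0 mulr1.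
  rewrite (_ : (al - j%:R + p%:C - 2 * 0%:R) * w%:C = (p * w)%:C + (al - j%:R) * w%:C);
    last by rewrite rmorphM /=; ring.
  rewrite cexpD; ring.
have two : (2 : C) != 0 by rewrite pnatr_eq0.
rewrite rop_complexS !ih ffact_complexS [ffact_complex _ l.+1]ffact_complexSl.
set be := (al + p%:C - j%:R) / 2.
have -> : (al + (p - 2)%:C - j%:R) / 2 = be - 1 by rewrite /be rmorphB /= rmorph_nat; field.
have -> : (al + (p - 1)%:C - j.+1%:R) / 2 = be - 1 by rewrite /be rmorphB /= rmorph1
  -addn1 natrD; field.
have -> : (al - j%:R + (p - 2)%:C - 2 * l%:R) = al - j%:R + p%:C - 2 * l.+1%:R.
  by rewrite rmorphB /= rmorph_nat -(addn1 l) natrD; ring.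
have -> : (al - j.+1%:R + (p - 1)%:C - 2 * l%:R) = al - j%:R + p%:C - 2 * l.+1%:R.
  by rewrite rmorphB /= rmorph1 -(addn1 l) -(addn1 j) !natrD; ring.
have -> : (p / 2)%:C = p%:C / 2 by rewrite rmorphM /= fmorphV /= rmorph_nat.
have -> : (2^-1)%:C = 2^-1 :> C by rewrite fmorphV /= rmorph_nat.
by rewrite {3}/be; field.
Qed.

Lemma smooth_jet (f : R -> R) :
  (forall (j : nat) (s : R), 0 < s -> derivable (derive1n j f) s 1) ->
  jet (fun j w => derive1n j f (expR w)).
Proof.
move=> hf j w.
have h1 : is_derive (expR w) 1 (derive1n j f) (derive1n j.+1 f (expR w)).
  apply: DeriveDef; first exact/hf/expR_gt0.
  by rewrite /derive1n iterS derive1E.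
have := is_derive1_comp h1 (is_derive_expR w).
by rewrite mulrC.
Qed.

(** At w = 0 the right-hand difference quotients vanish, and since the two-sided derivative exists
    this determines it. Hence all derivatives vanish at r = 1 too. *)
Lemma jet_zero Phi : jet Phi -> (forall w, 0 <= w -> Phi 0%N w = 0) ->
  forall j w, 0 <= w -> Phi j w = 0.
Proof.
move=> fP h0; elim => // j ih w w0.
have [dP eP] := fP j w.
suff : expR w * Phi j.+1 w = 0.
  by move/eqP; rewrite mulf_eq0 gt_eqF ?expR_gt0//= => /eqP.
have h1 : h^-1 *: ((Phi j \o shift w) (h *: (1 : R)) - Phi j w) @[h --> 0^'] --> expR w *
  Phi j.+1 w.
  by rewrite -eP; exact: dP.
have h2 : h^-1 *: ((Phi j \o shift w) (h *: (1 : R)) - Phi j w) @[h --> (0 : R)^'+] -->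
  expR w * Phi j.+1 w.
  move: h1; apply: cvg_trans; apply: cvg_app => P.
  by move=> [d /= d0 hd]; exists d => // y yd y0; apply: hd => //; rewrite gt_eqF.
have h3 : h^-1 *: ((Phi j \o shift w) (h *: (1 : R)) - Phi j w) @[h --> (0 : R)^'+] -->
  (0 : R).
  apply: cvg_near_cst; near=> h.
  have hp : 0 < h by near: h; exact: nbhs_right_gt.
  rewrite /= ih; last by rewrite addr_ge0// /GRing.scale /= mulr1 ltW.
  by rewrite ih// subrr scaler0.
exact: (cvg_unique _ h2 h3).
Unshelve. all: end_near. Qed.

(** Repeated integration by parts in the variable e^(2w). At w = 0 all derivatives of the function
    vanish; at w0 the power of e^(2w) - s does, until the last step, which leaves the value at
    w0. *)
Lemma cauchy_step Phi p s w0 l : jet Phi -> (forall j w, 0 <= w -> Phi j w = 0) ->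
  w0 < 0 -> s = expR w0 ^+ 2 ->
  \int[leb]_(w in `[w0, 0%R]) (2 * expR w ^+ 2 * rop Phi l.+1 p 0 w *
    (expR w ^+ 2 - s) ^+ l) =
  (-1) ^+ l.+1 * l`!%:R * rop Phi 0 p 0 w0.
Proof.
move=> fP P0 w00 es.
have r0 l' : rop Phi l' p 0 0 = 0 by apply: rop0 => j; exact: P0.
have ftc (G g : R -> R) : (forall w, is_derive w 1 G (g w)) -> continuous g ->
    \int[leb]_(w in `[w0, 0%R]) g w = G 0 - G w0.
  move=> dG cg; rewrite /Rintegral (@continuous_FTC2 _ g G)//.
  - exact: continuous_subspaceT.
  - have cG := is_derive_continuous dG.
    split; first by move=> x _; have [] := dG x.
    + by apply: cvg_at_right_filter; exact: cG.
    + by apply: cvg_at_left_filter; exact: cG.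
  - by move=> x _; rewrite derive1E; have h := dG x; rewrite derive_val.
have c2 : continuous (fun w : R => 2 * expR w ^+ 2).
  move=> w; apply: cvgM; first exact: cvg_cst.
  exact: (is_derive_continuous (@is_derive_expR2 R)).
have cX k : continuous (fun w : R => (expR w ^+ 2 - s) ^+ k).
  move=> w; apply: (@continuous_comp _ _ _ (fun w => expR w ^+ 2 - s) (fun y => y ^+ k));
    last exact: exprn_continuous.
  apply: cvgB; last exact: cvg_cst.
  exact: (is_derive_continuous (@is_derive_expR2 R)).
have cg k m : continuous (fun w => 2 * expR w ^+ 2 * rop Phi k p 0 w *
  (expR w ^+ 2 - s) ^+ m).
  move=> w; apply: cvgM; last exact: cX.
  by apply: cvgM; [exact: c2|exact: continuous_rop].
elim: l => [|l ih].
  rewrite (_ : (fun w => _) = (fun w => 2 * expR w ^+ 2 * rop Phi 1 p 0 w)); last first.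
    by apply/funext => w; rewrite expr0 mulr1.
  have cg1 : continuous (fun w => 2 * expR w ^+ 2 * rop Phi 1 p 0 w).
    by move=> w; apply: cvgM; [exact: c2|exact: continuous_rop].
  rewrite (ftc _ _ (fun w => is_derive_rop 0 p 0 w fP) cg1).
  by rewrite r0 sub0r fact0 expr1 mulr1 mulN1r.
have d (w : R) : is_derive w 1 (fun w => rop Phi l.+1 p 0 w * (expR w ^+ 2 - s) ^+ l.+1)
   (2 * expR w ^+ 2 * rop Phi l.+2 p 0 w * (expR w ^+ 2 - s) ^+ l.+1 +
    l.+1%:R * (2 * expR w ^+ 2 * rop Phi l.+1 p 0 w * (expR w ^+ 2 - s) ^+ l)).
  have h1 := is_derive_rop l.+1 p 0 w fP; have h2 := is_derive_subX s l w.
  have h3 := is_deriveM h1 h2.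
  apply: (is_derive_eq h3); rewrite /GRing.scale.
  move: (rop Phi l.+2 p 0 w) (rop Phi l.+1 p 0 w) => A B /=; rewrite (exprS _ l); ring.
have := ftc _ _ d; rewrite r0 mul0r sub0r -es subrr expr0n mulr0 oppr0.
rewrite RintegralD//; last 2 first.
- exact: (@itg_compact R _ w0 0 (cg _ _)).
- apply: (@itg_compact R (fun w => l.+1%:R * (2 * expR w ^+ 2 * rop Phi l.+1 p 0 w *
  (expR w ^+ 2 - s) ^+ l)) w0 0).
  by move=> w; apply: cvgM; [exact: cvg_cst|exact: cg].
rewrite RintegralZl//; last exact: (@itg_compact R _ w0 0 (cg _ _)).
rewrite ih => h.
have /eqP : \int[leb]_(w in `[w0, 0%R]) (2 * expR w ^+ 2 * rop Phi l.+2 p 0 w *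
  (expR w ^+ 2 - s) ^+ l.+1) +
   l.+1%:R * ((-1) ^+ l.+1 * l`!%:R * rop Phi 0 p 0 w0) = 0.
  apply: h => w; apply: cvgD; first exact: cg.
  by apply: cvgM; [exact: cvg_cst|exact: cg].
rewrite addr_eq0 => /eqP ->.
rewrite factS natrM [(-1) ^+ l.+2]exprS; ring.
Qed.

(** N + 2 integrations account for the factorial; the sign comes from integrating inwards from r =
    1. *)
Definition cauchy_cst (N : nat) : R := (-1) ^+ N.+2 / N.+1`!%:R.

Definition cauchy_density Phi p N w : R := cauchy_cst N * (2 * expR w ^+ 2 *
  rop Phi N.+2 p 0 w).

(* Cauchy's formula for repeated integration in the variable r^2, from the point
   r = 1 beyond which the function vanishes. *)
Lemma cauchy_repeated Phi p N w0 : jet Phi -> (forall j w, 0 <= w -> Phi j w = 0) ->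
  rop Phi 0 p 0 w0 =
  \int[leb]_w (cauchy_density Phi p N w * kern N.+1 (expR w ^+ 2) (expR w0 ^+ 2)).
Proof.
move=> fP P0.
have psi0 w : 0 <= w -> cauchy_density Phi p N w = 0.
  by move=> hw; rewrite /cauchy_density rop0 ?mulr0// => j; exact: P0.
have mono u v : (u <= v) = (expR u ^+ 2 <= expR v ^+ 2).
  by rewrite !expR_sqr ler_expR ler_pM2l.
have [w00|w00] := leP 0 w0.
  rewrite rop0; last by move=> j; exact: P0.
  have e w : cauchy_density Phi p N w * kern N.+1 (expR w ^+ 2) (expR w0 ^+ 2) = 0.
    have [hw|hw] := leP 0 w; first by rewrite psi0// mul0r.
    by rewrite kern_neg ?mulr0// -mono// (le_trans (ltW hw)).
  by under eq_Rintegral do rewrite e; rewrite Rintegral_cst// mul0r.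
have h := cauchy_step p N.+1 fP P0 w00 erefl.
have -> : rop Phi 0 p 0 w0 = cauchy_cst N * ((-1) ^+ N.+2 * N.+1`!%:R * rop Phi 0 p 0 w0).
  have sg : (-1) ^+ N.+2 * (-1) ^+ N.+2 = 1 :> R by rewrite -exprD addnn -mul2n exprM
    sqrrN expr1n expr1n.
  have f0 : N.+1`!%:R != 0 :> R by rewrite pnatr_eq0 -lt0n fact_gt0.
  transitivity ((-1) ^+ N.+2 * (-1) ^+ N.+2 * rop Phi 0 p 0 w0); first by rewrite sg mul1r.
  rewrite /cauchy_cst; move: {sg} ((-1) ^+ N.+2) => e; move: (N.+1`!%:R) f0 => f f0.
  by field.
rewrite -h -RintegralZl//; last first.
  apply: (@itg_compact R (fun w => 2 * expR w ^+ 2 * rop Phi N.+2 p 0 w *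
    (expR w ^+ 2 - expR w0 ^+ 2) ^+ N.+1) w0 0).
  move=> w; apply: cvgM.
    apply: cvgM; last exact: continuous_rop.
    by apply: cvgM; [exact: cvg_cst|exact: (is_derive_continuous (@is_derive_expR2 R))].
  exact: (is_derive_continuous (is_derive_subX (expR w0 ^+ 2) N)).
rewrite Rintegral_mkcond; apply: eq_Rintegral => w _; rewrite patchE.
have [/set_mem /=|/negP hn] := boolP (w \in _).
  rewrite in_itv /= => /andP[h1 h2].
  by rewrite /kern max_l ?subr_ge0 -?mono// /cauchy_density !mulrA.
have [hw|hw] := leP 0 w; first by rewrite psi0// mul0r.
rewrite kern_neg ?mulr0// -mono// leNgt; apply/negP => h1; apply: hn; apply/mem_set.
by rewrite /= in_itv /= !ltW.
Qed.

(** The estimate is known only near s = 0. On the compact rest of w <= 0 the continuous function |E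
    w| e^(-e w) attains a maximum. *)
Lemma near0_bound (E : R -> R) (B e : R) : continuous E ->
  (\forall s \near (0 : R)^'+, `|E (ln s)| <= B * s `^ e) ->
  exists B' : R, forall w, w <= 0 -> `|E w| <= B' * expR (e * w).
Proof.
move=> cE [d /= d0 hd].
pose s1 := Num.min (d / 2) 1; have s10 : 0 < s1 by rewrite lt_min divr_gt0// ltr01.
pose w1 := ln s1.
have w1le : w1 <= 0 by rewrite /w1 ln_le0// ge_min lexx orbT.
pose G w := `|E w| * expR (- (e * w)).
have cG : continuous G.
  move=> w; apply: cvgM; first by apply: (@continuous_comp _ _ _ E Num.norm);
    [exact: cE|exact: norm_continuous].
  have dd (v : R) : is_derive v 1 (fun w : R => expR (- (e * w))) (- e * expR (- (e * v))).
    by apply: is_derive_eq; rewrite /GRing.scale /=; ring.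
  exact: (is_derive_continuous dd).
have [c _ hc] := EVT_max w1le (continuous_subspaceT cG).
exists (Num.max B (G c)) => w w0.
have [hw|hw] := leP w1 w.
  have := hc w; rewrite in_itv /= hw w0 => /(_ isT) h.
  apply: le_trans (_ : G c * expR (e * w) <= _); last first.
    by rewrite ler_wpM2r ?expR_ge0// le_max lexx orbT.
  by rewrite -ler_pdivrMr ?expR_gt0// -expRN.
have h : `|E (ln (expR w))| <= B * expR w `^ e.
  apply: hd; last exact: expR_gt0.
  rewrite /ball_ /= sub0r normrN ger0_norm ?expR_ge0//.
  apply: lt_le_trans (_ : s1 <= _); first by rewrite -ltr_ln ?posrE ?expR_gt0// expRK.
  by rewrite ge_min ler_pdivrMr// ler_pMr// ler1n.
rewrite expRK in h; apply: le_trans h _.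
rewrite /powR gt_eqF ?expR_gt0// expRK; apply: ler_wpM2r; first exact: expR_ge0.
by rewrite le_max lexx.
Qed.

Lemma is_derive_cpow_Re (c be : C) s : 0 < s ->
  is_derive s 1 (fun t => cRe (c * cpow t be)) (cRe (c * be * cpow s (be - 1))).
Proof.
move=> s0; have h1 := is_derive_Re_cexp be (ln s).
have h2 := is_derive_Im_cexp be (ln s); have h3 := is_derive1_ln s0.
have k1 := is_derive1_comp h1 h3; have k2 := is_derive1_comp h2 h3.
have -> : (fun t => cRe (c * cpow t be)) =
  (fun t => cRe c * ((fun u : R => cRe (cexp (be * u%:C))) \o @ln R) t - cIm c *
    ((fun u : R => cIm (cexp (be * u%:C))) \o @ln R) t).
  by apply/funext => t; rewrite cReM /cpow /=.
have -> : cpow s (be - 1) = cexp (be * (ln s)%:C) * (s^-1)%:C.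
  have -> : (s^-1)%:C = cexp (- (ln s)%:C) by rewrite cexpN cexp_real lnK// fmorphV.
  by rewrite /cpow -cexpD; congr cexp; ring.
apply: is_derive_eq; rewrite /GRing.scale /= !(cReM, cImM) /=; ring.
Qed.

Lemma is_derive_cpow_Im (c be : C) s : 0 < s ->
  is_derive s 1 (fun t => cIm (c * cpow t be)) (cIm (c * be * cpow s (be - 1))).
Proof.
move=> s0; have h1 := is_derive_Re_cexp be (ln s).
have h2 := is_derive_Im_cexp be (ln s); have h3 := is_derive1_ln s0.
have k1 := is_derive1_comp h1 h3; have k2 := is_derive1_comp h2 h3.
have -> : (fun t => cIm (c * cpow t be)) =
  (fun t => cRe c * ((fun u : R => cIm (cexp (be * u%:C))) \o @ln R) t +
    cIm c * ((fun u : R => cRe (cexp (be * u%:C))) \o @ln R) t).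
  by apply/funext => t; rewrite cImM /cpow /=.
have -> : cpow s (be - 1) = cexp (be * (ln s)%:C) * (s^-1)%:C.
  have -> : (s^-1)%:C = cexp (- (ln s)%:C) by rewrite cexpN cexp_real lnK// fmorphV.
  by rewrite /cpow -cexpD; congr cexp; ring.
apply: is_derive_eq; rewrite /GRing.scale /= !(cReM, cImM) /=; ring.
Qed.

Lemma Cderive1n_cpow al j s : 0 < s ->
  Cderive1n j (fun t => cpow t al) s = ffact_complex al j * cpow s (al - j%:R).
Proof.
have near_pos (u : R) : 0 < u -> \forall t \near u, 0 < t.
  by move=> u0; exact: lt_nbhsr.
move=> s0; apply: complex_eq; rewrite /Cderive1n /=.
  elim: j s s0 => [|j ih] s s0.
    by rewrite /ffact_complex big_ord0 mul1r subr0.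
  rewrite /derive1n iterS derive1E -/(derive1n j _).
  rewrite (@near_eq_derive _ _ _ _ (fun t => cRe (ffact_complex al j *
    cpow t (al - j%:R)))); last first.
    by near=> t; apply: ih; near: t; exact: near_pos.
  have h := is_derive_cpow_Re (ffact_complex al j) (al - j%:R) s0.
  rewrite derive_val ffact_complexS -addn1 natrD; congr (cRe (_ * cpow _ _)); ring.
elim: j s s0 => [|j ih] s s0.
  by rewrite /ffact_complex big_ord0 mul1r subr0.
rewrite /derive1n iterS derive1E -/(derive1n j _).
rewrite (@near_eq_derive _ _ _ _ (fun t => cIm (ffact_complex al j *
  cpow t (al - j%:R)))); last first.
  by near=> t; apply: ih; near: t; exact: near_pos.
have h := is_derive_cpow_Im (ffact_complex al j) (al - j%:R) s0.
rewrite derive_val ffact_complexS -addn1 natrD; congr (cIm (_ * cpow _ _)); ring.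
Unshelve. all: end_near. Qed.

End radial_derivatives.

(** * Asymptotics of the Fourier transform *)

Section radial_transform.
Context {R : realType}.
Local Notation C := R[i].
Local Notation leb := (@lebesgue_measure R).
Local Notation mR := (measurableTypeR R).
Local Notation lam n := (@lebesgue_tuple R n).
Context (n : nat) (phi : R -> C) (mu : C) (c : nat -> C).
Context (sphi : smooth_on_pos phi).
Context (phi1 : forall s : R, 1 <= s -> phi s = 0).
Context (mu0 : 0 < cRe mu + n.+1%:R / 2).
Context (asym : forall j : nat, asymptotic_expansion j phi mu c).
Implicit Types (w s th : R) (xi : nat -> R).

(** All estimates are made in w = ln r, the origin being w -> -oo. [F j] stands for the j-th
    derivative of phi, [P k j] for that of the k-th term of its expansion, and [p] for the exponent
    of the factor |x|^(-dim/2). *)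
Let F (j : nat) w : C := Cderive1n j phi (expR w).
Let p : R := - (n.+1%:R / 2).
Let P (k j : nat) w : C := powF (c k) (mu + k%:R) j w.

Lemma jet_ReF : jet (fun j w => cRe (F j w)).
Proof. by apply: smooth_jet => j s s0; have [] := sphi j s0. Qed.

Lemma jet_ImF : jet (fun j w => cIm (F j w)).
Proof. by apply: smooth_jet => j s s0; have [] := sphi j s0. Qed.

Lemma ReF0 j w : 0 <= w -> cRe (F j w) = 0.
Proof.
apply: (jet_zero jet_ReF) => v v0; rewrite /F /= phi1//.
by rewrite -expR0 ler_expR.
Qed.

Lemma ImF0 j w : 0 <= w -> cIm (F j w) = 0.
Proof.
apply: (jet_zero jet_ImF) => v v0; rewrite /F /= phi1//.
by rewrite -expR0 ler_expR.
Qed.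

Lemma Ccont_P k j : Ccont (P k j).
Proof.
have h (a : C) : Ccont (fun w : R => a) by split => x; exact: cvg_cst.
by apply: CcontM => //; apply: CcontM => //; exact: Ccont_cexp.
Qed.

Lemma continuous_sum (I : Type) (r : seq I) (g : I -> R -> R) :
  (forall i, continuous (g i)) -> continuous (fun w => \sum_(i <- r) g i w).
Proof.
move=> h w; elim: r => [|i r ih].
  rewrite (_ : (fun w => _) = cst 0); first exact: cvg_cst.
  by apply/funext => v; rewrite big_nil.
rewrite (_ : (fun w => _) = (fun w => g i w + \sum_(i <- r) g i w)).
  by apply: cvgD => //; exact: h.
by apply/funext => v; rewrite big_cons.
Qed.

Lemma F_asym_near M j : exists B : R, \forall s \near (0 : R)^'+,
  normc (F j (ln s) - \sum_(k < M) P k j (ln s)) <= B * s `^ (cRe mu + M%:R - j%:R).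
Proof.
have [B hB] := asym j M; exists B; near=> s.
have s0 : 0 < s by near: s; exact: nbhs_right_gt.
have -> : F j (ln s) - \sum_(k < M) P k j (ln s) =
   Cderive1n j phi s - \sum_(k < M) c k * Cderive1n j (fun t => cpow t (mu + k%:R)) s.
  rewrite /F lnK ?posrE//; congr (_ - _); apply: eq_bigr => k _.
  by rewrite Cderive1n_cpow.
by near: s.
Unshelve. all: end_near. Qed.

Lemma ReF_asym M j : exists B : R, forall w, w <= 0 ->
  `|cRe (F j w) - \sum_(k < M) cRe (P k j w)| <= B * expR ((cRe mu + M%:R - j%:R) * w).
Proof.
have [B hB] := F_asym_near M j.
apply: (@near0_bound _ (fun w => cRe (F j w) - \sum_(k < M) cRe (P k j w)) B).
  move=> w; apply: cvgB; first exact: (is_derive_continuous (jet_ReF j)).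
  by apply: continuous_sum => k; exact: (Ccont_P k j).1.
near=> s; apply: le_trans (_ : normc (F j (ln s) - \sum_(k < M) P k j (ln s)) <= _).
  by apply: le_trans (norm_Re_le _); rewrite cReD cReN cRe_sum.
by near: s.
Unshelve. all: end_near. Qed.

Lemma ImF_asym M j : exists B : R, forall w, w <= 0 ->
  `|cIm (F j w) - \sum_(k < M) cIm (P k j w)| <= B * expR ((cRe mu + M%:R - j%:R) * w).
Proof.
have [B hB] := F_asym_near M j.
apply: (@near0_bound _ (fun w => cIm (F j w) - \sum_(k < M) cIm (P k j w)) B).
  move=> w; apply: cvgB; first exact: (is_derive_continuous (jet_ImF j)).
  by apply: continuous_sum => k; exact: (Ccont_P k j).2.
near=> s; apply: le_trans (_ : normc (F j (ln s) - \sum_(k < M) P k j (ln s)) <= _).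
  by apply: le_trans (norm_Im_le _); rewrite cImD cImN cIm_sum.
by near: s.
Unshelve. all: end_near. Qed.

(** * The expansion of the transform to a fixed order *)

Section order.
Context (N : nat).
Local Notation L := N.+2.

(* With a = aexp k = mu + k - dim/2, the L-th derivative of c_k r^a with respect to
   r^2 is dcoef k * r^(-2 zexp k), and the transform of that term is a multiple of
   |xi|^(-2 zexp' k). *)
Definition aexp (k : nat) : C := mu + k%:R + p%:C.
Definition dcoef (k : nat) : C := c k * ffact_complex (aexp k / 2) L.
Definition zexp (k : nat) : C := L%:R - aexp k / 2.
Definition zexp' (k : nat) : C := (aexp k + n.+1%:R) / 2.

Definition Gfun w : C := rop_complex F L p 0 w.
(** The pure powers are subtracted on the whole line. For w >= 0, where [Gfun] vanishes, what is
    left is minus their sum, so this remainder must be controlled at both ends. *)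
Definition Efun (M : nat) w : C := Gfun w - \sum_(k < M) dcoef k * cexp (- (2 * zexp k) *
  w%:C).

Lemma rop_complex_P k w : rop_complex (P k) L p 0 w =
  dcoef k * cexp (- (2 * zexp k) * w%:C).
Proof.
rewrite rop_complex_pow /ffact_complex big_ord0 mul1r !subr0 -/(aexp k) mulrA
  -/(ffact_complex _ _) -/(dcoef k).
have two : (2 : C) != 0 by rewrite pnatr_eq0.
rewrite /zexp (_ : aexp k - 2 * L%:R = - (2 * (L%:R - aexp k / 2)))//.
by move: (aexp k) (L%:R : C) => a b; field.
Qed.

Lemma Efun_bound M : exists B : R, forall w, w <= 0 ->
  normc (Efun M w) <= B * expR ((cRe mu + p + M%:R - 2 * L%:R) * w).
Proof.
have [B1 h1] := rop_bound L p 0 (ReF_asym M).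
have [B2 h2] := rop_bound L p 0 (ImF_asym M).
exists (B1 + B2) => w w0; apply: le_trans (normc_le _) _.
have e : (p + (cRe mu + M%:R) - 0%:R - 2 * L%:R) * w =
  (cRe mu + p + M%:R - 2 * L%:R) * w by ring.
have EE : Efun M w = rop_complex F L p 0 w - \sum_(k < M) rop_complex (P k) L p 0 w.
  by rewrite /Efun /Gfun; congr (_ - _); apply: eq_bigr => k _; rewrite rop_complex_P.
rewrite mulrDl EE !cReD !cImD !cReN !cImN cRe_sum cIm_sum; apply: lerD.
  by have := h1 w w0; rewrite rop_sum e.
by have := h2 w w0; rewrite rop_sum e.
Qed.

Lemma Gfun0 w : 0 <= w -> Gfun w = 0.
Proof.
move=> w0; rewrite /Gfun /rop_complex rop0; last by move=> j; exact: ReF0.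
by rewrite rop0// => j; exact: ImF0.
Qed.

Lemma cRe_nat m : cRe (m%:R : C) = m%:R /\ cIm (m%:R : C) = 0.
Proof.
elim: m => [|m [a b]]; first by [].
by rewrite -addn1 !natrD cReD cImD a b /= addr0.
Qed.

Lemma cRe_half (z : C) : cRe (z / 2) = cRe z / 2.
Proof.
have -> : z / 2 = z * (2^-1)%:C by rewrite fmorphV /= rmorph_nat.
by rewrite cReZ.
Qed.

(** The k-th term of the transform decays like |xi|^-(A0 + k); positivity of [A0] is local
    integrability of f at the origin. *)
Let A0 : R := cRe mu + n.+1%:R / 2.

Lemma Re_aexp k : cRe (aexp k) = A0 + k%:R - n.+1%:R.
Proof. by rewrite /aexp !cReD (cRe_nat k).1 /A0 /p /=; lra. Qed.

Lemma Re_zexp k : cRe (zexp k) = L%:R - (A0 + k%:R - n.+1%:R) / 2.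
Proof. by rewrite /zexp cReD cReN cRe_half Re_aexp (cRe_nat L).1. Qed.

Lemma Re_zexp' k : cRe (zexp' k) = (A0 + k%:R) / 2.
Proof. by rewrite /zexp' cRe_half cReD Re_aexp (cRe_nat n.+1).1; lra. Qed.

Lemma Re_zexp'_gt0 k : 0 < cRe (zexp' k).
Proof. by rewrite Re_zexp' divr_gt0// ltr_pwDl. Qed.

Lemma normc_pure k w : normc (cexp (- (2 * zexp k) * w%:C)) =
  expR ((A0 + k%:R - n.+1%:R - 2 * L%:R) * w).
Proof.
rewrite normc_cexp cReZ mulr_natl mulr2n cReN cReD Re_zexp; congr expR; lra.
Qed.

Lemma kern_cos_density_le xi th w : `|kern_cos_density n N xi th w| <= 2 ^+ n.+2 *
  expR ((n.+1%:R + 2 * L%:R) * w).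
Proof.
rewrite /kern_cos_density normrM ger0_norm; last by rewrite mulr_ge0// exprn_ge0// expR_ge0.
have h := kern_cos_le n.+1 N xi th (expR_ge0 w).
apply: le_trans (ler_wpM2l _ h) _; first by rewrite mulr_ge0// exprn_ge0// expR_ge0.
have -> : 2 * expR w ^+ 2 * (2 ^+ n.+1 * expR w ^+ (n.+1 + 2 * N.+1)) =
  2 ^+ n.+2 * expR w ^+ (2 + (n.+1 + 2 * N.+1)).
  by rewrite (exprS 2 n.+1) [expR w ^+ (2 + _)]exprD; ring.
apply: ler_wpM2l; first exact: exprn_ge0.
rewrite -expRM_natl ler_expR !natrD natrM -(addn1 N.+1) natrD; lra.
Qed.

Lemma kern_cos_density_decay m j : (m <= N.+1)%N -> (j < n.+1)%N -> exists B : R, 0 <= B /\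
  forall xi th w, `|kern_cos_density n N xi th w| * `|xi j| ^+ m <= B * expR ((n.+1%:R +
    2 * L%:R - m%:R) * w).
Proof.
move=> mN jn; have [B [B0 hB]] := @kern_cos_decay R n.+1 N m j mN jn.
exists (2 * B); split; first by rewrite mulr_ge0.
move=> xi th w; rewrite /kern_cos_density normrM ger0_norm;
  last by rewrite mulr_ge0// exprn_ge0// expR_ge0.
have h := hB (expR w) xi th (expR_ge0 w).
rewrite -[leLHS]mulrA; apply: le_trans (ler_wpM2l _ h) _;
  first by rewrite mulr_ge0// exprn_ge0// expR_ge0.
rewrite mulrACA; apply: ler_wpM2l; first by rewrite mulr_ge0.
rewrite -exprD -expRM_natl ler_expR.
rewrite (_ : (2 + (n.+1 + 2 * N.+1 - m))%:R = n.+1%:R + 2 * L%:R - m%:R :> R)//.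
rewrite -natrM -natrD -natrB; last by lia.
by congr (_%:R); lia.
Qed.

Lemma exp_abs_le (a b w : R) : (w < 0 -> b <= a) -> (0 < w -> a <= - b) ->
  expR (a * w) <= expR (- (b * `|w|)).
Proof.
move=> h1 h2; rewrite ler_expR; have [w0|w0|->] := ltgtP w 0.
- by rewrite ltr0_norm// mulrN opprK ler_wnM2r ?h1 ?ltW.
- by rewrite gtr0_norm// -mulNr ler_wpM2r ?h2// ltW.
- by rewrite normr0 !mulr0 oppr0.
Qed.

(** The rates for a pure term are A0 + k at -oo and N + 1 - (A0 + k) >= 1 at +oo. *)
Definition decay_rate : R := Num.min A0 1.

Lemma decay_rate_gt0 : 0 < decay_rate. Proof. by rewrite lt_min mu0 ltr01. Qed.

(* The decay in xi is needed as w -> +oo only; as w -> -oo the trivial bound on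
   the transform of the kernel suffices. *)
Lemma pure_bound k j : (j < n.+1)%N -> A0 + k%:R <= N%:R -> exists B : R,
  forall xi th, 1 <= `|xi j| -> forall w,
  expR (- (2 * cRe (zexp k) * w)) * `|kern_cos_density n N xi th w| <= B *
    expR (- (decay_rate * `|w|)).
Proof.
move=> jn kN; have [B [B0 hB]] := kern_cos_density_decay (leqnn N.+1) jn.
exists (2 ^+ n.+2 + B) => xi th xi1 w; have [w0|w0] := leP w 0.
  apply: le_trans (ler_wpM2l (expR_ge0 _) (kern_cos_density_le xi th w)) _.
  rewrite mulrCA -expRD; apply: ler_pM => //; rewrite ?exprn_ge0 ?expR_ge0//.
    by rewrite lerDl.
  rewrite (_ : _ + _ = (A0 + k%:R) * w); last by rewrite Re_zexp; lra.
  apply: exp_abs_le => [_|w1]; last by lra.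
  by rewrite /decay_rate ge_min lerDl ler0n.
have h1 : `|kern_cos_density n N xi th w| <= B * expR ((n.+1%:R + 2 * L%:R - N.+1%:R) * w).
  apply: le_trans (hB xi th w); apply: ler_peMr => //; exact: exprn_ege1.
apply: le_trans (ler_wpM2l (expR_ge0 _) h1) _.
rewrite mulrCA -expRD; apply: ler_pM => //; rewrite ?expR_ge0//.
  by rewrite lerDr exprn_ge0.
rewrite (_ : _ + _ = (A0 + k%:R - N.+1%:R) * w); last by rewrite Re_zexp; lra.
apply: exp_abs_le => [w1|_]; first by lra.
have : decay_rate <= 1 by rewrite /decay_rate ge_min lexx orbT.
rewrite -(addn1 N) natrD; lra.
Qed.

(* The hypotheses on M make the remainder integrable against the kernel transform
   at -oo, and every term removed from it integrable at +oo. *)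
Lemma err_bound M j : (j < n.+1)%N -> N%:R < A0 + M%:R ->
  (forall k : nat, (k < M)%N -> A0 + k%:R <= N%:R) ->
  exists B e : R, 0 < e /\ forall xi th, 1 <= `|xi j| -> forall w,
  normc (Efun M w) * (`|kern_cos_density n N xi th w| * `|xi j| ^+ N) <= B * expR (- (e *
    `|w|)).
Proof.
move=> jn NM kN.
have [B1 h1] := Efun_bound M.
have [B2 [B20 h2]] := kern_cos_density_decay (leqnSn N) jn.
have [B3 [B30 h3]] := kern_cos_density_decay (leqnn N.+1) jn.
pose S := \sum_(k < M) normc (dcoef k).
have S0 : 0 <= S by apply: sumr_ge0 => k _; exact: normc_ge0.
have B10 : 0 <= B1.
  by have := h1 0 (lexx _); rewrite mulr0 expR0 mulr1; apply: le_trans; exact: normc_ge0.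
exists (B1 * B2 + S * B3), (Num.min (A0 + M%:R - N%:R) 1); split.
  by rewrite lt_min ltr01 andbT subr_gt0.
move=> xi th xi1 w; have [w0|w0] := leP w 0.
  apply: le_trans (ler_pM (normc_ge0 _) _ (h1 w w0) (h2 xi th w)) _.
    by rewrite mulr_ge0// exprn_ge0.
  rewrite mulrACA -expRD; apply: ler_pM; rewrite ?mulr_ge0 ?expR_ge0//.
    by rewrite lerDl mulr_ge0.
  rewrite (_ : _ + _ = (A0 + M%:R - N%:R) * w); last by rewrite /A0 /p; lra.
  apply: exp_abs_le => [_|w1]; last by lra.
  by rewrite ge_min lexx.
have E1 : normc (Efun M w) <= S * expR ((N%:R - n.+1%:R - 2 * L%:R) * w).
  rewrite /Efun (Gfun0 (ltW w0)) sub0r normcN.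
  apply: le_trans (le_normc_sum _ _ _) _; rewrite /S mulr_suml; apply: ler_sum => k _.
  rewrite Normc.normcM normc_pure; apply: ler_wpM2l; first exact: normc_ge0.
  rewrite ler_expR; apply: ler_wpM2r; first exact: ltW.
  by have := kN k (ltn_ord k); lra.
(* One more order of decay than claimed is spent here: it brings the exponent at +oo down to -1, and
   [1 <= |xi j|] absorbs the surplus factor. *)
have R1 : `|kern_cos_density n N xi th w| * `|xi j| ^+ N <= B3 * expR ((n.+1%:R +
  2 * L%:R - N.+1%:R) * w).
  apply: le_trans (h3 xi th w); apply: ler_wpM2l => //.
  by rewrite (exprS _ N) ler_peMl// exprn_ge0.
apply: le_trans (ler_pM (normc_ge0 _) _ E1 R1) _.
  by rewrite mulr_ge0// exprn_ge0.
rewrite mulrACA -expRD; apply: ler_pM; rewrite ?mulr_ge0 ?expR_ge0//.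
  by rewrite lerDr mulr_ge0.
rewrite (_ : _ + _ = (-1) * w); last by rewrite -(addn1 N) natrD; lra.
apply: exp_abs_le => [w1|_]; first by lra.
by rewrite lerN2 ge_min lexx orbT.
Qed.

(** Near the origin, N + 2 derivatives in r^2 cost 2N + 4 powers of r. The kernel and the factor
    d(r^2) return them, and the volume adds as many powers as the dimension, so that A0 powers
    remain. *)
Lemma psi_bound Phi : jet Phi -> (forall j w, 0 <= w -> Phi j w = 0) ->
  (forall j, exists B : R, forall w, w <= 0 -> `|Phi j w| <= B * expR ((cRe mu - j%:R) *
    w)) ->
  exists B : R, forall w, `|cauchy_density Phi p N w| * expR w ^+ (n.+1 +
    2 * N.+1) <= B * expR (- (A0 * `|w|)).
Proof.
move=> fP P0 hP; have [B hB] := rop_bound L p 0 hP.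
have B0 : 0 <= B by have := hB 0 (lexx _); rewrite mulr0 expR0 mulr1; apply: le_trans.
exists (`|cauchy_cst N| * 2 * B) => w; have [w0|w0] := leP w 0; last first.
  rewrite /cauchy_density rop0; last by move=> j; apply: P0; exact: ltW.
  by rewrite !mulr0 normr0 mul0r !mulr_ge0 ?expR_ge0.
have h := hB w w0.
have -> : `|cauchy_density Phi p N w| = `|cauchy_cst N| * (2 * expR w ^+ 2 *
  `|rop Phi L p 0 w|).
  by rewrite /cauchy_density normrM [`|_ * rop _ _ _ _ _|]normrM (@ger0_norm _ (2 *
    _))// mulr_ge0// exprn_ge0// expR_ge0.
rewrite (_ : `|cauchy_cst N| * _ * expR w ^+ (n.+1 + 2 * N.+1) =
  `|cauchy_cst N| * 2 * (`|rop Phi L p 0 w| * expR w ^+ (2 + (n.+1 + 2 * N.+1))));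
  last first.
  by rewrite [expR w ^+ (2 + _)]exprD; ring.
rewrite -[leRHS]mulrA; apply: ler_wpM2l; first by rewrite mulr_ge0.
apply: le_trans (ler_wpM2r _ h) _; first by rewrite exprn_ge0// expR_ge0.
rewrite -expRM_natl -mulrA -expRD; apply: ler_wpM2l => //.
rewrite (_ : _ + _ = A0 * w).
  by apply: exp_abs_le => // w1; lra.
rewrite !natrD natrM -(addn1 N.+1) natrD /A0 /p; lra.
Qed.

Definition row_of (t : n.+1.-tuple mR) : 'rV[R]_n.+1 := \row_i tnth t i.

Definition fT (t : n.+1.-tuple mR) : C := radial_fun phi (row_of t).

Lemma enorm_row_of t : enorm (row_of t) = Num.sqrt (sq t).
Proof. by rewrite /enorm /sq; congr Num.sqrt; apply: eq_bigr => i _; rewrite mxE. Qed.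

Lemma fTE t : 0 < sq t -> fT t = (expR (p * (ln (sq t) / 2)))%:C * F 0 (ln (sq t) / 2).
Proof.
move=> t0; have s0 : 0 < Num.sqrt (sq t) by rewrite sqrtr_gt0.
have e : expR (ln (sq t) / 2) = Num.sqrt (sq t).
  have -> : ln (sq t) / 2 = ln (Num.sqrt (sq t)).
    by rewrite -{1}(sqr_sqrtr (ltW t0)) lnXn// mulr2n; lra.
  by rewrite lnK.
rewrite /fT /radial_fun enorm_row_of /F /Cderive1n /= e.
have -> : Num.sqrt (sq t) `^ (- (n.+1%:R / 2)) = expR (p * (ln (sq t) / 2)).
  by rewrite /powR gt_eqF// -e expRK.
have -> : cRe (phi (Num.sqrt (sq t))) +i* cIm (phi (Num.sqrt (sq t))) =
  phi (Num.sqrt (sq t)).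
  by case: (phi _).
have [h|h] := leP (Num.sqrt (sq t)) 1; last by rewrite phi1 ?ltW// mulr0 mul0r.
by rewrite indicE mem_set ?mulr1//= in_itv /= h ltW.
Qed.

Lemma fT0 t : sq t <= 0 -> fT t = 0.
Proof.
move=> t0; rewrite /fT /radial_fun enorm_row_of.
have -> : Num.sqrt (sq t) = 0 by exact: ler0_sqrtr.
rewrite powR0 ?mul0r// oppr_eq0 mulf_eq0 invr_eq0 !pnatr_eq0//.
Qed.

Lemma fT_meas : Cmeas fT.
Proof.
have mw : measurable_fun setT (fun t : n.+1.-tuple mR => ln (sq t) / 2).
  apply: measurable_funM => //; apply: measurableT_comp; first exact: measurable_ln.
  exact: measurable_sq.
have key (g : R -> R) (h : n.+1.-tuple mR -> R) : continuous g ->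
   (forall t, 0 < sq t -> h t = g (ln (sq t) / 2)) -> (forall t, sq t <= 0 -> h t = 0) ->
   measurable_fun setT h.
  move=> cg h1 h2.
  have -> : h = fun t => g (ln (sq t) / 2) * \1_(`]0, +oo[%classic : set R) (sq t).
    apply/funext => t; rewrite indicE; have [t0|t0] := leP (sq t) 0.
      by rewrite h2// memNset ?mulr0//= in_itv /= andbT; apply/negP; rewrite -leNgt.
    by rewrite h1// mem_set ?mulr1//= in_itv /= t0.
  apply: measurable_funM.
    by apply: measurableT_comp => //; exact: continuous_measurable_fun.
  by apply: measurableT_comp; [exact: measurable_indic|exact: measurable_sq].
split.
  apply: (key (rop (fun j w => cRe (F j w)) 0 p 0)); first exact/continuous_rop/jet_ReF.
    by move=> t t0; rewrite fTE// cReM /= mul0r subr0.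
  by move=> t t0; rewrite fT0.
apply: (key (rop (fun j w => cIm (F j w)) 0 p 0)); first exact/continuous_rop/jet_ImF.
  by move=> t t0; rewrite fTE// cImM /= mul0r addr0.
by move=> t t0; rewrite fT0.
Qed.

Lemma transform_rep xi th :
  Citg leb (fun w => Gfun w * (kern_cos_density n N xi th w)%:C) /\
  Citg (lam n.+1) (fun t => fT t * (cos (dotp xi t + th))%:C) /\
  Cint (lam n.+1) (fun t => fT t * (cos (dotp xi t + th))%:C) =
  (cauchy_cst N)%:C * Cint leb (fun w => Gfun w * (kern_cos_density n N xi th w)%:C).
Proof.
have [mRe mIm] := fT_meas.
(* The expansion cut at M = 0 is the growth bound O(r^(Re mu - j)) for the j-th derivative. *)
have bRe j : exists B : R, forall w, w <= 0 -> `|cRe (F j w)| <= B *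
  expR ((cRe mu - j%:R) * w).
  have [B hB] := ReF_asym 0 j; exists B => w w0; have := hB w w0.
  by rewrite big_ord0 subr0 addr0.
have bIm j : exists B : R, forall w, w <= 0 -> `|cIm (F j w)| <= B *
  expR ((cRe mu - j%:R) * w).
  have [B hB] := ImF_asym 0 j; exists B => w w0; have := hB w w0.
  by rewrite big_ord0 subr0 addr0.
have mpsi Phi : jet Phi -> measurable_fun setT (cauchy_density Phi p N).
  move=> fP; apply: measurable_funM => //; apply: measurable_funM.
    by apply: measurable_funM => //; apply: measurable_funX; exact: measurable_expR.
  by apply: continuous_measurable_fun; exact: continuous_rop.
have cN0 : cauchy_cst N != 0 :> R.
  rewrite /cauchy_cst mulf_neq0// ?signr_eq0// invr_eq0 pnatr_eq0 -lt0n fact_gt0//.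
have esq (t : n.+1.-tuple mR) : 0 < sq t -> expR (ln (sq t) / 2) ^+ 2 = sq t.
  by move=> t0; rewrite expR_sqr mulrC divfK// lnK.
have [B1 h1] := psi_bound jet_ReF ReF0 bRe.
have [B2 h2] := psi_bound jet_ImF ImF0 bIm.
have hE1 t : 0 < sq t -> cRe (fT t) = \int[leb]_w (cauchy_density (fun j w =>
  cRe (F j w)) p N w * kern N.+1 (expR w ^+ 2) (sq t)).
  move=> t0; have := @cauchy_repeated R _ p N (ln (sq t) / 2) jet_ReF ReF0.
  by rewrite esq// => <-; rewrite fTE// cReM /= mul0r subr0.
have hE2 t : 0 < sq t -> cIm (fT t) = \int[leb]_w (cauchy_density (fun j w =>
  cIm (F j w)) p N w * kern N.+1 (expR w ^+ 2) (sq t)).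
  move=> t0; have := @cauchy_repeated R _ p N (ln (sq t) / 2) jet_ImF ImF0.
  by rewrite esq// => <-; rewrite fTE// cImM /= mul0r addr0.
have [i1 [j1 k1]] := Rint_rep xi th mu0 (mpsi _ jet_ReF) h1 mRe hE1.
have [i2 [j2 k2]] := Rint_rep xi th mu0 (mpsi _ jet_ImF) h2 mIm hE2.
have e1 w : cRe (Gfun w * (kern_cos_density n N xi th w)%:C) =
   (cauchy_cst N)^-1 * (cauchy_density (fun j w => cRe (F j w)) p N w *
     kern_cos n.+1 N.+1 (expR w ^+ 2) xi th).
  by rewrite cReZ /Gfun /rop_complex /= -/(rop _ L p 0 w) /cauchy_density
    /kern_cos_density; field.
have e2 w : cIm (Gfun w * (kern_cos_density n N xi th w)%:C) =
   (cauchy_cst N)^-1 * (cauchy_density (fun j w => cIm (F j w)) p N w *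
     kern_cos n.+1 N.+1 (expR w ^+ 2) xi th).
  by rewrite cImZ /Gfun /rop_complex /= -/(rop _ L p 0 w) /cauchy_density
    /kern_cos_density; field.
have m1 : \int[leb]_w cRe (Gfun w * (kern_cos_density n N xi th w)%:C) = (cauchy_cst N)^-1 *
    \int[leb]_w (cauchy_density (fun j w => cRe (F j w)) p N w *
      kern_cos n.+1 N.+1 (expR w ^+ 2) xi th).
  by under eq_Rintegral do rewrite e1; rewrite RintegralZl.
have m2 : \int[leb]_w cIm (Gfun w * (kern_cos_density n N xi th w)%:C) = (cauchy_cst N)^-1 *
    \int[leb]_w (cauchy_density (fun j w => cIm (F j w)) p N w *
      kern_cos n.+1 N.+1 (expR w ^+ 2) xi th).
  by under eq_Rintegral do rewrite e2; rewrite RintegralZl.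
split; first split.
- by under eq_fun do rewrite e1; exact: itgZl.
- by under eq_fun do rewrite e2; exact: itgZl.
split; first split.
- by under eq_fun do rewrite cReZ.
- by under eq_fun do rewrite cImZ.
apply: complex_eq.
  rewrite mulrC cReZ /Cint /=.
  under eq_Rintegral do rewrite cReZ.
  by rewrite k1 m1 mulrAC mulVf ?mul1r.
rewrite mulrC cImZ /Cint /=.
under eq_Rintegral do rewrite cImZ.
by rewrite k2 m2 mulrAC mulVf ?mul1r.
Qed.

(** The coefficient of (|xi|/2)^(-2 zexp' k): Cauchy's constant, the coefficient of the density, and
    the constant of [pure_term] after division by [Gam (zexp k)]. *)
Definition Dcoef (k : nat) : C :=
  (cauchy_cst N)%:C * dcoef k * ((N.+1`!%:R * Num.sqrt pi ^+ n.+1)%:C *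
    (Gam (zexp' k) / Gam (zexp k))).

Lemma Re_zexp_gt0 k : A0 + k%:R <= N%:R -> 0 < cRe (zexp k).
Proof.
move=> h; rewrite Re_zexp -(addn2 N) natrD.
have : 0 <= N%:R :> R by []; have : 0 <= n.+1%:R :> R by [].
lra.
Qed.

Lemma zexpD k : zexp k + zexp' k = N.+2%:R + (n.+1%:R / 2 : R)%:C.
Proof.
rewrite rmorphM fmorphV /= !rmorph_nat /zexp /zexp'.
have two : (2 : C) != 0 by rewrite pnatr_eq0.
by move: (aexp k) (L%:R : C) => a b; field.
Qed.

Lemma cauchy_cst_neq0 : (cauchy_cst N)%:C != 0 :> C.
Proof.
rewrite fmorph_eq0 /cauchy_cst mulf_neq0// ?signr_eq0// invr_eq0 pnatr_eq0 -lt0n fact_gt0//.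
Qed.

(** Every factor besides [dcoef k] is nonzero, the two Gamma values because their arguments have
    positive real part. *)
Lemma Dcoef_eq0 k : A0 + k%:R <= N%:R -> (Dcoef k == 0) = (dcoef k == 0).
Proof.
move=> h; rewrite /Dcoef 4!mulf_eq0 (negbTE cauchy_cst_neq0) /= [X in _ || X](_ : _ =
  false) ?orbF//.
rewrite fmorph_eq0 [Gam (zexp' k) / _ == 0]mulf_eq0 invr_eq0 (negbTE (Gam_neq0
  (Re_zexp_gt0 h))) (negbTE (Gam_neq0 (Re_zexp'_gt0 k))).
rewrite !orbF mulf_eq0 pnatr_eq0 expf_eq0 /= sqrtr_eq0 leNgt pi_gt0 /= orbF.
by apply/negbTE; rewrite -lt0n fact_gt0.
Qed.

Lemma pure_integral k j xi th : (j < n.+1)%N -> A0 + k%:R <= N%:R -> 1 <= `|xi j| ->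
  Citg leb (fun w => cexp (- (2 * zexp k) * w%:C) * (kern_cos_density n N xi th w)%:C) /\
  (cauchy_cst N)%:C * (dcoef k * Cint leb (fun w =>
    cexp (- (2 * zexp k) * w%:C) * (kern_cos_density n N xi th w)%:C)) =
  (cos th)%:C * (Dcoef k * cexp (- zexp' k * (ln (nsq n.+1 xi / 4))%:C)).
Proof.
move=> jn kN xi1; have [B hB] := pure_bound jn kN.
have q0 : 0 < nsq n.+1 xi.
  rewrite /nsq (bigD1 (Ordinal jn))//= ltr_wpDr//.
    by apply: sumr_ge0 => i _; exact: sqr_ge0.
  by rewrite exprn_even_gt0//= -normr_gt0 (lt_le_trans ltr01).
have [i1 e1] := pure_term (Re_zexp_gt0 kN) decay_rate_gt0 (hB xi th xi1) (zexpD k)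
  (Re_zexp'_gt0 k) q0.
split=> //; have G0' := Gam_neq0 (Re_zexp_gt0 kN).
have -> : Cint leb (fun w => cexp (- (2 * zexp k) * w%:C) *
  (kern_cos_density n N xi th w)%:C) =
  (Gam (zexp k))^-1 * (Gam (zexp k) * Cint leb (fun w =>
    cexp (- (2 * zexp k) * w%:C) * (kern_cos_density n N xi th w)%:C)).
  by rewrite mulKf.
rewrite e1 /Dcoef [(_ * cos th)%:C]rmorphM.
ring.
Qed.

(** In the main terms the phase survives only as the factor [cos th]; this is why the sine transform
    will contribute to the error alone. *)
Lemma radial_asymptotics M j : (j < n.+1)%N -> N%:R < A0 + M%:R ->
  (forall k : nat, (k < M)%N -> A0 + k%:R <= N%:R) -> exists B : R, 0 <= B /\
  forall xi th, 1 <= `|xi j| ->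
  normc (Cint (lam n.+1) (fun t => fT t * (cos (dotp xi t + th))%:C) -
    (cos th)%:C * \sum_(k < M) Dcoef k * cexp (- zexp' k * (ln (nsq n.+1 xi / 4))%:C))
  * `|xi j| ^+ N <= B.
Proof.
move=> jn NM kN; have [B [e [e_gt0 hB]]] := err_bound jn NM kN.
have iE : itg leb (fun w : R => B * expR (- (e * `|w|))).
  by apply: itgZl; exact: itg_exp_abs.
pose J := \int[leb]_w (B * expR (- (e * `|w|))).
exists (`|cauchy_cst N| * (2 * `|J|)); split; first by rewrite !mulr_ge0.
move=> xi th xi1; have [iG [_ ->]] := transform_rep xi th.
have pI (k : 'I_M) := pure_integral th jn (kN k (ltn_ord k)) xi1.
pose pt (k : 'I_M) w := dcoef k * (cexp (- (2 * zexp k) * w%:C) *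
  (kern_cos_density n N xi th w)%:C).
have iP (k : 'I_M) : Citg leb (pt k) by apply: CitgZ; have [] := pI k.
have iS : Citg leb (fun w => \sum_(k < M) pt k w) by exact: Citg_sum.
have iR : Citg leb (fun w => Efun M w * (kern_cos_density n N xi th w)%:C).
  have -> : (fun w => Efun M w * (kern_cos_density n N xi th w)%:C) =
      (fun w => Gfun w * (kern_cos_density n N xi th w)%:C + (- 1) * \sum_(k < M) pt k w).
    apply/funext => w; rewrite /Efun mulrBl mulN1r mulr_suml; congr (_ - _).
    by apply: eq_bigr => k _; rewrite /pt mulrA.
  by apply: CitgD => //; exact: CitgZ.
have eG : Cint leb (fun w => Gfun w * (kern_cos_density n N xi th w)%:C) =
    Cint leb (fun w => Efun M w * (kern_cos_density n N xi th w)%:C) +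
      \sum_(k < M) Cint leb (pt k).
  rewrite -Cint_sum// -CintD//; apply: eq_Cint => w.
  rewrite /Efun mulrBl mulr_suml -addrA [X in _ + X](_ : _ = 0) ?addr0//.
  by rewrite addrC; apply/eqP; rewrite subr_eq0; apply/eqP/eq_bigr => k _;
    rewrite /pt mulrA.
rewrite eG mulrDr [X in _ + X - _](_ : _ = (cos th)%:C * \sum_(k < M) Dcoef k *
  cexp (- zexp' k * (ln (nsq n.+1 xi / 4))%:C)).
  rewrite addrK Normc.normcM normc_real -mulrA; apply: ler_wpM2l => //.
  have x0 : 0 < `|xi j| ^+ N by rewrite exprn_gt0// (lt_le_trans ltr01).
  rewrite -ler_pdivlMr//.
  have h w : normc (Efun M w * (kern_cos_density n N xi th w)%:C) <= (`|xi j| ^+ N)^-1 *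
    (B * expR (- (e * `|w|))).
    rewrite [leRHS]mulrC ler_pdivlMr// Normc.normcM normc_real -mulrA; exact: hB.
  apply: le_trans (normc_Cint_le (Citg_meas iR) h _) _; first exact: itgZl.
  rewrite RintegralZl// -/J mulrCA mulrC ler_wpM2r ?invr_ge0 ?(ltW x0)//.
  by rewrite ler_wpM2l// ler_norm.
rewrite !mulr_sumr; apply: eq_bigr => k _.
by rewrite -(pI k).2 /pt CintZ//; have [] := pI k.
Qed.

End order.

End radial_transform.

(** * Invertibility *)

Section continuous_on_tuples.
Context {R : realType} {n : nat}.
Local Notation mR := (measurableTypeR R).

Lemma measurable_box (q : 'rV[R]_n.+1) (r : R) :
  measurable [set t : n.+1.-tuple mR | forall i, ball (q 0 i) r (tnth t i)].
Proof.
rewrite (_ : [set t | _] = \bigcap_(i in [set: 'I_n.+1])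
    ((fun t : n.+1.-tuple mR => tnth t i) @^-1` ball (q 0 i) r)); last first.
  by apply/seteqP; split => t /= h => [i _|i]; exact: h.
apply: fin_bigcap_measurable => // i _; rewrite -[X in measurable X]setTI.
apply: measurable_tnth => //; exact: measurable_ball.
Qed.

(* An open set is a countable union of cubes with rational data. *)
Lemma measurable_row_of_open (U : set 'rV[R]_n.+1) : open U ->
  measurable ((@row_of R n) @^-1` U).
Proof.
move=> oU.
pose q (v : 'rV[rat]_n.+1) : 'rV[R]_n.+1 := map_mx ratr v.
pose B (vk : 'rV[rat]_n.+1 * nat) : set (n.+1.-tuple mR) :=
  [set t | (forall i, ball (q vk.1 0 i) vk.2.+1%:R^-1 (tnth t i)) /\
           forall x : 'rV[R]_n.+1, (forall i, ball (q vk.1 0 i) vk.2.+1%:R^-1 (x 0 i)) ->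
             U x].
rewrite (_ : _ @^-1` U = \bigcup_vk B vk); last first.
  apply/seteqP; split => [t Ut|t [vk _ [h1 h2]]]; last first.
    by apply: h2 => i; rewrite [row_of t 0 i]mxE.
  have /nbhs_ballP[e e0 eU] : nbhs (row_of t) U by exact: open_nbhs_nbhs.
  have [k hk] : exists k : nat, 2 * k.+1%:R^-1 < e.
    exists (Num.truncn (2 / e)); rewrite ltr_pdivrMr// mulrC -ltr_pdivrMr//.
    exact: truncnS_gt.
  have k0 : 0 < k.+1%:R^-1 :> R by rewrite invr_gt0.
  have hq i : exists r : rat, ball (ratr r : R) k.+1%:R^-1 (tnth t i).
    move: (k.+1%:R^-1 : R) k0 (tnth t i : R) => d d0 x.
    have [|r] := @rat_in_itvoo R (x - d) (x + d); first by lra.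
    by rewrite in_itv /= => /andP[r1 r2]; exists r; rewrite /ball /= ltr_norml;
      apply/andP; split; lra.
  pose v : 'rV[rat]_n.+1 := \row_i sval (cid (hq i)).
  have hv i : ball (q v 0 i) k.+1%:R^-1 (tnth t i) by rewrite !mxE;
    exact: (svalP (cid (hq i))).
  exists (v, k) => //; split => // x hx; apply: eU; split => // i j; rewrite !ord1 mxE.
  have := hx j; have := hv j; rewrite /ball /= => h1 h2.
  rewrite (_ : tnth t j - x 0 j = (q v 0 j - x 0 j) - (q v 0 j - tnth t j)); last by ring.
  apply: le_lt_trans (ler_normB _ _) _; apply: lt_trans hk.
  by rewrite mulr_natl mulr2n ltrD.
apply: countable_bigcupT_measurable => [|vk]; first exact: countableP.
have [h|h] := pselect (forall x : 'rV[R]_n.+1, (forall i,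
  ball (q vk.1 0 i) vk.2.+1%:R^-1 (x 0 i)) -> U x).
  rewrite (_ : B vk = [set t | forall i, ball (q vk.1 0 i) vk.2.+1%:R^-1 (tnth t i)]).
    exact: measurable_box.
  by apply/seteqP; split => [t []|t ht].
by rewrite (_ : B vk = set0)//; apply/seteqP; split => // t [].
Qed.

Lemma measurable_continuous_row_of (g : 'rV[R]_n.+1 -> R) : continuous g ->
  measurable_fun setT (fun t : n.+1.-tuple mR => g (row_of t)).
Proof.
move=> /continuousP cg; apply: (measurability _ (RGenOpens.measurableE R)).
move=> _ [_ [a [b ->] <-]]; rewrite setTI.
apply: (@measurable_row_of_open (g @^-1` `]a, b[%classic)); exact/cg/interval_open.
Qed.

End continuous_on_tuples.

Section euclidean_norm.
Context {R : realType} {n : nat}.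
Implicit Types x y : 'rV[R]_n.+1.

Lemma enorm_sqr x : enorm x ^+ 2 = \sum_i x 0 i ^+ 2.
Proof. by rewrite sqr_sqrtr// sumr_ge0// => i _; exact: sqr_ge0. Qed.

Lemma enorm_ge0 x : 0 <= enorm x. Proof. exact: sqrtr_ge0. Qed.

Lemma le_enorm x i : `|x 0 i| <= enorm x.
Proof.
rewrite -[`|_|]ger0_norm// -sqrtr_sqr ler_wsqrtr// real_normK ?num_real//.
rewrite (bigD1 i)//= lerDl sumr_ge0// => j _; exact: sqr_ge0.
Qed.

(** The decay estimates are in one coordinate; applied to the largest one they become estimates in
    the norm. *)
Lemma enorm_le_coord x : exists i, enorm x <= n.+1%:R * `|x 0 i|.
Proof.
case: (arg_maxP (fun i => `|x 0 i|) (erefl : predT (ord0 : 'I_n.+1))) => i _ hi.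
exists i; rewrite -[leRHS]ger0_norm ?mulr_ge0// -sqrtr_sqr ler_wsqrtr// exprMn.
have h j : x 0 j ^+ 2 <= `|x 0 i| ^+ 2.
  by rewrite -(real_normK (num_real (x 0 j))) lerXn2r ?nnegrE//; exact: hi.
apply: le_trans (ler_sum _ (fun j _ => h j)) _.
rewrite sumr_const card_ord -[leLHS]mulr_natl; apply: ler_wpM2r; first exact: exprn_ge0.
rewrite -natrX ler_nat.
by rewrite -mulnn leq_pmulr.
Qed.

(** From (a - b)^2 <= 2a^2 + 2b^2 in each coordinate. *)
Lemma enormB_le x y (r : R) : enorm x <= r -> enorm y <= r -> enorm (x - y) <= 2 * r.
Proof.
move=> xr yr; have r0 : 0 <= r by apply: le_trans xr; exact: enorm_ge0.
rewrite -(ger0_norm (mulr_ge0 (ler0n R 2) r0)) -sqrtr_sqr ler_wsqrtr//.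
have h i : (x - y) 0 i ^+ 2 <= 2 * x 0 i ^+ 2 + 2 * y 0 i ^+ 2.
  rewrite !mxE; have := sqr_ge0 (x 0 i + y 0 i); nra.
apply: le_trans (ler_sum _ (fun i _ => h i)) _.
rewrite big_split /= -!mulr_sumr -!enorm_sqr.
have hx : enorm x ^+ 2 <= r ^+ 2 by rewrite lerXn2r ?nnegrE ?enorm_ge0.
have hy : enorm y ^+ 2 <= r ^+ 2 by rewrite lerXn2r ?nnegrE ?enorm_ge0.
rewrite exprMn; lra.
Qed.

Lemma enorm_delta (a : R) : enorm (a *: delta_mx 0 ord0 : 'rV[R]_n.+1) = `|a|.
Proof.
rewrite -sqrtr_sqr /enorm; congr Num.sqrt.
rewrite (bigD1 ord0)//= big1 ?addr0 ?mxE ?eqxx ?mulr1// => i i0.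
by rewrite !mxE eqxx (negbTE i0) mulr0 expr0n.
Qed.

Lemma enorm0 : enorm (0 : 'rV[R]_n.+1) = 0.
Proof. by rewrite -(scale0r (delta_mx 0 ord0)) enorm_delta normr0. Qed.

End euclidean_norm.

Section coordinates.
Context {R : realType} {n : nat}.

(* [inord] makes the function total; only its values below n.+1 matter. *)
Definition coords (eta : 'rV[R]_n.+1) (i : nat) : R := eta 0 (inord i).

Lemma coords_ord (eta : 'rV[R]_n.+1) (i : 'I_n.+1) : coords eta i = eta 0 i.
Proof. by rewrite /coords inord_val. Qed.

Lemma nsq_coords (eta : 'rV[R]_n.+1) : nsq n.+1 (coords eta) = enorm eta ^+ 2.
Proof. by rewrite enorm_sqr; apply: eq_bigr => i _; rewrite coords_ord. Qed.

End coordinates.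

(** * The distribution defined by f and its Fourier transform *)

Section fourier_transform.
Context {R : realType}.
Local Notation C := R[i].
Local Notation leb := (@lebesgue_measure R).
Local Notation mR := (measurableTypeR R).
Local Notation lam n := (@lebesgue_tuple R n).
Context (n : nat) (phi : R -> C) (mu : C) (c : nat -> C).
Context (sphi : smooth_on_pos phi).
Context (phi1 : forall s : R, 1 <= s -> phi s = 0).
Context (mu0 : 0 < cRe mu + n.+1%:R / 2).
Context (asym : forall j : nat, asymptotic_expansion j phi mu c).
Local Notation u := (distribution_of_fun (@radial_fun R n.+1 phi)).
Local Notation f := (@fT R n phi).

Let transform := transform_rep sphi phi1 mu0 asym.

Definition fT_majorant (t : n.+1.-tuple mR) : R := `|cRe (f t)| + `|cIm (f t)|.

(** Integrability of f is contained in [transform_rep]: at frequency 0 and phase 0 the cosine is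
    1. *)
Lemma itg_fT_majorant : itg (lam n.+1) fT_majorant.
Proof.
have [_ [[a b] _]] := transform 0%N (fun=> 0) 0.
have e t : cos (dotp (fun=> 0 : R) t + 0) = 1 :> R.
  by rewrite /dotp big1 ?addr0 ?cos0// => i _; rewrite mul0r.
have a' : itg (lam n.+1) (fun t => cRe (f t)).
  by move: a; under eq_fun do rewrite cReZ e mulr1.
have b' : itg (lam n.+1) (fun t => cIm (f t)).
  by move: b; under eq_fun do rewrite cImZ e mulr1.
apply: itgD.
  exact: (integrable_norm a').
exact: (integrable_norm b').
Qed.

Lemma fT_out t : 1 < enorm (row_of t) -> f t = 0.
Proof.
move=> h; rewrite /fT /radial_fun indicE memNset ?mulr0//= in_itv /=.
by apply/negP; rewrite negb_and -!ltNge h orbT.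
Qed.

Definition sup_cube : set 'rV[R]_n.+1 :=
  [set v : 'rV[R]_n.+1 | forall i, `[-1, 1]%classic (v ord0 i)].

Lemma compact_sup_cube : compact sup_cube.
Proof. apply: (@rV_compact R n.+1 (fun=> `[(- 1 : R), 1]%classic)) => i;
  exact: segment_compact. Qed.

Lemma sup_cubeP (x : 'rV[R]_n.+1) : enorm x <= 1 -> sup_cube x.
Proof.
by move=> x1 i; rewrite /= in_itv /= -ler_norml; apply: le_trans x1; exact: le_enorm.
Qed.

Lemma smooth_meas (g : 'rV[R]_n.+1 -> C) : smooth g -> Cmeas (fun t => g (row_of t)).
Proof.
move=> [h1 h2]; split.
  by apply: (measurable_continuous_row_of (g := fun x => cRe (g x))); have [] := h1 [::].
by apply: (measurable_continuous_row_of (g := fun x => cIm (g x))); have [] := h2 [::].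
Qed.

Lemma normc_fg (g : 'rV[R]_n.+1 -> C) (B : R) : 0 <= B ->
  (forall x, sup_cube x -> normc (g x) <= B) ->
  forall t, normc (f t * g (row_of t)) <= B * fT_majorant t.
Proof.
move=> B0 hB t; rewrite Normc.normcM mulrC.
have [h|h] := leP (enorm (row_of t)) 1.
  by apply: ler_pM; rewrite ?normc_ge0 ?normc_le// hB//; exact: sup_cubeP.
by rewrite fT_out// Normc.normc0 mulr0 mulr_ge0// addr_ge0.
Qed.

Lemma smooth_bounded (g : 'rV[R]_n.+1 -> C) : smooth g ->
  exists2 B : R, 0 <= B & forall x, sup_cube x -> normc (g x) <= B.
Proof.
have key (h : 'rV[R]_n.+1 -> R) : continuous h -> exists B : R, forall x,
  sup_cube x -> `|h x| <= B.
  move=> ch.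
  have /compact_bounded [M [_ hM]] : compact (h @` sup_cube).
    apply: continuous_compact => //; last exact: compact_sup_cube.
    exact: continuous_subspaceT.
  exists (M + 1) => x Kx; apply: hM; last by exists x.
  by rewrite ltrDl.
move=> [h1 h2].
have [B1 hB1] := key _ (h1 [::]).1; have [B2 hB2] := key _ (h2 [::]).1.
exists (`|B1| + `|B2|) => // x Kx; apply: le_trans (normc_le _) _; apply: lerD.
  exact: le_trans (hB1 x Kx) (ler_norm _).
exact: le_trans (hB2 x Kx) (ler_norm _).
Qed.

Lemma Citg_fg (g : 'rV[R]_n.+1 -> C) : smooth g ->
  Citg (lam n.+1) (fun t => f t * g (row_of t)).
Proof.
move=> sg; have [B B0 hB] := smooth_bounded sg.
apply: (Citg_le (mu := lam n.+1)) (normc_fg B0 hB) _; last by apply: itgZl;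
  exact: itg_fT_majorant.
by apply: CmeasM; [exact: (fT_meas n sphi phi1)|exact: smooth_meas].
Qed.

(** An integrable function supported in the unit ball defines a distribution of order 0; the compact
    set is the cube around that ball. *)
Lemma radial_compact_distribution : compact_distribution u.
Proof.
split=> [a g h sg sh|].
  have -> : u (fun x => a * g x + h x) =
      Cint (lam n.+1) (fun t => a * (f t * g (row_of t)) + f t * h (row_of t)).
    by apply: eq_Cint => t; rewrite mulrDr mulrCA.
  by rewrite CintD ?CintZ//; [exact: Citg_fg|apply: CitgZ; exact: Citg_fg|exact: Citg_fg].
exists sup_cube, 0%N, (2 * \int[lam n.+1]_t fT_majorant t); split;
  first exact: compact_sup_cube.
move=> g B sg B0 hB.
have hB' x : sup_cube x -> normc (g x) <= B.
  move=> Kx; have := hB [::] x isT Kx; rewrite /Cpartial /=.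
  by case: (g x).
apply: le_trans (normc_Cint_le (mu := lam n.+1) (f := fun t =>
  f t * g (row_of t)) _ (normc_fg B0 hB') _) _.
- by apply: CmeasM; [exact: (fT_meas n sphi phi1)|exact: smooth_meas].
- by apply: itgZl; exact: itg_fT_majorant.
rewrite RintegralZl//; last exact: itg_fT_majorant.
by rewrite mulrA mulrAC.
Qed.

Definition fhat (eta : 'rV[R]_n.+1) : C := fourier u (map_mx (real_complex R) eta).

(* The sine transform is the cosine transform with phase -pi/2, whose main terms
   have the factor cos(-pi/2) = 0. *)
Lemma fhatE eta : fhat eta =
  Cint (lam n.+1) (fun t => f t * (cos (dotp (coords eta) t + 0))%:C) -
  'i * Cint (lam n.+1) (fun t => f t * (cos (dotp (coords eta) t + - (pi / 2)))%:C).
Proof.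
have [_ [i1 _]] := transform 0%N (coords eta) 0.
have [_ [i2 _]] := transform 0%N (coords eta) (- (pi / 2)).
rewrite -mulNr -CintZ// -CintD//; last exact: CitgZ.
transitivity (Cint (lam n.+1) (fun t => f t * ((cos (dotp (coords eta) t + 0))%:C -
    'i * (cos (dotp (coords eta) t + - (pi / 2)))%:C))); last first.
  by apply: eq_Cint => t; rewrite mulrBr mulNr mulrCA.
apply: eq_Cint => t; rewrite -/(fT phi t); congr (_ * _).
rewrite addr0 cosB cos_pihalf sin_pihalf mulr0 mulr1 add0r.
have -> : \sum_(i < n.+1) map_mx (real_complex R) eta 0 i * ((row_of t) 0 i)%:C =
    (dotp (coords eta) t)%:C :> C.
  rewrite /dotp rmorph_sum; apply: eq_bigr => i _.
  by rewrite /row_of !mxE rmorphM coords_ord.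
have E := (oppr0, mul0r, mulr0, mulN1r, subr0, add0r, addr0, expR0, mul1r, cosN, sinN).
move: (dotp _ t) => d; apply: complex_eq.
  by rewrite Re_cexp /= !E.
by rewrite Im_cexp /= !E.
Qed.

End fourier_transform.

(** * Bounds for the transform and the two implications *)

Section invertibility.
Context {R : realType}.
Local Notation C := R[i].
Context (n : nat) (phi : R -> C) (mu : C) (c : nat -> C).
Context (sphi : smooth_on_pos phi).
Context (phi1 : forall s : R, 1 <= s -> phi s = 0).
Context (mu0 : 0 < cRe mu + n.+1%:R / 2).
Context (asym : forall j : nat, asymptotic_expansion j phi mu c).
Local Notation u := (distribution_of_fun (@radial_fun R n.+1 phi)).
Local Notation fhat := (@fhat R n phi).
Let A0 : R := cRe mu + n.+1%:R / 2.

(** The number tested in [Kset] is half the exponent of |x| in the k-th term of f. *)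
Lemma aexp_half k : aexp n mu k / 2 = 2^-1 * (mu + k%:R - (n.+1%:R / 2 - 1) - 1).
Proof.
rewrite /aexp rmorphN rmorphM fmorphV /= !rmorph_nat.
have two : (2 : C) != 0 by rewrite pnatr_eq0.
by field.
Qed.

(* The falling factorial of length N + 2 vanishes exactly when aexp k / 2 is a
   natural number below N + 2, and aexp k <= N rules out larger ones. *)
Lemma dcoef_eq0 N k : A0 + k%:R <= N%:R ->
  dcoef n mu c N k = 0 <-> ~ Kset n.+1 mu c k.
Proof.
move=> kN; rewrite /Kset /= -aexp_half /dcoef; split.
  move/eqP; rewrite mulf_eq0 => /orP[/eqP c0 [/eqP]//|].
  rewrite /ffact_complex => /prodf_eq0[i _]; rewrite subr_eq0 => /eqP ai [_]; apply.
  by exists i.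
move=> h; apply/eqP; rewrite mulf_eq0; have [//|ck] := eqVneq (c k) 0.
have [m am] : exists m : nat, aexp n mu k / 2 = m%:R.
  by apply: contrapT => nm; apply: h.
have mN : (m < N.+2)%N.
  have := congr1 (fun z : C => cRe z) am; rewrite cRe_half Re_aexp (cRe_nat _).1 -/A0.
  move=> e; rewrite -(ltr_nat R) -(addn2 N) natrD.
  have : 0 <= N%:R :> R by []. have : 0 <= n.+1%:R :> R by []. have : 0 <= m%:R :> R by [].
  by move: kN e; move: A0 => a; lra.
by rewrite /=; apply/prodf_eq0; exists (Ordinal mN) => //=; rewrite am subrr.
Qed.

Lemma expansion_order N : exists M : nat, N%:R < A0 + M%:R /\
  forall k : nat, (k < M)%N -> A0 + k%:R <= N%:R.
Proof.
have ex : exists m : nat, N%:R < A0 + m%:R by exists N; rewrite ltrDr.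
exists (ex_minn ex); case: ex_minnP => M hM minM; split => // k kM.
by rewrite leNgt; apply: contraL kM => /minM; rewrite -leqNgt.
Qed.

(* |eta|^(-2 zexp' k) up to a nonzero constant. *)
Definition main_term N M (eta : 'rV[R]_n.+1) : C := \sum_(k < M) Dcoef n mu c N k *
  cexp (- zexp' n mu k * (ln (enorm eta ^+ 2 / 4))%:C).

Lemma fhat_asymptotics N M : N%:R < A0 + M%:R ->
  (forall k : nat, (k < M)%N -> A0 + k%:R <= N%:R) -> exists2 B : R, 0 <= B &
  forall (eta : 'rV[R]_n.+1) (j : 'I_n.+1), 1 <= `|eta 0 j| ->
  normc (fhat eta - main_term N M eta) * `|eta 0 j| ^+ N <= B.
Proof.
move=> NM kN.
have ex (j : 'I_n.+1) : exists B : R, 0 <= B /\ forall eta : 'rV[R]_n.+1, 1 <= `|eta 0 j| ->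
    normc (fhat eta - main_term N M eta) * `|eta 0 j| ^+ N <= B.
  have [B [B0 hB]] := radial_asymptotics sphi phi1 mu0 asym (ltn_ord j) NM kN.
  exists (2 * B); split => [|eta eta1]; first by rewrite mulr_ge0.
  have h th := hB (coords eta) th.
  rewrite coords_ord nsq_coords -/(main_term N M eta) in h.
  have h1 := h 0 eta1; have h2 := h (- (pi / 2)) eta1.
  rewrite cos0 mul1r in h1; rewrite cosN cos_pihalf mul0r subr0 in h2.
  rewrite (fhatE sphi phi1 mu0 asym) addrAC.
  apply: le_trans (ler_wpM2r _ (le_normcD _ _)) _; first by rewrite exprn_ge0.
  rewrite mulrDl [leRHS]mulr_natl mulr2n; apply: lerD => //.
  rewrite normcN Normc.normcM (_ : normc 'i = 1) ?mul1r//.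
  by rewrite /Normc.normc /= expr0n expr1n add0r sqrtr1.
(* Summing over j gives one constant, valid for whichever coordinate turns out to be large. *)
have [B hB] := choice ex; exists (\sum_j B j); first by apply: sumr_ge0 => j _;
  have [] := hB j.
move=> eta j eta1; apply: le_trans ((hB j).2 eta eta1) _.
by rewrite (bigD1 j)//= lerDl sumr_ge0// => i _; have [] := hB i.
Qed.

Lemma normc_cexp_zexp' k (eta : 'rV[R]_n.+1) : 0 < enorm eta ->
  normc (cexp (- zexp' n mu k * (ln (enorm eta ^+ 2 / 4))%:C)) =
  expR (- (A0 + k%:R) * ln (enorm eta / 2)).
Proof.
move=> r0; rewrite normc_cexp cReZ cReN Re_zexp' -/A0.
rewrite (_ : enorm eta ^+ 2 / 4 = (enorm eta / 2) ^+ 2); last by field.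
by rewrite lnXn ?divr_gt0// -mulr_natl; congr expR; field.
Qed.

Lemma fhat_lower k0 : Kset n.+1 mu c k0 -> (forall k, (k < k0)%N -> ~ Kset n.+1 mu c k) ->
  exists q d r0 : R, [/\ 0 < q, 0 < d, 0 < r0 & forall eta : 'rV[R]_n.+1, r0 <= enorm eta ->
    d * expR (- q * ln (enorm eta)) <= normc (fhat eta)].
Proof.
(* Here q is the decay exponent of the leading term, and N > q + 1 puts the remainder more than one
   power below it. *)
move=> Kk0 minK; pose q := A0 + k0%:R; pose N := (Num.truncn (q + 1)).+1.
have qN : q + 1 < N%:R by exact: truncnS_gt.
have q0 : 0 < q by rewrite ltr_pwDl.
have [M [NM kN]] := expansion_order N.
have [B B0 hB] := fhat_asymptotics NM kN.
have k0M : (k0 < M)%N.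
  rewrite ltnNge; apply/negP => Mk0.
  have : M%:R <= k0%:R :> R by rewrite ler_nat.
  by move: NM qN; rewrite /q; lra.
pose D k := normc (Dcoef n mu c N k).
have D0 k : 0 <= D k by exact: normc_ge0.
have Dk0 : 0 < D k0.
  apply: normc_gt0; rewrite (Dcoef_eq0 _ mu0 (kN _ k0M)); apply/eqP.
  by move/(dcoef_eq0 (kN _ k0M)).
have Dlt k : (k < k0)%N -> D k = 0.
  move=> kk0; have kM : A0 + k%:R <= N%:R by apply: kN; exact: ltn_trans k0M.
  rewrite /D (eqP (_ : Dcoef n mu c N k == 0)) ?Normc.normc0//.
  by rewrite (Dcoef_eq0 _ mu0 kM); apply/eqP/(dcoef_eq0 kM)/minK.
pose S := \sum_(k < M) D k.
have S0 : 0 <= S by exact: sumr_ge0.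
pose B' := B * n.+1%:R ^+ N.
have B'0 : 0 <= B' by rewrite mulr_ge0// exprn_ge0.
(* A threshold for |eta|/2. Relative to the leading power, the later terms and the remainder amount
   to at most (S + B') / (|eta|/2), which beyond x is at most half of [D k0]. *)
pose x := 1 + 2 * (S + B') / D k0.
have x1 : 1 <= x by rewrite lerDl divr_ge0// mulr_ge0// addr_ge0.
exists q, (D k0 / 2), (n.+1%:R + 2 * x); split=> //.
- by rewrite divr_gt0.
- by rewrite ltr_pwDl// mulr_ge0//; lra.
move=> eta hr; set r := enorm eta in hr *; pose l := ln (r / 2).
have n1 : 1 <= n.+1%:R :> R by rewrite ler1n.
have r2 : x <= r / 2 by lra.
have rp : 0 < r by lra.
have el : expR l = r / 2 by rewrite lnK// posrE divr_gt0.
have l0 : 0 <= l by apply: ln_ge0; lra.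
have [j hj] := enorm_le_coord eta; rewrite -/r in hj.
have etaj : 1 <= `|eta 0 j|.
  rewrite -(ler_pM2l (_ : 0 < n.+1%:R :> R))//; lra.
have mono (a : R) : q + 1 <= a -> expR (- a * l) <= expR (- (q + 1) * l).
  by move=> h; rewrite ler_expR; nra.
have herr : normc (fhat eta - main_term N M eta) <= B' * expR (- (q + 1) * l).
  have h1 : normc (fhat eta - main_term N M eta) * r ^+ N <= B'.
    rewrite /B' -ler_pdivrMr ?exprn_gt0//; apply: le_trans (hB eta j etaj).
    rewrite -mulrA; apply: ler_wpM2l; first exact: normc_ge0.
    by rewrite -exprVn -exprMn lerXn2r ?nnegrE ?mulr_ge0 ?invr_ge0 ?(ltW rp)//
      ler_pdivrMr// mulrC.
  rewrite mulNr expRN ler_pdivlMr ?expR_gt0//.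
  apply: le_trans (ler_wpM2l (normc_ge0 _) _) h1.
  apply: le_trans (_ : (r / 2) ^+ N <= _); last by rewrite lerXn2r ?nnegrE//; lra.
  by rewrite -el -expRM_natl ler_expR; nra.
have hmain : main_term N M eta = Dcoef n mu c N k0 * cexp (- zexp' n mu k0 *
  (ln (r ^+ 2 / 4))%:C) +
    \sum_(k < M | k != Ordinal k0M) Dcoef n mu c N k * cexp (- zexp' n mu k *
      (ln (r ^+ 2 / 4))%:C).
  by rewrite /main_term (bigD1 (Ordinal k0M)).
set rest := (X in _ + X) in hmain.
have hrest : normc rest <= S * expR (- (q + 1) * l).
  apply: le_trans (le_normc_sum _ _ _) _.
  rewrite /S mulr_suml big_mkcond; apply: ler_sum => k _; case: ifPn => [kk0|_]; last first.
    by rewrite mulr_ge0 ?expR_ge0.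
  rewrite Normc.normcM normc_cexp_zexp'// -/(D k) -/r -/l.
  have [/Dlt ->|kk|kk] := ltngtP k k0; first by rewrite !mul0r.
    apply: ler_wpM2l => //; apply: mono => //.
    by rewrite /q -addrA lerD2l natr1 ler_nat.
  by case/eqP: kk0; exact: val_inj.
have key : D k0 * expR (- q * l) <= normc (fhat eta) + (S + B') * expR (- (q + 1) * l).
  have -> : D k0 * expR (- q * l) = normc (fhat eta - (fhat eta - main_term N M eta) -
    rest).
    rewrite opprB addrCA subrr addr0 hmain addrK Normc.normcM normc_cexp_zexp'//.
  apply: le_trans (le_normcD _ _) _; rewrite normcN mulrDl [S * _ + _]addrC addrA.
  apply: lerD => //; apply: le_trans (le_normcD _ _) _; rewrite normcN.
  by rewrite lerD2l.
have e1 : expR (- (q + 1) * l) = expR (- q * l) / (r / 2).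
  by rewrite -el -expRN -expRD; congr expR; ring.
have e2 : (S + B') / (r / 2) <= D k0 / 2.
  rewrite ler_pdivrMr ?divr_gt0//; apply: le_trans (_ : D k0 / 2 * x <= _).
    rewrite /x mulrDr mulr1 (_ : D k0 / 2 * (2 * (S + B') / D k0) = S + B');
      first by rewrite lerDr; lra.
    by field; rewrite gt_eqF.
  by apply: ler_wpM2l => //; lra.
apply: le_trans (_ : D k0 / 2 * expR (- q * l) <= _).
  apply: ler_wpM2l; first lra.
  rewrite ler_expR !mulNr lerN2 ler_pM2l// /l ler_ln ?posrE ?divr_gt0//; lra.
have e3 : (S + B') * expR (- (q + 1) * l) <= D k0 / 2 * expR (- q * l).
  by rewrite e1 mulrCA [leRHS]mulrC; apply: ler_wpM2l => //; exact: expR_ge0.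
move: key e3; set X := expR (- q * l); set Y := (S + B') * _; lra.
Qed.

Lemma fhat_upper N : (forall k, ~ Kset n.+1 mu c k) -> exists2 B : R, 0 <= B &
  forall eta : 'rV[R]_n.+1, 1 <= `|eta 0 ord0| -> normc (fhat eta) *
    `|eta 0 ord0| ^+ N <= B.
Proof.
move=> K0; have [M [NM kN]] := expansion_order N.
have [B B0 hB] := fhat_asymptotics NM kN; exists B => // eta eta1.
have := hB eta ord0 eta1; rewrite /main_term big1 ?subr0// => k _.
rewrite (eqP (_ : Dcoef n mu c N k == 0)) ?mul0r//.
by rewrite (Dcoef_eq0 _ mu0 (kN _ (ltn_ord k)));
  apply/eqP/(dcoef_eq0 (kN _ (ltn_ord k)))/K0.
Qed.

Lemma powR_expR (a b : R) : 0 < a -> a `^ b = expR (b * ln a).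
Proof. by move=> a0; rewrite /powR gt_eqF. Qed.

(** Since A >= q + 1 there is a spare factor 1/a, and a >= A > 1/d makes it smaller than d. *)
Lemma powR_lt_lower (A q d a r : R) : 0 < q -> q + 1 <= A -> 1 < A * d -> A <= a ->
  0 < r -> r <= a -> a `^ (- A) < d * expR (- q * ln r).
Proof.
move=> q0 qA Ad Aa r0 ra; have a1 : 1 <= a by lra.
have a0 : 0 < a by lra.
have A0' : 0 < A by lra.
have d0 : 0 < d by rewrite -(pmulr_rgt0 _ A0'); lra.
have la : 0 <= ln a by exact: ln_ge0.
have lra' : ln r <= ln a by rewrite ler_ln ?posrE.
rewrite powR_expR//; apply: le_lt_trans (_ : expR (- q * ln a) * a^-1 < _).
  rewrite -[X in _ * X^-1](@lnK _ a) ?posrE// -expRN -expRD ler_expR; nra.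
apply: lt_le_trans (_ : expR (- q * ln a) * d <= _).
  by rewrite ltr_pM2l ?expR_gt0// -[X in X < _]mul1r ltr_pdivrMr//; nra.
by rewrite mulrC ler_pM2l// ler_expR !mulNr lerN2 ler_pM2l.
Qed.

Lemma invertible_of_Kset : Kset n.+1 mu c !=set0 -> invertible_distribution u.
Proof.
move=> [k1 Kk1]; split; first exact: (radial_compact_distribution sphi phi1 mu0 asym).
have ex : exists k, `[< Kset n.+1 mu c k >] by exists k1; exact/asboolP.
have [q [d [r0 [q0 d0 r00 hl]]]] : exists q d r0 : R, [/\ 0 < q, 0 < d, 0 < r0 &
    forall eta : 'rV[R]_n.+1, r0 <= enorm eta -> d * expR (- q *
      ln (enorm eta)) <= normc (fhat eta)].
  case: (ex_minnP ex) => k0 /asboolP Kk0 mink; apply: (fhat_lower Kk0) => k kk0.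
  by move/asboolP/mink; rewrite leqNgt kk0.
have l2 : 0 < ln (2 : R) by rewrite ln_gt0// ltr1n.
(* One summand per requirement: q + 1 and 1/d for [powR_lt_lower], r0 for |eta| <= A + |xi|, and 2
   r0 / ln 2 so that a point of norm r0 lies within A ln 2 of every xi with |xi| < r0. *)
pose A := q + 1 + d^-1 + r0 + 2 * r0 / ln 2.
have d1 : 0 < d^-1 by rewrite invr_gt0.
have rl : 0 < 2 * r0 / ln 2 by rewrite divr_gt0// mulr_gt0.
have A1 : q + 1 <= A by rewrite /A; lra.
have Ad : 1 < A * d.
  have -> : A * d = 1 + (q + 1 + r0 + 2 * r0 / ln 2) * d.
    by rewrite /A; field; rewrite !gt_eqF.
  by rewrite ltrDl mulr_gt0//; lra.
have Ap : 0 < A by lra.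
exists A => // xi.
have xi0 : 0 <= enorm xi by exact: enorm_ge0.
have lxi : ln 2 <= ln (2 + enorm xi) by rewrite ler_ln ?posrE; lra.
have sup eta : enorm (eta - xi) < A * ln (2 + enorm xi) -> r0 <= enorm eta ->
    enorm eta <= A + enorm xi ->
    (((A + enorm xi) `^ (- A))%:E <
     ereal_sup [set (normc (fourier u (map_mx (real_complex R) eta)))%:E
               | eta in [set eta : 'rV[R]_n.+1 |
                   (enorm (eta - xi) < A * ln (2 + enorm xi))%R]])%E.
  move=> h1 h2 h3; apply: (@lt_le_trans _ _ (normc (fhat eta))%:E).
    rewrite lte_fin; apply: lt_le_trans (hl eta h2).
    by apply: powR_lt_lower => //; lra.
  by apply: ereal_sup_ubound; exists eta.
have [h|h] := leP r0 (enorm xi).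
  by apply: (sup xi); rewrite ?subrr ?enorm0 ?mulr_gt0//; lra.
(* When |xi| < r0 the lower bound says nothing at xi itself, and a fixed vector of norm r0 is tested
   instead. *)
have er : enorm (r0 *: delta_mx 0 ord0 : 'rV[R]_n.+1) = r0 by rewrite enorm_delta gtr0_norm.
apply: (sup (r0 *: delta_mx 0 ord0)); rewrite ?er//; last by rewrite /A; lra.
apply: le_lt_trans (_ : 2 * r0 < _); first by apply: enormB_le; rewrite ?er// ltW.
apply: lt_le_trans (_ : A * ln 2 <= _); last by rewrite ler_pM2l.
by rewrite -ltr_pdivrMr// /A; lra.
Qed.

(** Rapid decrease is tested at xi = (T, 0, ..., 0). Within A ln(2 + T) <= T/2 of it the first
    coordinate stays above T/2, and decay of order m + 1 with m > A beats (A + T)^-A with a power of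
    T to spare for the constant. *)
Lemma Kset_of_invertible : invertible_distribution u -> Kset n.+1 mu c !=set0.
Proof.
move=> [_ [A Ap hA]]; apply: contrapT => K0.
have K0' k : ~ Kset n.+1 mu c k by move=> Kk; apply: K0; exists k.
pose m := (Num.truncn A).+1.
have Am : A < m%:R by exact: truncnS_gt.
have [B B0 hB] := fhat_upper m.+1 K0'.
pose b := B * 4 ^+ m.+1.
have b0 : 0 <= b by rewrite mulr_ge0// exprn_ge0.
(* [T] is chosen so that ln(2 + T) = v. The summand 4 A + 4 makes e^v outgrow the search radius A v,
   which stays below T/2; the summand b lets T absorb the constant. *)
pose v := 4 * A + 4 + b; pose T := expR v - 2.
have v0 : 4 <= v by rewrite /v; lra.
have Tv : 2 * A * v + 2 * v - 1 <= T.
  have := @expR_ge1Dxn R v 1 ltac:(lra); rewrite (_ : 2`! = 2)%N// => h.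
  have : v * (4 * A + 4) <= v ^+ 2 by rewrite expr2 ler_pM2l /v; lra.
  by rewrite /T; lra.
have Av : 0 <= A * v by rewrite mulr_ge0//; lra.
have T1 : b + 7 + A <= T by move: Tv; rewrite /v in Av *; lra.
have lT : A * ln (2 + T) <= T / 2.
  by rewrite /T addrC subrK expRK; rewrite -/T; lra.
have Tp : 0 < T by lra.
have := hA (T *: delta_mx 0 ord0); rewrite enorm_delta gtr0_norm//.
apply/negP; rewrite -leNgt.
apply: (@le_trans _ _ (B / (T / 2) ^+ m.+1)%:E).
  apply: ge_ereal_sup => _ [eta heta <-]; rewrite lee_fin -/(fhat eta).
  have {}heta : enorm (eta - T *: delta_mx 0 ord0) < A * ln (2 + T).
    by [].
  have h0 : `|eta 0 ord0 - T| < T / 2.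
    apply: lt_le_trans lT; apply: le_lt_trans heta.
    have := le_enorm (eta - T *: delta_mx 0 ord0) ord0.
    by rewrite !mxE !eqxx mulr1.
  have h1 : T / 2 <= `|eta 0 ord0|.
    move: h0; rewrite ltr_norml => /andP[h0 _].
    by apply: le_trans (ler_norm _); lra.
  rewrite ler_pdivlMr ?exprn_gt0 ?divr_gt0//.
  apply: le_trans (hB eta _); last by lra.
  apply: ler_wpM2l; first exact: normc_ge0.
  by rewrite lerXn2r ?nnegrE//; lra.
rewrite lee_fin powR_expR; last by lra.
apply: (@le_trans _ _ (((2 * T) ^+ m)^-1)).
  rewrite (_ : T / 2 = 2 * T / 4); last by field.
  rewrite expr_div_n invf_div mulrA -/b ler_pdivrMr ?exprn_gt0 ?mulr_gt0//.
  rewrite exprS mulrCA mulVf ?mulr1 ?expf_neq0; lra.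
have T2 : 0 < 2 * T by lra.
rewrite -[2 * T](@lnK _ _) ?posrE// -expRM_natl -expRN ler_expR mulNr lerN2.
have l1 : 0 <= ln (A + T) by apply: ln_ge0; lra.
apply: ler_pM => //; first exact: ltW.
  exact: ltW.
by rewrite ler_ln ?posrE; lra.
Qed.

End invertibility.

Theorem theorem4p9 (R : realType) (n : nat) (phi : R -> R[i]) (mu : R[i])
    (c : nat -> R[i]) :
  (2 <= n)%N ->
  smooth_on_pos phi ->
  (forall s : R, 1 <= s -> phi s = 0) ->
  -1 < @complex.Re R (mu + (n%:R / 2 - 1)) ->
  c 0%N != 0 ->
  (forall j : nat, asymptotic_expansion j phi mu c) ->
  invertible_distribution (distribution_of_fun (@radial_fun R n phi)) <->
  Kset n mu c !=set0.
Proof.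
case: n => [//|n] _ sphi phi1 mu0 _ asym.
have mu0' : 0 < cRe mu + n.+1%:R / 2.
  move: mu0; rewrite !cReD cRe_half (cRe_nat _).1 cReN /=; lra.
split; first exact: (Kset_of_invertible sphi phi1 mu0' asym).
exact: (invertible_of_Kset sphi phi1 mu0' asym).
Qed.
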